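(* Let $\mu(s)=|s|^{p-2}s$ with $1<p\le2$, and let the data $\ell,\alpha,\beta,u_0,u_\partial,\underline u,\overline u$ satisfy the standing assumptions stated in the context. Then there exist positive constants $c_1^*,c_2^*,\gamma,\gamma'$ such that for every $0<T<\infty$ the following holds. Let $u$ be the regular weak solution on $(0,T)$ of $$\partial_t\beta(u)-\partial_x(\mu(\partial_xu))=0\quad (0<x<\ell,\ t>0),\qquad n\,\mu(\partial_xu)+\alpha u=\alpha u_\partial\quad (x\in\{0,\ell\},\ t>0),\qquad u(0)=u_0,$$ where $n=-1$ at $x=0$ and $n=1$ at $x=\ell$. For each $t$ let $\hat u(t)$ be the solution of the stationary problem $$-\partial_x\mu(\partial_x\hat u)=0\ \text{ in }(0,\ell),\qquad n\,\mu(\partial_x\hat u)+\alpha\hat u=\alpha\hat u_\partial\ \text{ on }\{0,\ell\},$$ with boundary data $\hat u_\partial=u_\partial(t)$. Then for all $0\le s\le t\le T$, $$\|u(t)-\hat u(t)\|_{L^2(0,\ell)}^2\le c_1^*\,e^{-\gamma(t-s)}\,\|u(s)-\hat u(s)\|_{L^2(0,\ell)}^2+c_2^*\int_s^te^{-\gamma'(t-r)}\,\|\partial_tu_\partial(r)\|_\partial^2\,dr .$$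
   Context: Standing assumptions. $\ell>0$; $\alpha>0$ is a constant. $\beta\in C^0(\mathbb R)$ is $C^1$ on $\mathbb R\setminus\{0\}$ with $\beta'>0$ there, and $B(u):=\int_0^u\beta(s)\,ds$ is coercive. With $M(s):=\int_0^s\mu(\tilde s)\,d\tilde s=|s|^p/p$, $u_0\in L^\infty(0,\ell)$ is weakly differentiable with $M(\partial_x u_0)\in L^1(0,\ell)$. $u_\partial\in W^{1,\infty}((0,\infty)\times\{0,\ell\})$, i.e. $u_\partial$ is a bounded Lipschitz function of time at each of the two endpoints. There are constants $\underline u,\overline u>0$ with $0<\underline u\le u_0\le\overline u$ and $\underline u\le u_\partial\le\overline u$ uniformly in $x$ and $t$. Notation: $\langle f,g\rangle=\int_0^\ell fg\,dx$, $\langle f,g\rangle_\partial=f(0)g(0)+f(\ell)g(\ell)$, $\|f\|_\partial^2=\langle f,f\rangle_\partial$. Regular weak solution on $(0,T)$: a function $u\in L^p(0,T;W^{1,p}(0,\ell))$ whose transform has an integrable time derivative, i.e. $\beta(u)\in W^{1,1}(0,T;L^1(0,\ell))$, with $\beta(u)|_{t=0}=\beta(u_0)$, and such that for a.e. $t\in(0,T)$ and all $v\in H^1(0,\ell)$ $$\langle\partial_t\beta(u),v\rangle+\langle\mu(\partial_xu),\partial_xv\rangle+\alpha\langle u,v\rangle_\partial=\alpha\langle u_\partial(t),v\rangle_\partial.$$ If $\mu(s)=|s|^{p-2}s$ with $1<p\le2$, $\ell>0$, $\alpha>0$ is constant, $\beta\in C^0(\mathbb R)$ is $C^1$ on $\mathbb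 R\setminus\{0\}$ with $\beta'>0$ there and has coercive primitive $\int_0^u\beta(s)\,ds$, $u_0\in L^\infty(0,\ell)$ is weakly differentiable with $|\partial_xu_0|^p\in L^1(0,\ell)$, $u_\partial\in W^{1,\infty}((0,\infty)\times\{0,\ell\})$, and $0<\underline u\le u_0,u_\partial\le\overline u$ uniformly in $x$ and $t$, then for every $0<T<\infty$ there is exactly one regular weak solution on $(0,T)$; it belongs to $L^\infty(0,T;W^{1,p}(0,\ell))\cap H^1(0,T;L^2(0,\ell))$ (so $u(t)\in L^2(0,\ell)$ is defined for every $t\in[0,T]$) and satisfies $\underline u\le u\le\overline u$. The stationary problem has a unique solution, which is affine in $x$. *)

(* Defs.v *)
From HB Require Import structures.
From mathcomp Require Import all_boot all_order all_algebra.
From mathcomp Require Import all_classical all_reals all_analysis.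

Set Implicit Arguments.
Unset Strict Implicit.
Unset Printing Implicit Defensive.

Import Order.TTheory GRing.Theory Num.Theory.
Import numFieldNormedType.Exports.

Local Open Scope classical_set_scope.
Local Open Scope ring_scope.

Notation leb R := (@lebesgue_measure R).

Definition in_Lp (d : measure_display) (X : measurableType d) (R : realType)
    (m : {measure set X -> \bar R}) (q : \bar R) (D : set X) (f : X -> R) : Prop :=
  f \_ D \in Lfun m q.

Definition Lp_dist (R : realType) (q : \bar R) (I : set R) (f g : R -> R) : \bar R :=
  Lnorm (leb R) q (EFin \o ((fun x => f x - g x) \_ I)).

Definition space_time (R : realType) (T l : R) :
    set (measurableTypeR R * measurableTypeR R) :=
  `]0, T[%classic `*` `]0, l[%classic.

(* Testing with C^1_c functions gives the same weak derivatives as C^oo_c. *)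
Definition test_function (R : realType) (I : set R) (phi : R -> R) : Prop :=
  [/\ forall x, derivable phi x 1,
      continuous (derive1 phi)
    & exists K : set R, [/\ compact K, K `<=` I & forall x, ~ K x -> phi x = 0]].

Definition weak_derivative (R : realType) (I : set R) (f df : R -> R) : Prop :=
  [/\ locally_integrable I f, locally_integrable I df
    & forall phi : R -> R, test_function I phi ->
        \int[leb R]_(x in I) (f x * derive1 phi x)
        = - \int[leb R]_(x in I) (df x * phi x)].

(* For an open interval [I], every class of W^{1,q}(I) has exactly one
   representative that is continuous up to the boundary.  [sobolev] singles that
   representative out, so that the values of [f] at the finite end points of [I]
   are its traces. *)
Definition sobolev (R : realType) (q : \bar R) (I : set R) (f df : R -> R) : Prop :=
  [/\ in_Lp (leb R) q I f, in_Lp (leb R) q I df, weak_derivative I f df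
    & {within closure I, continuous f}].

(* At [s = 0] with [p < 2], [`|s| `^ (p - 2)] is 0 by convention, so the value
   is 0, the continuous extension. *)
Definition mu_p (R : realType) (p : R) (s : R) : R := `|s| `^ (p - 2) * s.

(* The primitive of [mu_p p] vanishing at 0. *)
Definition M_p (R : realType) (p : R) (s : R) : R := `|s| `^ p / p.

Definition inner (R : realType) (l : R) (f g : R -> R) : R :=
  \int[leb R]_(x in `]0, l[%classic) (f x * g x).

Definition inner_bd (R : realType) (l : R) (f g : R -> R) : R :=
  f 0 * g 0 + f l * g l.

Definition sqnorm (R : realType) (l : R) (f : R -> R) : R := inner l f f.

Definition sqnorm_bd (R : realType) (l : R) (f : R -> R) : R := inner_bd l f f.

Definition primitive (R : realType) (beta : R -> R) (u : R) : R :=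
  if 0 <= u then \int[leb R]_(s in `[0, u]%classic) beta s
  else - \int[leb R]_(s in `[u, 0]%classic) beta s.

Definition coercive (R : realType) (B : R -> R) : Prop :=
  (B x @[x --> +oo] --> +oo) /\ (B x @[x --> -oo] --> +oo).

(* Boundary data are functions [ub t x] of time and of the boundary point [x],
   of which only the values at [x = 0] and [x = l] matter; [dub] is the weak time
   derivative of [ub]. *)
Record standing_assumptions (R : realType) (p l alpha : R) (beta u0 : R -> R)
    (ub dub : R -> R -> R) (ulo uhi : R) : Prop := {
  sa_l : 0 < l ;
  sa_alpha : 0 < alpha ;
  sa_beta_cont : continuous beta ;
  sa_beta_C1 : forall x : R, x != 0 ->
    [/\ derivable beta x 1, {for x, continuous (derive1 beta)} & 0 < derive1 beta x] ;
  sa_B : coercive (primitive beta) ;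
  sa_u0_bounded : in_Lp (leb R) +oo%E `]0, l[%classic u0 ;
  sa_u0_deriv : exists du0 : R -> R,
    weak_derivative `]0, l[%classic u0 du0 /\
    in_Lp (leb R) 1%:E `]0, l[%classic (M_p p \o du0) ;
  sa_ub : forall x : R, x = 0 \/ x = l ->
    sobolev +oo%E `]0, +oo[%classic (fun t => ub t x) (fun t => dub t x) ;
  sa_ulo : 0 < ulo ;
  sa_uhi : 0 < uhi ;
  sa_u0_range : {ae leb R, forall x, x \in `]0, l[ -> ulo <= u0 x <= uhi} ;
  sa_ub_range : forall t x : R, 0 < t -> x = 0 \/ x = l -> ulo <= ub t x <= uhi
}.

(* [w] and [wt] stand for the L^1(0,l)-valued maps t |-> w t and t |-> wt t.
   L^1(0,T;L^1(0,l)) is identified with L^1((0,T) x (0,l)), where the Bochner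
   integrals of the weak derivative identity are computed for a.e. x. *)
Definition W11_time (R : realType) (T l : R) (w wt : R -> R -> R) : Prop :=
  [/\ in_Lp (leb R \x leb R)%E 1%:E (space_time T l) (fun z => w z.1 z.2),
      in_Lp (leb R \x leb R)%E 1%:E (space_time T l) (fun z => wt z.1 z.2)
    & forall phi : R -> R, test_function `]0, T[%classic phi ->
        {ae leb R, forall x, x \in `]0, l[ ->
          \int[leb R]_(t in `]0, T[%classic) (w t x * derive1 phi t)
          = - \int[leb R]_(t in `]0, T[%classic) (wt t x * phi t)}].

(* [W] is the representative in C([0,T]; L^q(0,l)) of the L^q(0,l)-valued map
   t |-> w t, which is only determined for a.e. t. *)
Definition continuous_version (R : realType) (q : \bar R) (T l : R)
    (w W : R -> R -> R) : Prop :=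
  [/\ forall t, t \in `[0, T] -> in_Lp (leb R) q `]0, l[%classic (W t),
      {ae leb R, forall t, t \in `]0, T[ ->
        {ae leb R, forall x, x \in `]0, l[ -> W t x = w t x}}
    & forall t, t \in `[0, T] ->
        Lp_dist q `]0, l[%classic (W s) (W t)
          @[s --> within `[0, T]%classic (nbhs t)] --> 0%E].

(* L^p(0,T;W^{1,p}(0,l)) is described by a jointly measurable [u] with [u t]
   continuous on [0,l] for a.e. t, together with its space derivative [ux];
   both are p-integrable on (0,T) x (0,l). *)
Definition regular_weak_solution (R : realType) (p l alpha : R)
    (beta u0 : R -> R) (ub : R -> R -> R) (T : R) (u : R -> R -> R) : Prop :=
  exists ux bt : R -> R -> R,
  [/\ [/\ in_Lp (leb R \x leb R)%E p%:E (space_time T l) (fun z => u z.1 z.2),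
          in_Lp (leb R \x leb R)%E p%:E (space_time T l) (fun z => ux z.1 z.2)
        & {ae leb R, forall t, t \in `]0, T[ ->
            sobolev p%:E `]0, l[%classic (u t) (ux t)}],
      W11_time T l (fun t => beta \o u t) bt,
      exists W : R -> R -> R,
        continuous_version 1%:E T l (fun t => beta \o u t) W /\
        {ae leb R, forall x, x \in `]0, l[ -> W 0 x = beta (u0 x)}
    & {ae leb R, forall t, t \in `]0, T[ ->
        forall v dv : R -> R, sobolev 2%:E `]0, l[%classic v dv ->
          inner l (bt t) v + inner l (mu_p p \o ux t) dv
            + alpha * inner_bd l (u t) v
          = alpha * inner_bd l (ub t) v}].

(* Weak form, with the same test space as the evolution problem. *)
Definition stationary_solution (R : realType) (p l alpha : R) (g : R -> R)
    (w : R -> R) : Prop :=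
  exists dw : R -> R,
    sobolev p%:E `]0, l[%classic w dw /\
    forall v dv : R -> R, sobolev 2%:E `]0, l[%classic v dv ->
      inner l (mu_p p \o dw) dv + alpha * inner_bd l w v = alpha * inner_bd l g v.

(* Main.v *)
Require Import Defs.
From HB Require Import structures.
From mathcomp Require Import all_boot all_order all_algebra.
From mathcomp Require Import all_classical all_reals all_analysis.
From mathcomp Require Import measurable_realfun ess_sup_inf.
From mathcomp Require Import ring lra.
Set Implicit Arguments.
Unset Strict Implicit.
Unset Printing Implicit Defensive.
Import Order.TTheory GRing.Theory Num.Theory.
Import numFieldNormedType.Exports.
Local Open Scope classical_set_scope.
Local Open Scope ring_scope.

(* The relative entropy [E(t) = \int (Psi(beta u) + B(a) - a * beta u)], where [B] is the
   primitive of [beta], [Psi] its Legendre transform and [a] the stationary profile at time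
   [t], is comparable to the squared L^2 distance of [u] and [a], because [beta] is
   bi-Lipschitz on the range of [u].  Its time derivative is
   [\int (u - a) d_t(beta u) + \int (beta a - beta u) d_t a].  Testing the difference of the
   two problems with [u - a] bounds the first term by [- c * ||u - a||^2]: the monotone flux
   controls [\int min(z^2, |z|)] for [z = d_x (u - a)] (the slope of [a] is bounded), which
   together with the boundary term controls [u - a].  Stationary profiles are
   affine and Lipschitz in the boundary data, so the second term is at most
   [C * ||u - a|| * ||d_t u_bd||].  Gronwall's lemma concludes.

   For a.e. [x] the path [t |-> beta (u t x) = w0 x + \int_0^t F (r, x) dr] is absolutely
   continuous, so the chain rule is only needed in one variable, as a differential inequality between convex functions
   and their subgradients. *)

(** The definition of a weak solution provides a time derivative for [beta (u)] only, with values in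
    L^1, and [beta'] may vanish or blow up at 0. Hence [||u - a||^2] cannot be differentiated
    directly, and [beta] is bi-Lipschitz along [u] only once [u] is known to stay away from 0. The
    bounds [ulo <= u <= uhi] are therefore proved first, by a comparison argument that is itself an
    entropy inequality, with zero profile and a convex [Psi] built from a smooth step. Both uses
    share the inverse [g] of [beta] on [[ulo / 2, uhi + 2]], clamped so that it is bounded and
    Lipschitz on the whole line; the margins around [[ulo, uhi]] let the step saturate by the time
    the clamp acts. For [p < 2] the difference [u - a] need not lie in H^1, so it becomes an
    admissible test function only through truncation of its derivative. Since the flux is coercive
    only linearly for large slopes, the quadratic estimate also consumes the uniform bound on
    [u - a]. The constants come from [l], [alpha], [p], [ulo], [uhi] and [beta], so none depends on
    [T]. *)

Definition itg (d : measure_display) (T : measurableType d) (R : realType)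
    (m : {measure set T -> \bar R}) (D : set T) (f : T -> R) : Prop :=
  m.-integrable D (EFin \o f).

(** * Integrability and integrals of real-valued functions *)

Section real_integrable.
Context {d : measure_display} {T : measurableType d} {R : realType}.
Variables (m : {measure set T -> \bar R}) (D : set T) (mD : measurable D).
Implicit Types f g c : T -> R.

Lemma itg_meas f : itg m D f -> measurable_fun D f.
Proof. by move=> /measurable_int/measurable_EFinP. Qed.

Lemma itg_dom f g : measurable_fun D f -> itg m D g ->
  (forall x, D x -> `|f x| <= g x) -> itg m D f.
Proof.
move=> mf ig fg; apply: (le_integrable mD _ _ ig).
  exact/measurable_EFinP.
move=> x Dx /=; rewrite lee_fin (le_trans (fg _ Dx))//.
exact: ler_norm.
Qed.

Lemma itgD f g : itg m D f -> itg m D g -> itg m D (fun x => f x + g x).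
Proof. by move=> h1 h2; have := integrableD mD h1 h2. Qed.

Lemma itgB f g : itg m D f -> itg m D g -> itg m D (fun x => f x - g x).
Proof. by move=> h1 h2; have := integrableB mD h1 h2. Qed.

Lemma itgN f : itg m D f -> itg m D (fun x => - f x).
Proof. by move=> h; have := integrableN h. Qed.

Lemma itgZ f (k : R) : itg m D f -> itg m D (fun x => k * f x).
Proof. by move=> h; have := integrableZl mD k h. Qed.

Lemma itg_abs f : itg m D f -> itg m D (fun x => `|f x|).
Proof. by move=> ?; exact: integrable_norm. Qed.

Lemma itg_eq f g : (forall x, D x -> f x = g x) -> itg m D f -> itg m D g.
Proof.
by move=> fg; apply: eq_integrable => // x /set_mem Dx /=; rewrite fg.
Qed.

Lemma itgMb c f (M : R) : measurable_fun D c ->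
  (forall x, D x -> `|c x| <= M) -> itg m D f -> itg m D (fun x => c x * f x).
Proof.
move=> mc cM itf; apply: (@itg_dom _ (fun x => M * `|f x|)).
- by apply: measurable_funM => //; exact: itg_meas.
- by apply: itgZ; exact: itg_abs.
- by move=> x Dx; rewrite normrM ler_wpM2r// cM.
Qed.

Lemma itg_cst (k : R) : (m D < +oo)%E -> itg m D (fun=> k).
Proof.
move=> mDoo; apply/integrableP; split; first exact: measurable_cst.
by rewrite integral_cst//= lte_mul_pinfty.
Qed.

Lemma itgS (A : set T) f : measurable A -> A `<=` D -> itg m D f -> itg m A f.
Proof. by move=> mA AD; exact: integrableS. Qed.

Lemma itg_patch f : itg m D f -> itg m setT (f \_ D).
Proof.
move=> itf; rewrite /itg -restrict_EFin; apply/integrable_restrict => //=.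
by rewrite setTI.
Qed.

Lemma ae_le_Rintegral f g : itg m D f -> itg m D g ->
  {ae m, forall x, D x -> f x <= g x} ->
  \int[m]_(x in D) f x <= \int[m]_(x in D) g x.
Proof.
move=> itf itg_ fg.
have mf := itg_meas itf; have mg := itg_meas itg_.
(* [Num.min (f x) (g x)] agrees with [f] almost everywhere and is below [g] everywhere, so pointwise
   monotonicity of the integral applies to it. *)
have mm : measurable_fun D (fun x => Num.min (f x) (g x)).
  exact: measurable_minr.
have -> : \int[m]_(x in D) f x = \int[m]_(x in D) Num.min (f x) (g x).
  rewrite /Rintegral; congr fine; apply: ae_eq_integral => //.
  - exact/measurable_EFinP.
  - exact/measurable_EFinP.
  - by apply: filterS fg => x fgx Dx; rewrite min_l// fgx.
apply: le_Rintegral => //.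
- apply: (@itg_dom _ (fun x => `|f x| + `|g x|)) => //.
    by apply: itgD; exact: itg_abs.
  by move=> x _; rewrite minEle; case: ifP => _; rewrite ?lerDl ?lerDr.
- by move=> x _; rewrite ge_min lexx orbT.
Qed.

Lemma ae_eq_Rintegral f g : measurable_fun D f -> measurable_fun D g ->
  {ae m, forall x, D x -> f x = g x} ->
  \int[m]_(x in D) f x = \int[m]_(x in D) g x.
Proof.
move=> mf mg fg; rewrite /Rintegral; congr fine; apply: ae_eq_integral => //.
- exact/measurable_EFinP.
- exact/measurable_EFinP.
- by apply: filterS fg => x fgx Dx; rewrite fgx.
Qed.

Lemma ae_itg f g : measurable_fun D f -> itg m D g ->
  {ae m, forall x, D x -> `|f x| <= g x} -> itg m D f.
Proof.
move=> mf ig fg.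
have mg := itg_meas ig.
apply/integrableP; split; first exact/measurable_EFinP.
have /integrableP[_] := ig; apply: le_lt_trans.
apply: ae_ge0_le_integral => //.
- by apply: measurableT_comp => //; exact/measurable_EFinP.
- by apply: measurableT_comp => //; exact/measurable_EFinP.
- apply: filterS fg => x fgx Dx /=; rewrite lee_fin (le_trans (fgx Dx))//.
  exact: ler_norm.
Qed.

Lemma Rintegral_eq0_ae f : itg m D f -> (forall x, D x -> 0 <= f x) ->
  \int[m]_(x in D) f x = 0 -> {ae m, forall x, D x -> f x = 0}.
Proof.
move=> itf f0 f_0.
have mf := itg_meas itf.
have : (\int[m]_(x in D) `|(f x)%:E| = 0)%E.
  rewrite (_ : (\int[m]_(x in D) `|(f x)%:E| = \int[m]_(x in D) (f x)%:E)%E).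
    rewrite -[LHS]fineK ?[fine _]f_0//; exact: integrable_fin_num.
  by apply: eq_integral => x /set_mem Dx; rewrite gee0_abs// lee_fin f0.
move=> /(ae_eq_integral_abs _ mD _).1 h.
have /h : measurable_fun D (EFin \o f) by exact/measurable_EFinP.
by apply: filterS => x /[apply] -[].
Qed.

End real_integrable.

(** * Integrals over open intervals and the passage from local to global estimates *)

Section open_interval_integral.
Context {R : realType}.
Notation mu := (@lebesgue_measure R).
Implicit Types (f g h F : R -> R).

(** For [t <= s] the interval is empty and the value is 0, so this is not the oriented integral;
    additivity is available for [s <= r <= t] only. *)
Definition oint f (s t : R) : R := \int[mu]_(x in `]s, t[%classic) f x.

Definition oitg f (s t : R) : Prop := itg mu `]s, t[%classic f.

Lemma oitgS f a b s t : a <= s -> t <= b -> oitg f a b -> oitg f s t.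
Proof.
move=> as_ tb; apply: itgS => // x /=; rewrite !in_itv/= => /andP[sx xt].
by rewrite (le_lt_trans as_ sx) (lt_le_trans xt tb).
Qed.

Lemma leb_oo_lty (s t : R) : (mu `]s, t[%classic < +oo)%E.
Proof.
rewrite lebesgue_measure_itv/=; case: ifPn => // _.
by rewrite -EFinB ltry.
Qed.

Lemma oitg_cst (k s t : R) : oitg (fun=> k) s t.
Proof. by apply: itg_cst => //; exact: leb_oo_lty. Qed.

Lemma oint_cst (k s t : R) : s <= t -> oint (fun=> k) s t = k * (t - s).
Proof.
move=> st; transitivity (k * fine (mu `]s, t[%classic)); first exact: Rintegral_cst.
rewrite lebesgue_measure_itv/= lte_fin.
by move: st; rewrite le_eqVlt => /predU1P[->|->//]; rewrite ltxx subrr.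
Qed.

Lemma oint_cat f (s r t : R) : s <= r -> r <= t -> oitg f s t ->
  oint f s t = oint f s r + oint f r t.
Proof.
move=> sr rt itf.
have isr : oitg f s r by apply: oitgS itf.
move: sr; rewrite le_eqVlt => /predU1P[<-|sr].
  by rewrite {2}/oint set_itv_ge ?bnd_simp ?ltxx// Rintegral_set0 add0r.
move: rt; rewrite le_eqVlt => /predU1P[->|rt].
  by rewrite {3}/oint set_itv_ge ?bnd_simp ?ltxx// Rintegral_set0 addr0.
have -> : oint f s r = \int[mu]_(x in `]s, r]%classic) f x.
  exact: Rintegral_itv_bndo_bndc.
have := @Rintegral_itvB R f (BRight s) (BLeft t) r itf.
by rewrite !bnd_simp/= /oint => /(_ (ltW sr) rt) <-; rewrite addrC subrK.
Qed.

Lemma oint_le f g s t : oitg f s t -> oitg g s t ->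
  (forall x, s < x < t -> f x <= g x) -> oint f s t <= oint g s t.
Proof.
by move=> itf itg_ fg; apply: le_Rintegral => // x /=; rewrite in_itv/=; exact: fg.
Qed.

Lemma oint_eq f g s t : (forall x, s < x < t -> f x = g x) -> oint f s t = oint g s t.
Proof.
by move=> fg; apply: eq_Rintegral => x /set_mem/=; rewrite in_itv/=; exact: fg.
Qed.

Lemma ointD f g s t : oitg f s t -> oitg g s t ->
  oint (fun x => f x + g x) s t = oint f s t + oint g s t.
Proof. by move=> ? ?; exact: RintegralD. Qed.

Lemma ointB f g s t : oitg f s t -> oitg g s t ->
  oint (fun x => f x - g x) s t = oint f s t - oint g s t.
Proof. by move=> ? ?; exact: RintegralB. Qed.

Lemma ointZ k f s t : oitg f s t -> oint (fun x => k * f x) s t = k * oint f s t.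
Proof. by move=> ?; exact: RintegralZl. Qed.

Lemma ointN f s t : oitg f s t -> oint (fun x => - f x) s t = - oint f s t.
Proof.
move=> itf; rewrite -mulN1r -ointZ//.
by apply: oint_eq => x _; rewrite mulN1r.
Qed.

Lemma oint_ge0 f s t : (forall x, s < x < t -> 0 <= f x) -> 0 <= oint f s t.
Proof. by move=> f0; apply: Rintegral_ge0 => x /=; rewrite in_itv/=; exact: f0. Qed.

Lemma oint_abs f s t : oitg f s t -> `|oint f s t| <= oint (fun x => `|f x|) s t.
Proof. by move=> itf; exact: le_normr_Rintegral. Qed.

Lemma oint_xx f s : oint f s s = 0.
Proof. by rewrite /oint set_itv_ge ?bnd_simp ?ltxx// Rintegral_set0. Qed.

Lemma oint_cc f s t : oitg f s t ->
  \int[mu]_(x in `[s, t]%classic) f x = oint f s t.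
Proof.
move=> itf; have [ts|st] := ltP t s.
  rewrite /oint !set_itv_ge ?bnd_simp -?ltNge ?Rintegral_set0//.
  by rewrite -leNgt ltW.
move: st; rewrite le_eqVlt => /predU1P[<-|st].
  by rewrite oint_xx set_itv1 Rintegral_set1.
rewrite /oint Rintegral_itv_bndo_bndc// Rintegral_itv_obnd_cbnd//.
apply/integrableP; have /integrableP[mf foo] := itf.
have mf' : measurable_fun `]s, t]%classic (EFin \o f).
  rewrite -(@setUitv1 _ _ _ _ true) ?bnd_simp//; apply/measurable_funU => //.
  by split=> //; exact: measurable_fun_set1.
split => //.
rewrite -integral_itv_bndo_bndc//.
by apply: measurableT_comp => //; exact: mf.
Qed.

(** A compactness principle: the admissible size [d] may depend on the point [r], as for the gauges
    of Cousin's lemma. The supremum [c] of the [t] with [P a t] is attained, and the local property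
    at [c] pushes beyond it unless [c = b]. *)
Lemma cousin (P : R -> R -> Prop) (a b : R) : a <= b ->
  (forall s r t, a <= s -> s <= r -> r <= t -> t <= b -> P s r -> P r t -> P s t) ->
  (forall r, a <= r <= b -> exists2 d : R, 0 < d &
     forall s t, a <= s -> s <= r -> r <= t -> t <= b -> r - s < d -> t - r < d -> P s t) ->
  P a b.
Proof.
move=> ab Pcat Ploc.
pose S := [set t | a <= t <= b /\ P a t].
have Sa : S a.
  split; first by rewrite lexx.
  have [|d d0 H] := Ploc a; first by rewrite lexx.
  by apply: H => //; rewrite subrr.
have ubS : ubound S b by move=> t [/andP[]].
have supS : has_sup S by split; [exists a|exists b].
pose c := sup S.
have ac : a <= c by apply: ub_le_sup => //; exists b.
have cb : c <= b by apply: ge_sup => //; exists a.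
have [|d d0 H] := Ploc c; first by rewrite ac.
have [t0 [/andP[at0 t0b] Pt0] ct0] := sup_adherent d0 supS.
have t0c : t0 <= c by apply: ub_le_sup; [exists b|split=> //; rewrite at0].
(* The interval from [t0] to [e] contains [c] and is small enough for the local property there; as
   [c] is the supremum, [e] cannot exceed [c], which forces [e = b]. *)
pose e := Num.min b (c + d / 2).
have ce : c <= e by rewrite le_min cb/= lerDl divr_ge0// ltW.
have eb : e <= b by rewrite ge_min lexx.
have Pe : P a e.
  apply: (Pcat a t0 e) => //; first exact: le_trans ce.
  apply: H => //; first by move: ct0; rewrite -/c; lra.
  by rewrite /e ltrBlDl gt_min; apply/orP; right; lra.
have Se : S e by split=> //; rewrite eb (le_trans ac).
have ec : e <= c by apply: ub_le_sup => //; exists b.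
have : e = b.
  by move: ec; rewrite /e ge_min; case/orP => [bc|]; [rewrite min_l//; lra|lra].
by move=> <-.
Qed.

(** The errors [e * k] of the local estimates add up to [e] times one fixed integral. Because the
    estimate is required near every point of [[a, b]], [Phi] need not be differentiable anywhere and
    no Lebesgue differentiation enters. *)
Lemma local_to_global (Phi h k : R -> R) (a b : R) : a <= b ->
  oitg h a b -> oitg k a b ->
  (forall r e : R, a <= r <= b -> 0 < e -> exists2 d : R, 0 < d &
     forall s t, a <= s -> s <= r -> r <= t -> t <= b -> r - s < d -> t - r < d ->
       Phi t - Phi s <= oint (fun x => h x + e * k x) s t) ->
  Phi b - Phi a <= oint h a b.
Proof.
move=> ab ih ik H; apply/ler_addgt0Pr => e e0.
(* The maximum with 1 keeps the divisor positive, whatever the sign of the integral of [k]. *)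
have [M M0 Mk] : exists2 M : R, 0 < M & oint k a b <= M.
  by exists (Num.max 1 (oint k a b)); rewrite ?lt_max ?ltr01// le_max lexx orbT.
pose e' := e / M; have e'0 : 0 < e' by rewrite divr_gt0.
apply: (@le_trans _ _ (oint (fun x => h x + e' * k x) a b)); last first.
  rewrite ointD ?ointZ//; last by apply: itgZ.
  by rewrite lerD2l /e' mulrAC ler_pdivrMr// ler_wpM2l// ltW.
have ihk : oitg (fun x => h x + e' * k x) a b by apply: itgD => //; exact: itgZ.
apply: (@cousin (fun s t => Phi t - Phi s <= oint (fun x => h x + e' * k x) s t)) => //.
- move=> s r t as_ sr rt tb H1 H2; rewrite (@oint_cat _ s r t)//.
    by move: H1 H2; lra.
  exact: oitgS ihk.
- by move=> r rab; exact: H.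
Qed.

End open_interval_integral.

(** * Primitives of integrable functions and differential inequalities *)

Section primitives.
Context {R : realType}.
Notation mu := (@lebesgue_measure R).
Implicit Types (f g h F : R -> R).

Lemma cont_eps f (r e : R) : continuous f -> 0 < e -> \forall x \near r, `|f x - f r| <= e.
Proof.
move=> cf e0; have /cvgrPdist_le := cf r.
by move=> /(_ _ e0); apply: filterS => x; rewrite distrC.
Qed.

Lemma cont_meas f (D : set R) : measurable D -> continuous f -> measurable_fun D f.
Proof. by move=> mD cf; apply: measurable_funTS; exact: continuous_measurable_fun. Qed.

Lemma cont_bounded f (a b : R) : continuous f ->
  exists2 M : R, 0 < M & forall x, a <= x <= b -> `|f x| <= M.
Proof.
move=> cf; have [ab|ba] := leP a b; last first.
  by exists 1 => // x /andP[ax xb]; move: ba; rewrite ltNge (le_trans ax).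
have cfn : {within `[a, b], continuous (fun x => `|f x|)}.
  apply: continuous_subspaceT => x; apply: continuous_comp; first exact: cf.
  exact: norm_continuous.
have [c _ H] := EVT_max ab cfn.
exists (`|f c| + 1) => [|x xab]; first by rewrite ltr_wpDl.
by rewrite (le_trans (H x _)) ?in_itv//= lerDl.
Qed.

Lemma leb_oo_lt (s t e : R) : 0 < e -> t - s < e -> (mu `]s, t[%classic < e%:E)%E.
Proof.
move=> e0 ts; rewrite lebesgue_measure_itv/=; case: ifPn => _.
  by rewrite -EFinB lte_fin.
by rewrite lte_fin.
Qed.

Lemma oitgM (c f : R -> R) (a b : R) : continuous c -> oitg f a b -> oitg (fun x => c x * f x) a b.
Proof.
move=> cc itf; have [M _ HM] := cont_bounded a b cc.
apply: (@itgMb _ _ _ _ _ _ _ _ M) => //; first exact: cont_meas.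
by move=> x /=; rewrite in_itv/= => /andP[ax xb]; rewrite HM// !ltW.
Qed.

Lemma oitg_cont f (a b : R) : continuous f -> oitg f a b.
Proof.
move=> cf; have := oitgM cf (oitg_cst 1 a b).
by apply: itg_eq => // x _; rewrite mulr1.
Qed.

(** Absolute continuity in integral form. Derivatives on a bounded interval are extended by 0, which
    makes them integrable over the whole line and [f] constant outside. *)
Definition prim f df := itg mu setT df /\
  forall s t : R, s <= t -> f t - f s = oint df s t.

Lemma prim_oitg f df (a b : R) : prim f df -> oitg df a b.
Proof. by move=> [itf _]; apply: itgS itf. Qed.

(** Absolute continuity of the integral: the integral of [|k|] over short intervals is uniformly
    small. *)
Lemma dominated_continuous f (k : R -> R) : itg mu setT k ->
  (forall s t, s <= t -> `|f t - f s| <= oint k s t) -> continuous f.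
Proof.
move=> itk fk r; apply/cvgrPdist_lt => e e0.
have [d [d0 Hd]] := integral_normr_continuous itk e0.
have H s t : s <= t -> t - s < d -> `|f t - f s| < e.
  move=> st ts; apply: le_lt_trans (Hd `]s, t[%classic _ _) => //.
    rewrite (le_trans (fk _ _ st))//; apply: oint_le => [||x _]; last exact: ler_norm.
      exact: itgS itk.
    by apply: itg_abs => //; exact: itgS itk.
  exact: leb_oo_lt.
exists d => //= x /=; have [rx|xr] := leP r x.
  by rewrite ler0_norm ?subr_le0// opprB => ?; rewrite distrC; exact: H.
by rewrite gtr0_norm ?subr_gt0// => ?; apply: H => //; exact: ltW.
Qed.

Lemma prim_continuous f df : prim f df -> continuous f.
Proof.
move=> [itf H]; apply: (@dominated_continuous _ (fun x => `|df x|)).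
  exact: itg_abs.
by move=> s t st; rewrite H//; apply: oint_abs; exact: itgS itf.
Qed.

Lemma coef_le (c C e F : R) : `|c - C| <= e -> c * F <= C * F + e * `|F|.
Proof.
move=> ccC; rewrite -lerBlDl -mulrBl (le_trans (ler_norm _))// normrM.
by rewrite ler_wpM2r.
Qed.

(* A differential inequality [Phi' <= C1 F1 + C2 F2] for integrable [F1], [F2]
   follows from difference quotients whose coefficients converge. *)
Lemma chain_le (Phi F1 F2 C1 C2 : R -> R) (a b : R) : a <= b ->
  oitg F1 a b -> oitg F2 a b -> continuous C1 -> continuous C2 ->
  (forall r e : R, a <= r <= b -> 0 < e -> exists2 P : R -> Prop,
     (\forall x \near r, P x) &
     forall s t, a <= s -> s <= r -> r <= t -> t <= b -> P s -> P t ->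
       exists c1 c2 : R, [/\ Phi t - Phi s <= c1 * oint F1 s t + c2 * oint F2 s t,
         `|c1 - C1 r| <= e & `|c2 - C2 r| <= e]) ->
  Phi b - Phi a <= oint (fun x => C1 x * F1 x + C2 x * F2 x) a b.
Proof.
move=> ab i1 i2 cC1 cC2 H.
have iC1 : oitg (fun x => C1 x * F1 x) a b by exact: oitgM.
have iC2 : oitg (fun x => C2 x * F2 x) a b by exact: oitgM.
have iA : oitg (fun x => `|F1 x| + `|F2 x|) a b by apply: itgD => //; exact: itg_abs.
apply: (@local_to_global _ _ _ (fun x => `|F1 x| + `|F2 x|)) => //.
  exact: itgD.
(* One half of [e] is spent on the distance of the coefficients to their limits at [r], the other on
   the oscillation of [C1] and [C2] near [r]. *)
move=> r e rab e0; have e2 : 0 < e / 2 by rewrite divr_gt0.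
have [P nP HP] := H r _ rab e2.
have : \forall x \near r, [/\ P x, `|C1 x - C1 r| <= e / 2 & `|C2 x - C2 r| <= e / 2].
  by near=> x; split; near: x => //; exact: cont_eps.
move=> /nbhs_ballP[d /= d0 Hd]; exists d => // s t as_ sr rt tb rs tr.
have Bs x : s <= x -> x <= t -> ball r d x.
  move=> sx xt; rewrite /ball/= ltr_distlC; apply/andP; split; first lra.
  by move: tr; lra.
have [Ps _ _] := Hd s (Bs _ (lexx _) (le_trans sr rt)).
have [Pt _ _] := Hd t (Bs _ (le_trans sr rt) (lexx _)).
have [c1 [c2 [Hc c1C c2C]]] := HP s t as_ sr rt tb Ps Pt.
apply: (le_trans Hc).
have i1' : oitg F1 s t by exact: oitgS i1.
have i2' : oitg F2 s t by exact: oitgS i2.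
rewrite -!ointZ// -ointD; [|exact: itgZ|exact: itgZ].
apply: oint_le.
- by apply: itgD => //; exact: itgZ.
- apply: itgD => //; first by apply: itgD => //; [exact: oitgS iC1|exact: oitgS iC2].
  by apply: itgZ => //; exact: oitgS iA.
move=> x /andP[sx xt].
have [_ C1x C2x] := Hd x (Bs _ (ltW sx) (ltW xt)).
have K1 : `|c1 - C1 x| <= e.
  rewrite (le_trans (ler_distD (C1 r) _ _))// (splitr e) lerD//.
  by rewrite distrC.
have K2 : `|c2 - C2 x| <= e.
  rewrite (le_trans (ler_distD (C2 r) _ _))// (splitr e) lerD//.
  by rewrite distrC.
have q1 := coef_le (F1 x) K1; have q2 := coef_le (F2 x) K2; clear - q1 q2; lra.
Unshelve. all: by end_near. Qed.

(** The increment of the product is exactly [f t * (g t - g s) + g s * (f t - f s)], so [chain_le]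
    applies both to the product and to its negative. *)
Lemma prim_mul f df g dg (a b : R) : a <= b -> prim f df -> prim g dg ->
  f b * g b - f a * g a = oint (fun x => f x * dg x + g x * df x) a b.
Proof.
move=> ab pf pg.
have cf := prim_continuous pf; have cg := prim_continuous pg.
have idf : oitg df a b by exact: prim_oitg pf.
have idg : oitg dg a b by exact: prim_oitg pg.
have nP r (e : R) : 0 < e -> \forall x \near r, `|f x - f r| <= e /\ `|g x - g r| <= e.
  by move=> e0; near=> x; split; near: x; exact: cont_eps.
apply/eqP; rewrite eq_le; apply/andP; split.
  apply: (@chain_le (fun x => f x * g x)) => // r e rab e0.
  exists (fun x => `|f x - f r| <= e /\ `|g x - g r| <= e); first exact: nP.
  move=> s t as_ sr rt tb [fs gs] [ft gt_]; exists (f t), (g s); split=> //.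
  have st := le_trans sr rt.
  by rewrite -(pf.2 _ _ st) -(pg.2 _ _ st); lra.
rewrite -lerN2 -ointN; last by apply: itgD => //; exact: oitgM.
rewrite (@oint_eq _ _ (fun x => (- f x) * dg x + (- g x) * df x)); last first.
  by move=> x _; rewrite opprD !mulNr.
rewrite opprB addrC.
rewrite (_ : _ + _ = - (f b * g b) - - (f a * g a)); last by rewrite opprK.
apply: (@chain_le (fun x => - (f x * g x))) => //.
- by move=> x; apply: cvgN; exact: cf.
- by move=> x; apply: cvgN; exact: cg.
move=> r e rab e0.
exists (fun x => `|f x - f r| <= e /\ `|g x - g r| <= e); first exact: nP.
move=> s t as_ sr rt tb [fs gs] [ft gt_]; exists (- f t), (- g s).
split; [|by rewrite -opprD normrN..].
have st := le_trans sr rt.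
by rewrite -(pf.2 _ _ st) -(pg.2 _ _ st); lra.
Unshelve. all: by end_near. Qed.

(** The mean value theorem writes each increment as [Q' z * (f t - f s)] with [z] between [f s] and
    [f t]; applied to [P] and [- P], this gives both inequalities. *)
Lemma prim_comp (P P' f df : R -> R) (a b : R) : a <= b ->
  (forall y : R, is_derive y (1 : R) P (P' y)) -> continuous P' -> prim f df ->
  P (f b) - P (f a) = oint (fun x => P' (f x) * df x) a b.
Proof.
move=> ab dP cP' pf; have cf := prim_continuous pf.
have idf : oitg df a b by exact: prim_oitg pf.
have cP'f : continuous (P' \o f).
  by move=> x; apply: continuous_comp; [exact: cf|exact: cP'].
have key (Q Q' : R -> R) : (forall y : R, is_derive y (1 : R) Q (Q' y)) -> continuous Q' ->
    Q (f b) - Q (f a) <= oint (fun x => Q' (f x) * df x) a b.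
  move=> dQ cQ'.
  have cQ'f : continuous (Q' \o f).
    by move=> x; apply: continuous_comp; [exact: cf|exact: cQ'].
  rewrite (@oint_eq _ _ (fun x => (Q' \o f) x * df x + (cst 0 : R -> R) x * df x)); last first.
    by move=> x _; rewrite mul0r addr0.
  apply: (@chain_le (fun x => Q (f x))) => //; first by move=> x; exact: cvg_cst.
  move=> r e rab e0.
  have := cont_eps (f r) cQ' e0 => /nbhs_ballP[d /= d0 Hd].
  exists (fun x => `|f x - f r| < d).
    have d2 : 0 < d / 2 by rewrite divr_gt0.
    apply: filterS (cont_eps r cf d2) => x /le_lt_trans; apply.
    by rewrite ltr_pdivrMr// ltr_pMr// ltr1n.
  move=> s t as_ sr rt tb Ps Pt.
  have [z zst Hz] : exists2 z, `|z - f r| < d & Q (f t) - Q (f s) = Q' z * (f t - f s).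
    have cQ x y : {within `[x, y], continuous Q}.
      apply: continuous_subspaceT => u; apply: differentiable_continuous.
      by apply/derivable1_diffP; exact: (@ex_derive _ _ _ _ _ _ _ (dQ u)).
    have bw u v z : `|u - f r| < d -> `|v - f r| < d -> z \in `[u, v] -> `|z - f r| < d.
      rewrite !ltr_distl in_itv/= => /andP[? ?] /andP[? ?] /andP[? ?].
      by apply/andP; split; lra.
    have [st|ts] := leP (f s) (f t).
      have [z zz ->] := MVT_segment st (fun x _ => dQ x) (cQ _ _).
      by exists z => //; exact: bw zz.
    have [z zz E] := MVT_segment (ltW ts) (fun x _ => dQ x) (cQ _ _).
    exists z; first exact: bw zz.
    by rewrite -(opprB (f s)) mulrN -E opprB.
  exists (Q' z), 0; rewrite mul0r addr0 subrr normr0 (ltW e0).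
  rewrite Hz (pf.2 _ _ (le_trans sr rt)); split=> //.
  by apply: Hd; rewrite /ball/= distrC.
apply/eqP; rewrite eq_le key//= -lerN2 -ointN; last exact: oitgM.
have := key (fun x => - P x) (fun x => - P' x).
rewrite opprB opprK addrC => H.
rewrite (@oint_eq _ _ (fun x => - P' (f x) * df x)); last by move=> x _; rewrite mulNr.
by apply: H => x; apply: cvgN; exact: cP'.
Qed.

(* [Psi] and [B] are convex with subgradients [g] and [beta]; the functional is
   their Fenchel-Young gap. *)
Lemma entropy_path (Psi g B beta w F al k : R -> R) (a b : R) : a <= b ->
  (forall x y, Psi y - Psi x <= g y * (y - x)) -> continuous g ->
  (forall x y, B y - B x <= beta y * (y - x)) -> continuous beta ->
  prim w F -> itg mu setT k ->
  (forall s t, s <= t -> `|al t - al s| <= oint k s t) ->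
  (Psi (w b) + B (al b) - al b * w b) - (Psi (w a) + B (al a) - al a * w a)
  <= oint (fun r => (g (w r) - al r) * F r + `|beta (al r) - w r| * k r) a b.
Proof.
move=> ab hPsi cg hB cbeta pw ik hal.
have cw := prim_continuous pw.
have cal := dominated_continuous ik hal.
have cC1 : continuous (fun x => g (w x) - al x).
  move=> x; apply: cvgB; last exact: cal.
  by apply: continuous_comp; [exact: cw|exact: cg].
have cba : continuous (fun x => beta (al x)).
  by move=> x; apply: continuous_comp; [exact: cal|exact: cbeta].
have cC2 : continuous (fun x => `|beta (al x) - w x|).
  by move=> x; apply: cvg_norm; apply: cvgB; [exact: cba|exact: cw].
apply: (@chain_le (fun x => Psi (w x) + B (al x) - al x * w x)) => //.
- exact: prim_oitg pw.
- exact: itgS ik.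
move=> r e rab e0; have e2 : 0 < e / 2 by rewrite divr_gt0.
exists (fun x => [/\ `|g (w x) - al x - (g (w r) - al r)| <= e,
  `|beta (al x) - beta (al r)| <= e / 2 & `|w x - w r| <= e / 2]).
  near=> x; split; near: x.
  - exact: (cont_eps _ cC1).
  - exact: (cont_eps _ cba).
  - exact: cont_eps.
move=> s t as_ sr rt tb [_ _ ws] [gt_ bt _].
(* The product term is split as [al t * (w t - w s) + w s * (al t - al s)], and both subgradients
   are taken at the right end [t]. *)
exists (g (w t) - al t), `|beta (al t) - w s|.
have st := le_trans sr rt; split=> //.
  rewrite -(pw.2 _ _ st).
  have : (beta (al t) - w s) * (al t - al s) <= `|beta (al t) - w s| * oint k s t.
    by rewrite (le_trans (ler_norm _))// normrM ler_wpM2l// hal.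
  have := hPsi (w s) (w t); have := hB (al s) (al t); lra.
rewrite (le_trans (ler_dist_dist _ _))//.
rewrite (_ : _ - _ = (beta (al t) - beta (al r)) - (w s - w r)); last lra.
by rewrite (le_trans (ler_normB _ _))// (splitr e) lerD.
Unshelve. all: by end_near. Qed.

(** [E] is only integrable, not continuous; its differential inequality is given between any two
    times, and the weight is handled through difference quotients. *)
Lemma gronwall (E f : R -> R) (gam a b : R) : 0 <= gam -> a <= b ->
  oitg E a b -> oitg f a b -> (forall t, a <= t <= b -> 0 <= E t) ->
  (forall t, 0 <= f t) ->
  (forall s t, a <= s -> s <= t -> t <= b ->
     E t - E s <= oint (fun r => f r - gam * E r) s t) ->
  expR (gam * b) * E b - expR (gam * a) * E a <= oint (fun r => expR (gam * r) * f r) a b.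
Proof.
move=> gam0 ab iE if_ E0 f0 H.
have cexp : continuous (fun r : R => expR (gam * r)).
  move=> x; apply: continuous_comp; last exact: continuous_expR.
  exact: mulrl_continuous.
rewrite (@oint_eq _ _ (fun r => expR (gam * r) * f r + (cst 0 : R -> R) r * E r)); last first.
  by move=> x _; rewrite mul0r addr0.
apply: (@chain_le (fun x => expR (gam * x) * E x)) => //.
  by move=> x; exact: cvg_cst.
move=> r e rab e0.
(* [M] dominates [gam], [1] and [gam * expR (gam * b)], so every coefficient error below is a small
   multiple of [e / (4 * M)] times something bounded by [M]. *)
pose M := gam * expR (gam * b) + gam + 1.
have M0 : 0 < M by rewrite ltr_wpDl// addr_ge0// mulr_ge0// expR_ge0.
have e' : 0 < e / (4 * M) by rewrite divr_gt0// mulr_gt0.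
have e2 : e / (4 * M) * M = e / 4 by field; lra.
exists (fun x => `|expR (gam * x) - expR (gam * r)| <= e / (4 * M) /\ `|x - r| <= e / (4 * M)).
  near=> x; split; near: x; first exact: (cont_eps _ cexp).
  by apply: (@cont_eps id) => // ?; exact: cvg_id.
move=> s t as_ sr rt tb [es ds] [et dt].
have st := le_trans sr rt.
(* The increment is [(exp(gam t) - exp(gam s)) E(t) + exp(gam s) (E(t) - E(s))]. The first
   difference of exponentials is at most [gam exp(gam t) (t - s)], and [H1] trades [(t - s) E(t)]
   for integrals. In the limit the coefficient of [f] is the weight and that of [E] cancels. *)
exists (expR (gam * s) + gam * expR (gam * t) * (t - s)),
       (gam * expR (gam * t) - gam * expR (gam * s)).
have iEst : oitg E s t by exact: oitgS iE.
have ifst : oitg f s t by exact: oitgS if_.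
have if0 : 0 <= oint f s t by apply: oint_ge0.
have Et0 : 0 <= E t by rewrite E0// (le_trans as_ st).
(* Going forward from any [x] in []s, t[], [E] grows by at most the integral of [f]; integrating in
   [x] replaces a point value by the integral of [E]. *)
have H1 : (t - s) * E t <= oint E s t + (t - s) * oint f s t.
  rewrite mulrC -oint_cst// [(t - s) * _]mulrC -(oint_cst _ st).
  rewrite -ointD//; last exact: oitg_cst.
  apply: oint_le; [exact: oitg_cst|by apply: itgD => //; exact: oitg_cst|].
  move=> x /andP[sx xt]; rewrite -lerBlDl.
  have ax : a <= x by rewrite (le_trans as_)// ltW.
  have ixf : oitg f x t by apply: oitgS ifst => //; exact: ltW.
  have ixE : oitg E x t by apply: oitgS iEst => //; exact: ltW.
  apply: (le_trans (H _ _ ax (ltW xt) tb)).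
  apply: (@le_trans _ _ (oint f x t)).
    apply: oint_le => //; first by apply: itgB => //; exact: itgZ.
    move=> y /andP[xy yt]; rewrite gerBl mulr_ge0// E0//.
    by rewrite (le_trans ax (ltW xy)) (le_trans (ltW yt)).
  by rewrite (oint_cat (ltW sx) (ltW xt) ifst) lerDr oint_ge0.
have H2 := H s t as_ st tb.
rewrite ointB ?ointZ// in H2; last exact: itgZ.
have eE : expR (gam * t) - expR (gam * s) <= gam * expR (gam * t) * (t - s).
  have := expR_ge1Dx (- (gam * (t - s))).
  rewrite -(ler_pM2l (expR_gt0 (gam * t))) -expRD.
  rewrite (_ : gam * t + _ = gam * s); last by ring.
  by set X := expR (gam * t); lra.
have es0 := expR_gt0 (gam * s).
have et0 := expR_gt0 (gam * t).
have etb : expR (gam * t) <= expR (gam * b) by rewrite ler_expR ler_wpM2l.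
split.
- have K1 : (expR (gam * t) - expR (gam * s)) * E t <=
      gam * expR (gam * t) * ((t - s) * E t) by rewrite mulrA ler_wpM2r.
  have K2 : gam * expR (gam * t) * ((t - s) * E t) <=
      gam * expR (gam * t) * (oint E s t + (t - s) * oint f s t).
    by rewrite ler_wpM2l// mulr_ge0// ltW.
  have K3 : expR (gam * s) * (E t - E s) <= expR (gam * s) * (oint f s t - gam * oint E s t).
    by rewrite ler_wpM2l// ltW.
  move: K1 K2 K3; lra.
- have ts : `|t - s| <= 2 * (e / (4 * M)).
    rewrite (le_trans (ler_distD r _ _))// mulr2n mulrDl mul1r lerD//.
    by rewrite distrC.
  have G : `|gam * expR (gam * t) * (t - s)| <= e / 2.
    rewrite normrM ger0_norm; last by rewrite mulr_ge0// ltW.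
    apply: (@le_trans _ _ (M * (2 * (e / (4 * M))))).
      apply: ler_pM => //; first by rewrite mulr_ge0// ltW.
      rewrite /M -addrA ler_wpDr ?addr_ge0//.
      by rewrite ler_wpM2l.
    by rewrite mulrCA [M * _]mulrC e2; lra.
  rewrite addrAC (le_trans (ler_normD _ _))//.
  have : e / (4 * M) <= e / 4.
    rewrite -e2 ler_peMr//; first exact: ltW.
    have := mulr_ge0 gam0 (ltW (expR_gt0 (gam * b))); rewrite /M; lra.
  move: es G; lra.
- rewrite subr0 -mulrBr normrM (ger0_norm gam0).
  apply: (@le_trans _ _ (gam * (2 * (e / (4 * M))))).
    rewrite ler_wpM2l// (le_trans (ler_distD (expR (gam * r)) _ _))//.
    by rewrite mulr2n mulrDl mul1r lerD// distrC.
  have : gam * (e / (4 * M)) <= e / 4.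
    rewrite -e2 [leRHS]mulrC ler_wpM2r//; first exact: ltW.
    have := mulr_ge0 gam0 (ltW (expR_gt0 (gam * b))); rewrite /M; lra.
  move: e0; lra.
Unshelve. all: by end_near. Qed.

End primitives.

(** * Du Bois-Reymond lemma *)

Section smooth_step.
Context {R : realType}.
Implicit Types x y : R.

Definition sq_pos (y : R) : R := Num.max y 0 ^+ 2.

Lemma is_derive_sq_pos y : is_derive y (1 : R) sq_pos (2 * Num.max y 0).
Proof.
suff H : h^-1 *: (sq_pos (h *: (1 : R) + y) - sq_pos y) @[h --> (0 : R)^'] --> (2 * Num.max y 0 : R).
  apply: DeriveDef; last by rewrite /derive; apply/cvg_lim.
  by rewrite /derivable; apply/cvg_ex; exists (2 * Num.max y 0).
(* The difference quotient is within [|h|] of the claimed derivative, including across the kink at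
   0. *)
apply/cvgrPdist_le => e e0; near=> h.
have h0 : h != 0 by near: h; exact: nbhs_dnbhs_neq.
have he : `|h| <= e.
  near: h; apply: dnbhs0_le => //.
rewrite /sq_pos /GRing.scale/= mulr1 (le_trans _ he)//.
rewrite -(ler_pM2l (_ : 0 < `|h|)) ?normr_gt0// -!normrM mulrBr mulVKf//.
rewrite [X in _ <= X]ger0_norm; last by rewrite -expr2 sqr_ge0.
rewrite !maxEle ler_norml.
by have [a|a] := leP (h + y) 0; have [b|b] := leP y 0; apply/andP; split; nra.
Unshelve. all: by end_near. Qed.

(** A C^1 quadratic spline rising from 0 at 0 to 1 at 2; its derivative [dstep] is the hat function
    on [[0, 2]] with peak 1. It serves as a mollifier profile here and as a smooth truncation in the
    comparison argument. *)
Definition step (y : R) : R :=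
  (sq_pos y - 2 * sq_pos (y - 1) + sq_pos (y - 2)) / 2.

Definition dstep (y : R) : R :=
  Num.max y 0 - 2 * Num.max (y - 1) 0 + Num.max (y - 2) 0.

Lemma is_derive_step y : is_derive y (1 : R) step (dstep y).
Proof.
have D (c : R) : is_derive y (1 : R) (fun y => sq_pos (y - c)) (2 * Num.max (y - c) 0).
  have H1 : is_derive y (1 : R) (fun y => y - c) 1.
    by apply: is_derive_eq; rewrite subr0.
  have H2 := @is_derive_sq_pos (y - c).
  have := @is_derive1_comp _ sq_pos (fun y => y - c) y _ _ H2 H1.
  by rewrite mulr1.
have D0 := @is_derive_sq_pos y; have D1 := D 1; have D2 := D 2.
have -> : step = (fun y => sq_pos y *: (2^-1 : R)) \+
    (fun y => sq_pos (y - 1) *: (- 1 : R)) \+ (fun y => sq_pos (y - 2) *: (2^-1 : R)).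
  by apply/funext => x; rewrite /step /GRing.scale/=; lra.
apply: is_derive_eq; rewrite /GRing.scale/= /dstep; lra.
Qed.

Lemma continuous_dstep : continuous dstep.
Proof.
have H (c : R) : continuous (fun y => Num.max (y - c) 0).
  have -> : (fun y : R => Num.max (y - c) 0) = (fun y => (y - c + `|y - c|) / 2).
    by apply/funext => y; rewrite maxr_absE addr0 subr0.
  have cc : continuous (fun y : R => y - c).
    by move=> x; apply: cvgB; [exact: cvg_id|exact: cvg_cst].
  move=> x; apply: cvgM; last exact: cvg_cst.
  by apply: cvgD; [exact: cc|apply: cvg_norm; exact: cc].
have H0 : continuous (fun y : R => Num.max y 0).
  by have := H 0; under eq_fun do rewrite subr0.
move=> x; apply: cvgD; last exact: H.
by apply: cvgB; [exact: H0|apply: cvgM; [exact: cvg_cst|exact: H]].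
Qed.

Lemma dstep_ge0 y : 0 <= dstep y.
Proof.
rewrite /dstep !maxEle.
by have [a|a] := leP y 0; have [b|b] := leP (y - 1) 0; have [c|c] := leP (y - 2) 0; lra.
Qed.

Lemma dstep_out y : y <= 0 \/ 2 <= y -> dstep y = 0.
Proof.
rewrite /dstep !maxEle.
by have [a|a] := leP y 0; have [b|b] := leP (y - 1) 0; have [c|c] := leP (y - 2) 0; move=> []; lra.
Qed.

Lemma step0 y : y <= 0 -> step y = 0.
Proof.
move=> y0; rewrite /step /sq_pos !max_r ?expr2; first lra.
all: lra.
Qed.

Lemma step1 y : 2 <= y -> step y = 1.
Proof.
move=> y0; rewrite /step /sq_pos !max_l ?expr2; first lra.
all: lra.
Qed.

Lemma step_ge0 y : 0 <= step y.
Proof.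
rewrite /step /sq_pos !maxEle.
by have [a|a] := leP y 0; have [b|b] := leP (y - 1) 0; have [c|c] := leP (y - 2) 0; nra.
Qed.

Lemma step_le1 y : step y <= 1.
Proof.
rewrite /step /sq_pos !maxEle.
by have [a|a] := leP y 0; have [b|b] := leP (y - 1) 0; have [c|c] := leP (y - 2) 0; nra.
Qed.

Lemma step_gt0 y : 0 < y -> 0 < step y.
Proof.
rewrite /step /sq_pos !maxEle.
by have [a|a] := leP y 0; have [b|b] := leP (y - 1) 0; have [c|c] := leP (y - 2) 0; nra.
Qed.

Lemma step_homo : {homo step : x y / x <= y}.
Proof.
have dv x : derivable step x 1 by exact: (@ex_derive _ _ _ _ _ _ _ (is_derive_step x)).
move=> x y xy.
have cQ : {within `[x, y], continuous step}.
  apply: continuous_subspaceT => u; apply: differentiable_continuous.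
  exact/derivable1_diffP.
have [z _ E] := MVT_segment xy (fun x _ => is_derive_step x) cQ.
by rewrite -subr_ge0 E mulr_ge0 ?dstep_ge0 ?subr_ge0.
Qed.

Lemma continuous_step : continuous step.
Proof.
move=> u; apply: differentiable_continuous; apply/derivable1_diffP.
exact: (@ex_derive _ _ _ _ _ _ _ (is_derive_step u)).
Qed.

End smooth_step.

Section dubois_reymond.
Context {R : realType}.
Notation mu := (@lebesgue_measure R).
Implicit Types (f g h F : R -> R).

Lemma C1_prim (phi dphi : R -> R) (a b : R) :
  (forall x : R, is_derive x (1 : R) phi (dphi x)) -> continuous dphi ->
  (forall x, ~~ (a < x < b) -> dphi x = 0) -> prim phi dphi.
Proof.
move=> D cd out; split.
  have -> : dphi = dphi \_ `]a, b[%classic.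
    apply/funext => x; rewrite patchE; case: ifPn => // /negP xab.
    rewrite out//; apply/negP => h; apply: xab; apply/mem_set => /=.
    by rewrite in_itv.
  by apply: itg_patch => //; exact: oitg_cont.
move=> s t; rewrite le_eqVlt => /predU1P[<-|st]; first by rewrite subrr oint_xx.
have dphiE : derive1 phi = dphi by apply/funext => x; rewrite derive1E; apply: derive_val.
have cphi : continuous phi.
  move=> u; apply: differentiable_continuous; apply/derivable1_diffP.
  exact: (@ex_derive _ _ _ _ _ _ _ (D u)).
rewrite -oint_cc; last exact: oitg_cont.
rewrite /Rintegral (@continuous_FTC2 _ dphi phi)//.
- exact: continuous_subspaceT.
- split => //.
  + by apply: cvg_at_right_filter; exact: cphi.
  + by apply: cvg_at_left_filter; exact: cphi.
- by move=> x _; rewrite dphiE.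
Qed.

Lemma is_derive_step_affine (s h x : R) :
  is_derive x (1 : R) (fun x => step ((x - s) / h)) (dstep ((x - s) / h) / h).
Proof.
have H1 : is_derive x (1 : R) (fun x => (x - s) / h) (h^-1).
  have -> : (fun x => (x - s) / h) = (fun x => (x - s) *: (h^-1 : R)) by [].
  by apply: is_derive_eq; rewrite /GRing.scale/=; lra.
have H2 := @is_derive_step R ((x - s) / h).
have := @is_derive1_comp _ step (fun x => (x - s) / h) x _ _ H2 H1.
by rewrite /GRing.scale/=.
Qed.

Lemma continuous_dstep_affine (s h : R) : continuous (fun x => dstep ((x - s) / h) / h).
Proof.
move=> x; apply: cvgM; last exact: cvg_cst.
apply: (@continuous_comp _ _ _ (fun x => (x - s) / h) dstep); last exact: continuous_dstep.
by apply: cvgM; [apply: cvgB; [exact: cvg_id|exact: cvg_cst]|exact: cvg_cst].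
Qed.

Lemma step_prim (s h a b : R) : 0 < h -> a <= s -> s + 2 * h <= b ->
  prim (fun x => step ((x - s) / h)) (fun x => dstep ((x - s) / h) / h) /\
  (forall x, ~~ (s < x < s + 2 * h) -> dstep ((x - s) / h) / h = 0).
Proof.
move=> h0 as_ sb.
have out x : ~~ (s < x < s + 2 * h) -> dstep ((x - s) / h) / h = 0.
  rewrite negb_and -!leNgt => /orP[xs|xs]; rewrite dstep_out ?mul0r//.
    by left; rewrite pmulr_lle0 ?invr_gt0// subr_le0.
  by right; rewrite ler_pdivlMr//; lra.
split=> //; apply: (@C1_prim _ _ s (s + 2 * h)) => //.
- by move=> x; exact: is_derive_step_affine.
- exact: continuous_dstep_affine.
Qed.

(** The rescaled hat is a probability density supported in [[s, s + 2 * h]], so the integral is an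
    average of [N] just to the right of [s]. *)
Lemma bump_average (N : R -> R) (a b s h e : R) : 0 < h -> a < s -> s + 2 * h < b ->
  oitg N a b -> (forall x, s < x < s + 2 * h -> `|N x - N s| <= e) ->
  `|oint (fun x => N x * (dstep ((x - s) / h) / h)) a b - N s| <= e.
Proof.
move=> h0 as_ sb iN He.
have [pr out] := step_prim h0 (ltW as_) (ltW sb).
have ab : a <= b by move: h0 as_ sb; lra.
set rho := fun x => dstep ((x - s) / h) / h in pr out *.
have crho : continuous rho by exact: continuous_dstep_affine.
have rho0 x : 0 <= rho x by rewrite mulr_ge0 ?dstep_ge0 ?invr_ge0// ltW.
have irho : oitg rho a b by exact: oitg_cont.
have int1 : oint rho a b = 1.
  rewrite -(pr.2 _ _ ab) step1 ?step0 ?subr0//.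
    by rewrite pmulr_lle0 ?invr_gt0// subr_le0 ltW.
  by rewrite ler_pdivlMr//; move: sb; lra.
have iNr : oitg (fun x => N x * rho x) a b.
  by have := oitgM crho iN; apply: itg_eq => // x _; rewrite mulrC.
rewrite -[X in _ - X]mulr1 -int1 -ointZ// -ointB//; last exact: itgZ.
rewrite (le_trans (oint_abs _))//; first by apply: itgB => //; exact: itgZ.
rewrite -[leRHS]mulr1 -int1 -ointZ//; apply: oint_le.
- by apply: itg_abs; apply: itgB => //; exact: itgZ.
- exact: itgZ.
move=> x _; rewrite -mulrBl normrM (ger0_norm (rho0 x)).
have [xs|/out rx] := boolP (s < x < s + 2 * h); last by rewrite [rho x]rx !mulr0.
by rewrite ler_wpM2r// He.
Qed.

Lemma prim_oint (df : R -> R) (a b : R) : oitg df a b ->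
  prim (fun x => oint (df \_ `]a, b[%classic) a x) (df \_ `]a, b[%classic).
Proof.
move=> idf; set df' := df \_ _; set G := fun x => _.
have pG0 : itg mu setT df' by exact: itg_patch.
split=> // u v uv.
have df'a x : x <= a -> df' x = 0.
  by move=> xa; rewrite /df' patchE memNset//= in_itv/= => /andP[]; rewrite ltNge xa.
have Ga y : y <= a -> G y = 0.
  by rewrite /G /oint => ya; rewrite set_itv_ge ?Rintegral_set0// bnd_simp -leNgt.
have z0 y : y <= a -> oint df' y a = 0.
  move=> ya; rewrite (@oint_eq _ _ (fun=> 0)) ?oint_cst ?mul0r// => x /andP[_ xa].
  by rewrite df'a// ltW.
have [au|ua] := leP a u.
  rewrite /G (@oint_cat _ df' a u v)//; first by rewrite addrC addKr.
  by apply: itgS pG0.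
rewrite (Ga u (ltW ua)) subr0; have [av|va] := leP a v.
  rewrite (@oint_cat _ df' u a v (ltW ua) av); last by apply: itgS pG0.
  by rewrite z0 ?add0r// ltW.
rewrite (Ga v (ltW va)) (@oint_eq _ _ (fun=> 0)) ?oint_cst ?mul0r// => x /andP[_ xv].
by rewrite df'a// ltW// (lt_trans xv).
Qed.

(** Let [N] be [f] minus a primitive of [df]. Testing with the difference of two steps, placed at
    [s] and [t], shows that the averages of [N] to the right of [s] and of [t] coincide; continuity
    then gives [N s = N t]. The test domain [D] may exceed []a, b[], as for boundary data on the
    half-line. *)
Lemma dubois_reymond (D : set R) (f df : R -> R) (a b : R) :
  `]a, b[ `<=` D -> (forall x, a < x < b -> {for x, continuous f}) ->
  oitg f a b -> oitg df a b ->
  (forall phi : R -> R, test_function D phi ->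
     \int[mu]_(x in D) (f x * derive1 phi x) = - \int[mu]_(x in D) (df x * phi x)) ->
  forall s t, a < s -> s <= t -> t < b -> f t - f s = oint df s t.
Proof.
move=> abD cf if_ idf H s t as_ st tb.
have ab : a <= b by rewrite (le_trans (ltW as_))// (le_trans st)// ltW.
pose df' := df \_ `]a, b[%classic.
have df'E x : a < x < b -> df' x = df x.
  by move=> xab; rewrite /df' patchE mem_set//= in_itv.
pose G x := oint df' a x.
have pG : prim G df' by exact: prim_oint.
have GE u v : u <= v -> G v - G u = oint df' u v by exact: pG.2.
have cG := prim_continuous pG.
pose N x := f x - G x.
have cN x : a < x < b -> {for x, continuous N}.
  by move=> xab; apply: cvgB; [exact: cf|exact: cG].
have iN : oitg N a b by apply: itgB => //; exact: oitg_cont.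
suff Nst : N s = N t.
  have : f t - f s = G t - G s by move: Nst; rewrite /N; lra.
  move=> ->; rewrite GE// ?ltW//; apply: oint_eq => x /andP[sx xt].
  by rewrite df'E// (lt_trans as_ sx) (lt_trans xt tb).
apply/eqP; rewrite -subr_eq0 -normr_le0; apply/ler_addgt0Pr => e e0; rewrite add0r.
have e2 : 0 < e / 2 by rewrite divr_gt0.
have sab : a < s < b by rewrite as_ (le_lt_trans st).
have tab : a < t < b by rewrite (lt_le_trans as_).
have loc x : a < x < b -> \forall h \near 0^'+, x + 2 * h < b /\
    (forall y, x < y < x + 2 * h -> `|N y - N x| <= e / 2).
  move=> /[dup] xab /andP[ax xb].
  have /cvgrPdist_le /(_ _ e2) /nbhs_ballP[d /= d0 Hd] := cN x xab.
  near=> h; have h0 : 0 < h by near: h; exact: nbhs_right_gt.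
  have hd : h < d / 2 by near: h; apply: nbhs_right_lt; rewrite divr_gt0.
  have hb : h < (b - x) / 2 by near: h; apply: nbhs_right_lt; rewrite divr_gt0// subr_gt0.
  split; first by clear - hb; lra.
  move=> y /andP[xy yh]; rewrite distrC; apply: Hd; rewrite /ball/= ltr_distlC.
  by apply/andP; split; clear - xy yh hd d0; lra.
near ((0 : R)^'+) => h.
have h0 : 0 < h by near: h; exact: nbhs_right_gt.
have [sh Hs] : s + 2 * h < b /\ (forall y, s < y < s + 2 * h -> `|N y - N s| <= e / 2).
  by near: h; exact: loc.
have [th Ht] : t + 2 * h < b /\ (forall y, t < y < t + 2 * h -> `|N y - N t| <= e / 2).
  by near: h; exact: loc.
have as' := ltW as_; have at_ : a < t by exact: lt_le_trans st.
pose phi x := step ((x - s) / h) - step ((x - t) / h).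
pose dphi x := dstep ((x - s) / h) / h - dstep ((x - t) / h) / h.
have [ps outs] := step_prim h0 (ltW as_) (ltW sh).
have [pt outt] := step_prim h0 (ltW at_) (ltW th).
have Dphi x : is_derive x (1 : R) phi (dphi x).
  have H1 := is_derive_step_affine s h x; have H2 := is_derive_step_affine t h x.
  exact: is_deriveB.
have cdphi : continuous dphi.
  by move=> x; apply: cvgB; exact: continuous_dstep_affine.
have dphi_out x : ~~ (a < x < b) -> dphi x = 0.
  rewrite negb_and -!leNgt => xab; rewrite /dphi outs ?outt ?subrr//;
  by rewrite negb_and -!leNgt; case/orP: xab => [xa|bx]; apply/orP; [left|right];
    clear - as_ st tb sh th xa || clear - as_ st tb sh th bx; lra.
have phi_out x : ~~ (s <= x <= t + 2 * h) -> phi x = 0.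
  rewrite negb_and -!ltNge /phi => /orP[xs|tx].
    by rewrite !step0 ?subr0// pmulr_lle0 ?invr_gt0//; clear - xs st; lra.
  by rewrite !step1 ?subrr// ler_pdivlMr//; clear - tx st; lra.
have phi_out' x : ~~ (a < x < b) -> phi x = 0.
  move=> xab; apply: phi_out; apply: contra xab => /andP[sx xt].
  by rewrite (lt_le_trans as_ sx) (le_lt_trans xt th).
have dphiE : derive1 phi = dphi by apply/funext => x; rewrite derive1E; apply: derive_val.
have tphi : test_function D phi.
  split.
  - by move=> x; exact: (@ex_derive _ _ _ _ _ _ _ (Dphi x)).
  - by rewrite dphiE.
  - exists `[s, t + 2 * h]%classic; split.
    + exact: segment_compact.
    + move=> x /=; rewrite in_itv/= => /andP[sx xt]; apply: abD => /=.
      by rewrite in_itv/= (lt_le_trans as_ sx) (le_lt_trans xt th).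
    + by move=> x /=; rewrite in_itv/= => /negP; exact: phi_out.
have pphi : prim phi dphi by apply: (@C1_prim _ _ a b).
have red (u : R -> R) : (forall x, ~~ (a < x < b) -> u x = 0) ->
    \int[mu]_(x in D) u x = oint u a b.
  move=> u0; rewrite /oint Rintegral_mkcond [RHS]Rintegral_mkcond; congr (Rintegral _ _ _).
  apply/funext => x; rewrite !patchE.
  have [xab|/u0 ->] := boolP (a < x < b); last by rewrite !if_same.
  by rewrite !mem_set//=; try apply: abD; rewrite /= in_itv.
have := H _ tphi; rewrite dphiE !red; last 2 first.
- by move=> x /phi_out' ->; rewrite mulr0.
- by move=> x /dphi_out ->; rewrite mulr0.
have := prim_mul ab pG pphi.
rewrite !phi_out' ?ltxx ?andbF// !mulr0 subrr.
have iGd : oitg (fun x => G x * dphi x) a b by apply: oitgM => //; exact: oitg_cont.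
have cphi := prim_continuous pphi.
have ipd : oitg (fun x => phi x * df x) a b by exact: oitgM.
rewrite (@oint_eq _ (fun x => G x * dphi x + phi x * df' x)
  (fun x => G x * dphi x + phi x * df x)); last by move=> x xab; rewrite df'E.
rewrite ointD//.
rewrite (@oint_eq _ (fun x => df x * phi x) (fun x => phi x * df x)); last first.
  by move=> x _; rewrite mulrC.
move=> E1 E2.
have ifd : oitg (fun x => f x * dphi x) a b.
  by have := oitgM cdphi if_; apply: itg_eq => // x _; rewrite mulrC.
have iNc c : continuous c -> oitg (fun x => N x * c x) a b.
  by move=> cc; have := oitgM cc iN; apply: itg_eq => // x _; rewrite mulrC.
(* Integration by parts against the primitive [G] removes [df] from the weak identity. *)
have E3 : oint (fun x => N x * dphi x) a b = 0.
  rewrite (@oint_eq _ _ (fun x => f x * dphi x - G x * dphi x)); last first.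
    by move=> x _; rewrite mulrBl.
  by rewrite ointB//; clear - E1 E2; lra.
have E4 : oint (fun x => N x * (dstep ((x - s) / h) / h)) a b =
          oint (fun x => N x * (dstep ((x - t) / h) / h)) a b.
  have i1 := iNc _ (@continuous_dstep_affine s h).
  have i2 := iNc _ (@continuous_dstep_affine t h).
  apply/eqP; rewrite -subr_eq0 -ointB//.
  rewrite -[X in _ == X]E3; apply/eqP; apply: oint_eq => x _.
  by rewrite -mulrBr.
have := bump_average h0 as_ sh iN Hs; have := bump_average h0 at_ th iN Ht.
rewrite E4; set X := oint _ _ _ => K1 K2.
rewrite (le_trans (ler_distD X _ _))// (splitr e) lerD// distrC.
exact: K2.
Unshelve. all: by end_near. Qed.

(** A point of disagreement would spread, by continuity, to a nondegenerate subinterval of []a, b[],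
    which has positive measure; this covers the end points too. *)
Lemma continuous_ae_eq (f g : R -> R) (a b : R) : a < b ->
  {within `[a, b], continuous f} -> {within `[a, b], continuous g} ->
  {ae mu, forall x, x \in `]a, b[ -> f x = g x} ->
  forall x, a <= x <= b -> f x = g x.
Proof.
move=> ab cf cg fg x xab; apply/eqP; apply: contraT => fgx.
have cfg : {within `[a, b], continuous (fun y => f y - g y)}.
  by move=> y; apply: cvgB; [exact: cf|exact: cg].
have e0 : 0 < `|f x - g x| by rewrite normr_gt0 subr_eq0.
have /subspace_continuousP/(_ x) := cfg; rewrite /= in_itv/= => /(_ xab).
move=> /cvgrPdist_lt /(_ _ e0); rewrite /within /= => /nbhs_ballP[d /= d0 Hd].
have [N [mN N0 sN]] := fg.
pose u := Num.max a (x - d); pose v := Num.min b (x + d).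
have uv : u < v.
  by rewrite /u /v lt_min !gt_max ab/=; case/andP: xab => ax xb; apply/andP; split;
     [move: d0 xb; lra|apply/andP; split; [move: d0 ax; lra|move: d0; lra]].
have sub : `]u, v[%classic `<=` N.
  move=> y /=; rewrite in_itv/= gt_max lt_min => /andP[/andP[ay xdy] /andP[yb yxd]].
  apply: sN => /= H.
  have := Hd y; rewrite /ball/= ltr_distlC xdy yxd in_itv/= !ltW//.
  have fy0 : f y - g y = 0 by rewrite H ?subrr// in_itv/= ay.
  move=> /(_ isT isT); rewrite [X in `|_ - X| < _ -> _]fy0.
  by rewrite subr0 ltxx.
have : (mu `]u, v[%classic <= 0)%E by rewrite -N0 le_measure// inE.
by rewrite lebesgue_measure_itv/= lte_fin uv -EFinB lee_fin subr_le0 leNgt uv.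
Qed.

End dubois_reymond.

(** * Coercivity of the flux *)

Section p_laplacian_flux.
Context {R : realType}.
Implicit Types (s x y a p q : R).

(** Let [m] be the right-hand side. Then [q * (s / m) + (1 - q) / m = 1], so the inequality
    [ln y <= y - 1] at [s / m] and at [1 / m], with weights [q] and [1 - q], sums to
    [q * ln s <= ln m]. *)
Lemma bernoulli_powR s q : 0 <= s -> 0 < q <= 1 -> s `^ q <= 1 + q * (s - 1).
Proof.
move=> s0 /andP[q0 q1].
have [->|sn0] := eqVneq s 0; first by rewrite powR0 ?gt_eqF//; lra.
have sp : 0 < s by rewrite lt_neqAle eq_sym sn0.
pose m := 1 + q * (s - 1).
have m0 : 0 < m by rewrite /m; nra.
rewrite -/m /powR (negbTE sn0) -[leRHS]lnK ?posrE// ler_expR.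
have L1 : ln s - ln m <= s / m - 1.
  rewrite -ln_div ?posrE// -[X in ln X](subrK 1) addrC le_ln1Dx//.
  have := divr_gt0 sp m0; lra.
have L2 : - ln m <= m^-1 - 1.
  rewrite -lnV ?posrE// -[X in ln X](subrK 1) addrC le_ln1Dx//.
  have : 0 < m^-1 by rewrite invr_gt0.
  lra.
have E : q * (s / m - 1) + (1 - q) * (m^-1 - 1) = 0.
  by rewrite /m; field; rewrite -/m gt_eqF.
have := ler_wpM2l (ltW q0) L1.
have q1' : 0 <= 1 - q by lra.
have := ler_wpM2l q1' L2; lra.
Qed.

Lemma mu_pN p s : mu_p p (- s) = - mu_p p s.
Proof. by rewrite /mu_p normrN mulrN. Qed.

Lemma mu_p_pow p s : 1 < p -> 0 <= s -> mu_p p s = s `^ (p - 1).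
Proof.
move=> p1 s0; rewrite /mu_p ger0_norm//.
have [->|sn0] := eqVneq s 0; first by rewrite mulr0 powR0// gt_eqF// subr_gt0.
rewrite -{2}[s]powRr1// -powRD ?sn0 ?implybT//; congr (_ `^ _); lra.
Qed.

Lemma mu_p_norm p s : 1 < p -> `|mu_p p s| = `|s| `^ (p - 1).
Proof.
move=> p1; rewrite -(mu_p_pow p1)// /mu_p !normrM normr_id.
by congr (_ * _); rewrite ger0_norm ?powR_ge0.
Qed.

Lemma mu_p_mul p s : 1 < p -> mu_p p s * s = `|s| `^ p.
Proof.
move=> p1; rewrite /mu_p -mulrA -expr2 -real_normK ?num_real//.
have [->|sn0] := eqVneq s 0.
  by rewrite normr0 expr0n mulr0 powR0// gt_eqF//; lra.
rewrite -powR_mulrn// -powRD ?normr_eq0 ?sn0 ?implybT//; congr (_ `^ _); lra.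
Qed.

Lemma powR_le1D (x a b : R) : 0 <= x -> 0 <= a -> a <= b -> x `^ a <= 1 + x `^ b.
Proof.
move=> x0 a0 ab; have [x1|x1] := leP x 1.
  have : x `^ a <= 1 `^ a by rewrite ge0_ler_powR ?nnegrE.
  by rewrite powR1 => x1a; rewrite ler_wpDr ?powR_ge0.
by rewrite ler_wpDl// ler_powR// ltW.
Qed.

Lemma mu_p_le p s : 1 < p -> `|mu_p p s| <= 1 + `|s| `^ p.
Proof. by move=> p1; rewrite mu_p_norm// powR_le1D//; lra. Qed.

Lemma measurable_mu_p p : measurable_fun setT (mu_p p : R -> R).
Proof.
apply: measurable_funM => //.
by apply: (measurableT_comp (measurable_powR _)); exact: normr_measurable.
Qed.

(** [(p - 1) * L^(p - 2)] is the smallest derivative of the flux on [[-L, L]] when [p <= 2]. For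
    [p < 2] that derivative is infinite at 0, so the bound is obtained from a power inequality. *)
Lemma mu_p_slope p (L x y : R) : 1 < p <= 2 -> 0 < L -> - L <= x -> x <= y -> y <= L ->
  (p - 1) * L `^ (p - 2) * (y - x) <= mu_p p y - mu_p p x.
Proof.
move=> /andP[p1 p2] L0.
have Lp : 0 <= L `^ (p - 2) by exact: powR_ge0.
(* For [0 <= u <= v], Bernoulli's inequality for [(u / v)^(p - 1)] plays the role of the mean value
   theorem, and [v^(p - 2) >= L^(p - 2)] because the exponent is nonpositive. *)
have pos u v : 0 <= u -> u <= v -> v <= L ->
    (p - 1) * L `^ (p - 2) * (v - u) <= mu_p p v - mu_p p u.
  move=> u0 uv vL; have v0 := le_trans u0 uv.
  have [v_0|vn0] := eqVneq v 0.
    have -> : u = 0 by apply/eqP; rewrite eq_le u0 -v_0 uv.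
    by rewrite v_0 !subrr mulr0.
  have vp : 0 < v by rewrite lt_neqAle eq_sym vn0.
  have H : L `^ (p - 2) <= v `^ (p - 2).
    rewrite -[p - 2]opprK [L `^ _]powRN [v `^ _]powRN lef_pV2 ?posrE ?powR_gt0//.
    by rewrite ge0_ler_powR ?nnegrE//; lra.
  have Hb := @bernoulli_powR (u / v) (p - 1).
  have {}Hb : (u / v) `^ (p - 1) <= 1 + (p - 1) * (u / v - 1).
    by apply: Hb; [rewrite divr_ge0|apply/andP; split; lra].
  rewrite !mu_p_pow// -[u in X in _ <= _ - X](divfK vn0) powRM ?divr_ge0//.
  have vE : v `^ (p - 1) = v `^ (p - 2) * v.
    by rewrite -{3}[v]powRr1// -powRD ?vn0 ?implybT//; congr (_ `^ _); lra.
  have vp0 : 0 <= v `^ (p - 1) by exact: powR_ge0.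
  apply: (@le_trans _ _ (v `^ (p - 1) * ((p - 1) * (1 - u / v)))); last first.
    have := ler_wpM2r vp0 Hb; lra.
  rewrite vE (_ : v `^ (p - 2) * v * ((p - 1) * (1 - u / v)) = (p - 1) * v `^ (p - 2) * (v - u)).
    by rewrite ler_wpM2r ?subr_ge0// ler_wpM2l//; lra.
  by field.
have mu0 : mu_p p (0 : R) = 0 by rewrite /mu_p mulr0.
(* Oddness yields the negative side; an interval around 0 is cut at 0. *)
move=> Lx xy yL; have [x0|x0] := leP 0 x; first exact: pos.
have [y0|y0] := leP y 0.
  have h1 : 0 <= - y by lra.
  have h2 : - y <= - x by lra.
  have h3 : - x <= L by lra.
  by have := pos _ _ h1 h2 h3; rewrite !mu_pN; lra.
have h1 : 0 <= - x by lra.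
have h3 : - x <= L by lra.
have := pos _ _ (lexx _) h1 h3; have := pos _ _ (lexx _) (ltW y0) yL.
by rewrite mu_pN mu0; lra.
Qed.

Lemma mu_p_homo p x y : 1 < p <= 2 -> x <= y -> mu_p p x <= mu_p p y.
Proof.
move=> p12 xy; have /andP[p1 p2] := p12.
pose L := `|x| + `|y| + 1.
have L0 : 0 < L by rewrite ltr_wpDl// addr_ge0.
have := @mu_p_slope p L x y p12 L0.
have : - L <= x /\ y <= L.
  rewrite /L; have := ler_norm y; have := ler_norm (- x); rewrite normrN.
  have := normr_ge0 y; have := normr_ge0 x; lra.
move=> [Lx yL] /(_ Lx xy yL) H.
rewrite -[leRHS](subrK (mu_p p x)) addrC lerDl; apply: le_trans H.
by rewrite mulr_ge0 ?subr_ge0// mulr_ge0 ?powR_ge0//; lra.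
Qed.

(** Within distance 1 of [a] the slope bound on [[-(A0 + 1), A0 + 1]] gives the quadratic estimate.
    Further away, monotonicity keeps the flux difference above its value at distance 1, which leaves
    linear growth. *)
Lemma mu_p_coercive p (A0 : R) : 1 < p <= 2 -> 0 <= A0 -> exists2 c : R, 0 < c &
  forall a y, `|a| <= A0 ->
    c * Num.min ((y - a) ^+ 2) `|y - a| <= (mu_p p y - mu_p p a) * (y - a).
Proof.
move=> p12 A0_0; have /andP[p1 p2] := p12.
have L0 : 0 < A0 + 1 by rewrite ltr_wpDl.
exists ((p - 1) * (A0 + 1) `^ (p - 2)).
  by rewrite mulr_gt0 ?subr_gt0// powR_gt0.
set c := _ * _ => a y; rewrite ler_norml => /andP[Aa aA].
have c0 : 0 <= c by rewrite mulr_ge0 ?powR_ge0//; lra.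
have [ay|ya] := leP a y.
  rewrite (ger0_norm (_ : 0 <= y - a)) ?subr_ge0//.
  have [y1|y1] := leP y (a + 1).
    apply: (@le_trans _ _ (c * (y - a) ^+ 2)).
      by rewrite ler_wpM2l// ge_min lexx.
    rewrite expr2 mulrA ler_wpM2r ?subr_ge0//.
    by apply: mu_p_slope => //; lra.
  apply: (@le_trans _ _ (c * (y - a))).
    by rewrite ler_wpM2l// ge_min lexx orbT.
  rewrite ler_wpM2r ?subr_ge0//.
  have h1 : - (A0 + 1) <= a by lra.
  have h2 : a <= a + 1 by lra.
  have h3 : a + 1 <= A0 + 1 by lra.
  have := @mu_p_slope p (A0 + 1) a (a + 1) p12 L0 h1 h2 h3.
  by have := @mu_p_homo p (a + 1) y p12 (ltW y1); rewrite -/c; lra.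
rewrite (ltr0_norm (_ : y - a < 0)) ?subr_lt0//.
rewrite (_ : _ * (y - a) = (mu_p p a - mu_p p y) * (a - y)); last by ring.
rewrite opprB -sqrrN opprB.
have [y1|y1] := leP (a - 1) y.
  apply: (@le_trans _ _ (c * (a - y) ^+ 2)).
    by rewrite ler_wpM2l// ge_min lexx.
  rewrite expr2 mulrA ler_wpM2r ?subr_ge0//; first exact: ltW.
  by apply: mu_p_slope => //; lra.
apply: (@le_trans _ _ (c * (a - y))).
  by rewrite ler_wpM2l// ge_min lexx orbT.
rewrite ler_wpM2r ?subr_ge0//; first exact: ltW.
have h1 : - (A0 + 1) <= a - 1 by lra.
have h2 : a - 1 <= a by lra.
have h3 : a <= A0 + 1 by lra.
have := @mu_p_slope p (A0 + 1) (a - 1) a p12 L0 h1 h2 h3.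
by have := @mu_p_homo p y (a - 1) p12 (ltW y1); rewrite -/c; lra.
Qed.

End p_laplacian_flux.

(** * Membership in L^q and dominated convergence *)

Section Lp_facts.
Context {d : measure_display} {T : measurableType d} {R : realType}.
Variables (m : {measure set T -> \bar R}) (D : set T) (mD : measurable D).
Implicit Types f g : T -> R.

Lemma in_Lp_meas q f : in_Lp m q D f -> measurable_fun D f.
Proof.
move=> /sub_Lfun_mfun; rewrite inE/= => mf.
exact/(measurable_restrictT f mD).
Qed.

Lemma in_Lp_pow (q : R) f : 1 <= q -> in_Lp m q%:E D f -> itg m D (fun x => `|f x| `^ q).
Proof.
move=> q1 fq; have mf := in_Lp_meas fq.
have := Lfun_integrable q1 fq => H.
have : itg m D (fun x => `|(f \_ D) x| `^ q) by apply: itgS H.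
by apply: itg_eq => // x Dx; rewrite patchE mem_set.
Qed.

Lemma in_Lp1_itg f : in_Lp m 1%:E D f <-> itg m D f.
Proof.
split=> [/Lfun1_integrable H|itf].
  have : itg m D (f \_ D) by apply: itgS H.
  by apply: itg_eq => // x Dx; rewrite patchE mem_set.
by apply/Lfun1_integrable; exact: itg_patch.
Qed.

Lemma in_Lp_itg (q : R) f : (m D < +oo)%E -> 1 <= q -> in_Lp m q%:E D f -> itg m D f.
Proof.
move=> mDoo q1 fq; apply: (@itg_dom _ _ _ _ _ mD _ (fun x => 1 + `|f x| `^ q)).
- exact: in_Lp_meas fq.
- by apply: itgD => //; [exact: itg_cst|exact: in_Lp_pow].
- move=> x _; rewrite -{1}[`|f x|]powRr1//; apply: powR_le1D => //.
Qed.

Lemma bounded_in_L2 f (M : R) : (m D < +oo)%E -> measurable_fun D f ->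
  (forall x, D x -> `|f x| <= M) -> in_Lp m 2%:E D f.
Proof.
move=> mDoo mf fM; have mfD := (measurable_restrictT f mD).1 mf.
rewrite /in_Lp inE; apply/andP; split; first by rewrite inE.
rewrite inE/= /finite_norm unlock/=; apply: poweR_lty.
have I : itg m setT ((fun=> M ^+ 2) \_ D) by apply: itg_patch => //; exact: itg_cst.
have /integrableP[_] := I; apply: le_lt_trans; apply: ge0_le_integral => //.
- suff : measurable_fun setT (EFin \o (fun x => `|(f \_ D) x| `^ 2)) by [].
  apply: measurableT_comp => //; apply: (measurableT_comp (measurable_powR _)).
  exact: measurableT_comp.
- by apply: measurableT_comp => //; have /integrableP[] := I.
move=> x _ /=; have [xD|xD] := boolP (x \in D); rewrite !patchE ?xD ?(negbTE xD)/=.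
  have fMx := fM _ (set_mem xD).
  rewrite lee_fin [leRHS]ger0_norm ?sqr_ge0//.
  suff : `|f x| `^ 2%:R <= M ^+ 2 by [].
  by rewrite powR_mulrn// ler_sqr ?nnegrE// (le_trans _ fMx).
by rewrite normr0 powR0// normr0 lexx.
Qed.

Lemma Rdominated_cvg (f_ : nat -> T -> R) f g :
  (forall n, measurable_fun D (f_ n)) ->
  (forall x, D x -> f_ n x @[n --> \oo] --> f x) -> itg m D g ->
  (forall n x, D x -> `|f_ n x| <= g x) ->
  \int[m]_(x in D) f_ n x @[n --> \oo] --> \int[m]_(x in D) f x.
Proof.
move=> mf_ f_f ig fg.
have [] := @dominated_convergence _ _ _ m D mD (fun n => EFin \o f_ n) (EFin \o f) (EFin \o g).
- by move=> n; exact/measurable_EFinP.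
- exact/measurable_EFinP/(measurable_fun_cvg mf_).
- by apply: aeW => x Dx; apply: cvg_EFin; [exact: nearW|exact: f_f].
- by [].
- by apply: aeW => x n Dx; rewrite lee_fin fg.
move=> itf _ H; apply: fine_cvg.
by rewrite /Rintegral fineK//; exact: integrable_fin_num.
Qed.

End Lp_facts.

Section oitg_closure.
Context {R : realType}.
Notation mu := (@lebesgue_measure R).
Implicit Types (f g : R -> R).

Lemma oitgZ (k : R) f (s t : R) : oitg f s t -> oitg (fun x => k * f x) s t.
Proof. by move=> h; exact: itgZ h. Qed.

Lemma oitg_abs f (s t : R) : oitg f s t -> oitg (fun x => `|f x|) s t.
Proof. by move=> h; exact: itg_abs h. Qed.

Lemma oitgD f g (s t : R) : oitg f s t -> oitg g s t -> oitg (fun x => f x + g x) s t.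
Proof. by move=> hf hg; exact: itgD hf hg. Qed.

Lemma oitgB f g (s t : R) : oitg f s t -> oitg g s t -> oitg (fun x => f x - g x) s t.
Proof. by move=> hf hg; exact: itgB hf hg. Qed.

Lemma oitg_eq f g (s t : R) : (forall x, s < x < t -> f x = g x) ->
  oitg f s t -> oitg g s t.
Proof. by move=> fg; apply: itg_eq => // x /=; rewrite in_itv/=; exact: fg. Qed.

Lemma oitg_dom f g (s t : R) : measurable_fun `]s, t[%classic f -> oitg g s t ->
  (forall x, s < x < t -> `|f x| <= g x) -> oitg f s t.
Proof.
by move=> mf ig fg; apply: (@itg_dom _ _ _ mu `]s, t[%classic _ f g).
Qed.

Lemma oitg_meas f (s t : R) : oitg f s t -> measurable_fun `]s, t[%classic f.
Proof. by move=> h; exact: itg_meas h. Qed.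

End oitg_closure.

(** * Sobolev functions on an interval *)

Section sobolev_interval.
Context {R : realType}.
Notation mu := (@lebesgue_measure R).
Variables (l : R) (l0 : 0 < l).
Implicit Types (f g v : R -> R).

Lemma closure_oo (a b : R) : a < b -> `[a, b]%classic `<=` closure `]a, b[%classic.
Proof.
move=> ab x /=; rewrite in_itv/= => /andP[ax xb] B /nbhs_ballP[e /= e0 Be].
pose u := Num.max a (x - e); pose w := Num.min b (x + e).
have uw : u < w.
  by rewrite /u /w lt_min !gt_max ab/=; apply/andP; split;
     [lra|apply/andP; split; lra].
exists ((u + w) / 2); split.
  rewrite /= in_itv/=; have : a <= u by rewrite le_max lexx.
  have : w <= b by rewrite ge_min lexx.
  by move=> ? ?; apply/andP; split; lra.
apply: Be; rewrite /ball/= ltr_distlC.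
have : x - e <= u by rewrite le_max lexx orbT.
have : w <= x + e by rewrite ge_min lexx orbT.
by move=> ? ?; apply/andP; split; lra.
Qed.

Lemma within_interior f (a b : R) : {within `[a, b], continuous f} ->
  forall x, a < x < b -> {for x, continuous f}.
Proof.
move=> cf x xab; apply: within_continuous_continuous cf _; last by rewrite in_itv.
by case/andP: xab => ax xb; exact: lt_trans xb.
Qed.

(** The du Bois-Reymond lemma works in the open interval; continuity up to the boundary carries the
    identity to the end points, so that traces become values of an absolutely continuous
    function. *)
Lemma weak_derivative_prim (a b : R) (D : set R) f df : a < b -> `]a, b[ `<=` D ->
  {within `[a, b], continuous f} -> oitg df a b -> 
  (forall phi : R -> R, test_function D phi ->
     \int[mu]_(x in D) (f x * derive1 phi x) = - \int[mu]_(x in D) (df x * phi x)) ->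
  exists2 F, prim F (df \_ `]a, b[%classic) & forall x, a <= x <= b -> f x = F x.
Proof.
move=> ab abD cf idf H.
have itf : oitg f a b.
  have : mu.-integrable `[a, b] (EFin \o f).
    by apply: continuous_compact_integrable => //; exact: segment_compact.
  by apply: itgS => //; exact: subset_itv_oo_cc.
have key := dubois_reymond abD (within_interior cf) itf idf H.
have pP := prim_oint idf; set P := fun x => _ in pP.
pose c := (a + b) / 2; have ac : a < c by rewrite /c; lra.
have cb : c < b by rewrite /c; lra.
exists (fun x => f c + (P x - P c)).
  split; first exact: pP.1.
  by move=> s t st; rewrite -(pP.2 _ _ st); lra.
have E x : a < x < b -> f x = f c + (P x - P c).
  have PE s t : a < s -> s <= t -> t < b -> f t - f s = P t - P s.
    move=> as_ st tb; rewrite key// (pP.2 _ _ st); apply: oint_eq => y /andP[sy yt].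
    by rewrite patchE mem_set//= in_itv/= (lt_trans as_ sy) (lt_trans yt tb).
  move=> /andP[ax xb]; have [xc|cx] := leP x c.
    by have := PE x c ax xc cb; lra.
  by have := PE c x ac (ltW cx) xb; lra.
apply: (continuous_ae_eq ab cf).
  apply: continuous_subspaceT => x; apply: cvgD; first exact: cvg_cst.
  by apply: cvgB; [exact: (prim_continuous pP)|exact: cvg_cst].
by apply: aeW => x; rewrite in_itv/=; exact: E.
Qed.

Lemma sobolev_prim (q : R) f df : 1 <= q -> sobolev q%:E `]0, l[%classic f df ->
  exists2 F, prim F (df \_ `]0, l[%classic) & forall x, 0 <= x <= l -> f x = F x.
Proof.
move=> q1 [_ dfq [_ _ H] cf]; apply: (weak_derivative_prim l0 _ _ _ H) => //.
- by apply: continuous_subspaceW cf; exact: closure_oo.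
- by apply: in_Lp_itg dfq => //; exact: leb_oo_lty.
Qed.

(** Produces the admissible H^1 test functions; the weak identity is the product rule on []0, l[],
    with no boundary term since [phi] vanishes at both ends. *)
Lemma prim_sobolev2 v dv (M : R) : prim v dv ->
  (forall x, 0 < x < l -> `|dv x| <= M) -> sobolev 2%:E `]0, l[%classic v dv.
Proof.
move=> pv dvM; have cv := prim_continuous pv.
have idv : oitg dv 0 l by exact: prim_oitg pv.
have [K _ vK] := cont_bounded 0 l cv.
split.
- apply: (@bounded_in_L2 _ _ _ _ _ _ _ K) => //; first exact: leb_oo_lty.
    exact: cont_meas.
  by move=> x /=; rewrite in_itv/= => /andP[? ?]; rewrite vK// !ltW.
- apply: (@bounded_in_L2 _ _ _ _ _ _ _ M) => //; first exact: leb_oo_lty.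
  exact: itg_meas idv.
- split.
  + by apply: open_integrable_locally; [exact: interval_open|exact: oitg_cont].
  + by apply: open_integrable_locally => //; exact: interval_open.
  move=> phi [dphi cdphi [K' [cK' K'l out]]].
  (* The complement of the compact set [K'] is open, so [phi] vanishes near each of its points and
     so does its derivative there. *)
  have dphi_out x : ~~ (0 < x < l) -> derive1 phi x = 0.
    move=> xl; have K'x : ~ K' x.
      by move=> /K'l/=; rewrite in_itv/= => h; move: xl; rewrite h.
    rewrite derive1E -(derive_cst 0 x (1 : R)); apply: near_eq_derive.
    have oC : open (~` K') by apply: closed_openC; exact: compact_closed.
    by apply: filterS (open_nbhs_nbhs (conj oC K'x)) => y /out.
  have pphi : prim phi (derive1 phi).
    apply: (@C1_prim _ _ _ 0 l) => // x.
    by rewrite derive1E; exact: derivableP.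
  have out0 x : ~~ (0 < x < l) -> phi x = 0.
    move=> xl; apply: out => /K'l/=; rewrite in_itv/= => h.
    by move: xl; rewrite h.
  have := prim_mul (ltW l0) pv pphi.
  rewrite !out0 ?ltxx ?andbF// !mulr0 subrr ointD; last 2 first.
  + by apply: oitgM => //; exact: oitg_cont.
  + by apply: oitgM => //; exact: (prim_continuous pphi).
  move=> /esym/eqP; rewrite addr_eq0 => /eqP.
  rewrite /oint => ->; congr (- _); apply: eq_Rintegral => x _; exact: mulrC.
- exact: continuous_subspaceT.
Qed.

Definition trunc (n : nat) (y : R) : R := Num.max (- n%:R) (Num.min y n%:R).

Lemma trunc_le n y : `|trunc n y| <= n%:R.
Proof.
rewrite /trunc ler_norml le_max lexx/= ge_max ge_min lexx orbT andbT.
by have := ler0n R n; lra.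
Qed.

Lemma trunc_dist n y : `|y - trunc n y| <= `|y|.
Proof.
have := ler0n R n; rewrite /trunc ler_norml maxEle minEle => n0.
have [yn|ny] := leP y n%:R; (have [h|h] := leP (- n%:R) _);
  (have [a|a] := leP 0 y; [rewrite (ger0_norm a)|rewrite (ltr0_norm a)]);
  apply/andP; split; lra.
Qed.

Lemma trunc_id n y : `|y| <= n%:R -> trunc n y = y.
Proof.
by rewrite ler_norml => /andP[? ?]; rewrite /trunc min_l// max_r.
Qed.

Lemma measurable_trunc n : measurable_fun setT (trunc n).
Proof. by apply: measurable_maxr => //; exact: measurable_minr. Qed.

(** Dominated convergence with majorant [|w * h|]: the product alone has to be integrable, which
    suits a flux in the dual exponent. *)
Lemma trunc_cvg (w h : R -> R) :
  measurable_fun `]0, l[%classic w -> measurable_fun `]0, l[%classic h ->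
  oitg (fun x => w x * h x) 0 l ->
  oint (fun x => `|w x| * `|h x - trunc n (h x)|) 0 l @[n --> \oo] --> (0 : R).
Proof.
move=> mw mh iwh.
have E : \int[mu]_(x in `]0, l[%classic) (fun=> 0 : R) x = 0.
  by rewrite [LHS]oint_cst ?mul0r// ltW.
rewrite -[X in _ --> X]E.
apply: (@Rdominated_cvg _ _ _ mu `]0, l[%classic _
  (fun n x => `|w x| * `|h x - trunc n (h x)|) (fun=> 0) (fun x => `|w x * h x|)) => //.
- move=> n; apply: measurable_funM; first exact: measurableT_comp.
  apply: measurableT_comp => //; apply: measurable_funB => //.
  exact: (measurableT_comp (measurable_trunc n)).
- move=> x _; apply: cvg_near_cst.
  have := @nbhs_infty_ger R `|h x|; apply: filterS => n hn.
  by rewrite trunc_id// subrr normr0 mulr0.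
- exact: itg_abs.
- by move=> n x _; rewrite !normrM !normr_id ler_wpM2l// trunc_dist.
Qed.

(* An identity tested on H^1 extends to absolutely continuous test functions, by
   truncating their derivative. *)
Lemma weak_eq_extend (alpha : R) (b fl U g : R -> R) :
  oitg b 0 l -> oitg fl 0 l ->
  (forall v dv, sobolev 2%:E `]0, l[%classic v dv ->
     inner l b v + inner l fl dv + alpha * inner_bd l U v = alpha * inner_bd l g v) ->
  forall V dV, prim V dV -> oitg (fun x => fl x * dV x) 0 l ->
    inner l b V + inner l fl dV + alpha * inner_bd l U V = alpha * inner_bd l g V.
Proof.
move=> ib ifl H V dV pV ifdV.
have cV := prim_continuous pV; have idV := prim_oitg 0 l pV.
pose d_ n x := trunc n (dV x).
have md n : measurable_fun `]0, l[%classic (d_ n).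
  by apply: (measurableT_comp (measurable_trunc n)); exact: itg_meas idV.
have id_ n : oitg (d_ n) 0 l.
  apply: (@itg_dom _ _ _ _ _ _ _ (fun=> n%:R)) => //.
  - exact: md.
  - exact: oitg_cst.
  - by move=> x _; exact: trunc_le.
pose D_ n := d_ n \_ `]0, l[%classic.
pose V_ n x := V 0 + (oint (D_ n) 0 x - oint (D_ n) 0 0).
have pV_ n : prim (V_ n) (D_ n).
  have pP := prim_oint (id_ n); split; first exact: pP.1.
  by move=> s t st; rewrite -(pP.2 _ _ st) /V_; lra.
have D_E n x : 0 < x < l -> D_ n x = d_ n x.
  by move=> xl; rewrite /D_ patchE mem_set//= in_itv.
have sV n : sobolev 2%:E `]0, l[%classic (V_ n) (D_ n).
  apply: (@prim_sobolev2 _ _ n%:R) => // x xl; rewrite D_E//; exact: trunc_le.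
(* [V] and [V_ n] agree at 0, so [del n] bounds their distance uniformly on [[0, l]]; [eta n] is the
   error in the flux term, and it tends to 0 because [fl * dV] is integrable. *)
pose del n := oint (fun x => `|(cst 1 : R -> R) x| * `|dV x - d_ n x|) 0 l.
pose eta n := oint (fun x => `|fl x| * `|dV x - d_ n x|) 0 l.
have del0 : del n @[n --> \oo] --> (0 : R).
  apply: trunc_cvg => //; first exact: itg_meas idV.
  by apply: itg_eq idV => // x _; rewrite mul1r.
have eta0 : eta n @[n --> \oo] --> (0 : R).
  by apply: trunc_cvg => //; [exact: itg_meas ifl|exact: itg_meas idV].
have idd n : oitg (fun x => dV x - d_ n x) 0 l by exact: itgB idV (id_ n).
have VV n x : 0 <= x <= l -> `|V x - V_ n x| <= del n.
  move=> /andP[x0 xl].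
  have -> : V x - V_ n x = oint (fun y => dV y - d_ n y) 0 x.
    rewrite ointB; [|exact: oitgS idV|exact: oitgS (id_ n)].
    rewrite -(pV.2 _ _ x0) /V_ oint_xx subr0.
    rewrite (@oint_eq _ (D_ n) (d_ n)); last first.
      by move=> y /andP[y0 yx]; rewrite D_E// y0 (lt_le_trans yx).
    lra.
  have iax : oitg (fun y => `|dV y - d_ n y|) 0 l by exact: oitg_abs (idd n).
  rewrite (le_trans (oint_abs _))//; first exact: oitgS (idd n).
  rewrite /del (@oint_eq _ (fun x => `|cst 1 x| * _) (fun y => `|dV y - d_ n y|)); last first.
    by move=> y _; rewrite normr1 mul1r.
  by rewrite (oint_cat x0 xl iax) lerDl oint_ge0.
pose Lam v dv := inner l b v + inner l fl dv + alpha * inner_bd l U v - alpha * inner_bd l g v.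
suff : Lam V dV = 0 by move/eqP; rewrite subr_eq0 => /eqP.
have L0 n : Lam (V_ n) (D_ n) = 0 by rewrite /Lam H ?subrr.
have ibV W : continuous W -> oitg (fun x => b x * W x) 0 l.
  by move=> cW; have := oitgM cW ib; apply: oitg_eq => x _; rewrite mulrC.
have ifD n : oitg (fun x => fl x * D_ n x) 0 l.
  apply: (@oitg_dom _ _ (fun x => n%:R * `|fl x|)).
  - apply: measurable_funM; first exact: itg_meas ifl.
    by apply: oitg_meas; exact: prim_oitg (pV_ n).
  - by apply: oitgZ; exact: oitg_abs.
  - move=> x xl; rewrite normrM mulrC ler_wpM2r// D_E//.
    exact: trunc_le.
pose K := oint (fun x => `|b x|) 0 l.
have K0 : 0 <= K by exact: oint_ge0.
pose K2 := `|alpha| * (`|U 0 - g 0| + `|U l - g l|).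
have K20 : 0 <= K2 by rewrite mulr_ge0// addr_ge0.
have bound n : `|Lam V dV| <= del n * (K + K2) + eta n.
  rewrite -[Lam V dV]subr0 -(L0 n).
  have -> : Lam V dV - Lam (V_ n) (D_ n) =
      oint (fun x => b x * (V x - V_ n x)) 0 l + oint (fun x => fl x * (dV x - D_ n x)) 0 l
      + alpha * ((U 0 - g 0) * (V 0 - V_ n 0) + (U l - g l) * (V l - V_ n l)).
    rewrite (@oint_eq _ (fun x => b x * (V x - V_ n x)) (fun x => b x * V x - b x * V_ n x)); last first.
      by move=> x _; rewrite mulrBr.
    rewrite (@oint_eq _ (fun x => fl x * (dV x - D_ n x)) (fun x => fl x * dV x - fl x * D_ n x)); last first.
      by move=> x _; rewrite mulrBr.
    rewrite !ointB//; [|exact: ibV|by apply: ibV; exact: (prim_continuous (pV_ n))].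
    by rewrite /Lam /inner /inner_bd /oint; ring.
  rewrite (le_trans (ler_normD _ _))//.
  rewrite (_ : del n * (K + K2) + eta n = (del n * K + eta n) + K2 * del n); last by ring.
  have V0 : `|V 0 - V_ n 0| <= del n by rewrite VV// lexx ltW.
  have Vl : `|V l - V_ n l| <= del n by rewrite VV// lexx ltW.
  have cVn := prim_continuous (pV_ n).
  rewrite lerD//; last first.
    rewrite normrM /K2 -mulrA ler_wpM2l// (le_trans (ler_normD _ _))// [leRHS]mulrDl.
    by rewrite lerD// normrM ler_wpM2l.
  rewrite (le_trans (ler_normD _ _))// lerD//.
    have iV : oitg (fun x => b x * (V x - V_ n x)) 0 l.
      by apply: ibV => x; apply: cvgB; [exact: cV|exact: cVn].
    rewrite (le_trans (oint_abs iV))// /K -ointZ; last exact: oitg_abs.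
    apply: oint_le; [exact: oitg_abs|by apply: oitgZ; exact: oitg_abs|].
    by move=> x /andP[x0 xl]; rewrite normrM mulrC ler_wpM2r// VV// !ltW.
  have iF : oitg (fun x => fl x * (dV x - D_ n x)) 0 l.
    have := oitgB ifdV (ifD n).
    by apply: oitg_eq => x _; rewrite mulrBr.
  rewrite (le_trans (oint_abs iF))// /eta le_eqVlt; apply/orP; left; apply/eqP.
  by apply: oint_eq => x xl; rewrite normrM D_E.
apply/eqP; rewrite -normr_le0.
have lim0 : del n * (K + K2) + eta n @[n --> \oo] --> (0 : R).
  suff : del n * (K + K2) + eta n @[n --> \oo] --> 0 * (K + K2) + (0 : R).
    by rewrite mul0r addr0.
  by apply: cvgD => //; apply: cvgM => //; exact: cvg_cst.
apply/ler_addgt0Pr => e e0; rewrite add0r.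
have /cvgrPdist_le /(_ _ e0) [N _ /(_ N (leqnn N))] := lim0.
rewrite sub0r normrN => /(le_trans (ler_norm _)); apply: le_trans; exact: bound.
Qed.

End sobolev_interval.

Section almost_everywhere_monotone.
Context {d : measure_display} {T : measurableType d} {R : realType}.
Variable m : {measure set T -> \bar R}.
Implicit Types P Q S : T -> Prop.

Lemma ae_imp P Q : {ae m, forall x, P x} -> (forall x, P x -> Q x) -> {ae m, forall x, Q x}.
Proof. by move=> aeP PQ; apply: filterS aeP. Qed.

Lemma ae_imp2 P Q S : {ae m, forall x, P x} -> {ae m, forall x, Q x} ->
  (forall x, P x -> Q x -> S x) -> {ae m, forall x, S x}.
Proof. by move=> aeP aeQ PQS; apply: filterS2 aeP aeQ. Qed.

End almost_everywhere_monotone.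

(** * Stationary profiles and dissipation *)

Section spatial_estimates.
Context {R : realType}.
Notation mu := (@lebesgue_measure R).
Variables (l : R) (l0 : 0 < l).
Implicit Types (f g u v b : R -> R).

Lemma prim_comp_prim (P P' f df : R -> R) (K : R) :
  (forall y : R, is_derive y (1 : R) P (P' y)) -> continuous P' ->
  (forall y, `|P' y| <= K) -> prim f df -> prim (P \o f) (fun x => P' (f x) * df x).
Proof.
move=> dP cP' P'K pf; have cf := prim_continuous pf; split.
  apply: (@itgMb _ _ _ mu setT _ (P' \o f) df K) => //; last exact: pf.1.
    by apply: cont_meas => // x; apply: continuous_comp; [exact: cf|exact: cP'].
  by move=> x _; exact: P'K.
by move=> s t st; exact: (prim_comp st dP cP' pf).
Qed.

Lemma dstep_le1 (y : R) : dstep y <= 1.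
Proof.
rewrite /dstep !maxEle.
by have [a|a] := leP y 0; have [b|b] := leP (y - 1) 0; have [c|c] := leP (y - 2) 0; lra.
Qed.

Lemma is_derive_step_scale (lam k y : R) :
  is_derive y (1 : R) (fun y => lam * step (lam * (y - k))) (lam ^+ 2 * dstep (lam * (y - k))).
Proof.
have H1 : is_derive y (1 : R) (fun y => lam * (y - k)) lam.
  have -> : (fun y => lam * (y - k)) = (fun y => (y - k) *: lam).
    by apply/funext => z; rewrite /GRing.scale/= mulrC.
  by apply: is_derive_eq; rewrite /GRing.scale/=; lra.
have H2 := @is_derive_step R (lam * (y - k)).
have H3 := @is_derive1_comp _ step (fun y => lam * (y - k)) y _ _ H2 H1.
have -> : (fun y => lam * step (lam * (y - k))) = lam *: (step \o (fun y => lam * (y - k))) by [].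
by apply: is_derive_eq; rewrite /GRing.scale/=; ring.
Qed.

Lemma continuous_affine (lam k : R) : continuous (fun y : R => lam * (y - k)).
Proof.
move=> x; apply: cvgM; first exact: cvg_cst.
by apply: cvgB; [exact: cvg_id|exact: cvg_cst].
Qed.

(** The coordinate function on [[0, l]], with derivative cut off outside so that it is integrable
    over the line as [prim] demands. *)
Lemma lin_prim : prim (fun x => oint ((cst 1 : R -> R) \_ `]0, l[%classic) 0 x)
  ((cst 1 : R -> R) \_ `]0, l[%classic).
Proof. by apply: prim_oint; exact: oitg_cst. Qed.

Lemma lin_E x : 0 <= x <= l -> oint ((cst 1 : R -> R) \_ `]0, l[%classic) 0 x = x.
Proof.
move=> /andP[x0 xl]; rewrite (@oint_eq _ _ (cst 1)) ?oint_cst// ?mul1r ?subr0//.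
move=> y /andP[y0 yx]; rewrite patchE mem_set//= in_itv/= y0.
exact: lt_le_trans xl.
Qed.

Lemma flux_integrable (p : R) f df : 1 < p -> sobolev p%:E `]0, l[%classic f df ->
  oitg (mu_p p \o df) 0 l /\ oitg (fun x => mu_p p (df x) * df x) 0 l.
Proof.
move=> p1 [_ dfp _ _].
have mdf : measurable_fun `]0, l[%classic df by exact: in_Lp_meas dfp.
have ip : oitg (fun x => `|df x| `^ p) 0 l by apply: in_Lp_pow dfp => //; exact: ltW.
have mm : measurable_fun `]0, l[%classic (mu_p p \o df).
  exact: (measurableT_comp (@measurable_mu_p _ p)).
split.
  apply: (@oitg_dom _ _ (fun x => 1 + `|df x| `^ p)) => //.
    by apply: oitgD => //; exact: oitg_cst.
  by move=> x _; exact: mu_p_le.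
by apply: oitg_eq ip => x _; rewrite mu_p_mul.
Qed.

(** Testing with the difference of [w] and its chord, which vanishes at both ends, leaves the
    integral of [(mu(dw) - mu(m)) * (dw - m)] equal to 0; coercivity then forces [dw = m] almost
    everywhere. Testing with the coordinate gives the condition at [l], and testing with the
    constant 1 gives the sum of both conditions. *)
Lemma stationary_affine (p alpha : R) g w : 1 < p <= 2 -> 0 < alpha ->
  stationary_solution p l alpha g w ->
  exists m, [/\ forall x, 0 <= x <= l -> w x = w 0 + m * x,
    - mu_p p m + alpha * w 0 = alpha * g 0 & mu_p p m + alpha * w l = alpha * g l].
Proof.
move=> p12 al0 [dw [sw H]]; have /andP[p1 p2] := p12.
have [F pF wF] := sobolev_prim l0 (ltW p1) sw.
have [ifl ifd] := flux_integrable p1 sw.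
have H' V dV : prim V dV -> oitg (fun x => (mu_p p \o dw) x * dV x) 0 l ->
    inner l (mu_p p \o dw) dV + alpha * inner_bd l w V = alpha * inner_bd l g V.
  move=> pV iV.
  have := @weak_eq_extend _ l l0 alpha (fun=> 0) (mu_p p \o dw) w g (oitg_cst _ _ _) ifl _ V dV pV iV.
  have z v : inner l (fun=> 0) v = 0.
    rewrite /inner (_ : (fun x => 0 * v x) = fun=> 0); last first.
      by apply/funext => x; rewrite mul0r.
    by rewrite [LHS]oint_cst ?mul0r// ltW.
  rewrite z add0r; apply=> v dv /H; rewrite z add0r; exact.
pose m := (w l - w 0) / l.
have w00 : w 0 = F 0 by rewrite wF// lexx ltW.
have wll : w l = F l by rewrite wF// lexx ltW.
have pL := lin_prim; set one := _ \_ _ in pL; set L := fun x => _ in pL.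
have L0 : L 0 = 0 by rewrite /L lin_E ?lexx ?ltW.
have Ll : L l = l by rewrite /L lin_E ?lexx ?ltW.
have oneE x : 0 < x < l -> one x = 1 by move=> xl; rewrite /one patchE mem_set//= in_itv.
pose dF := dw \_ `]0, l[%classic.
have dFE x : 0 < x < l -> dF x = dw x by move=> xl; rewrite /dF patchE mem_set//= in_itv.
pose V x := F x - w 0 - m * L x; pose dV x := dF x - m * one x.
have pV : prim V dV.
  split; first by apply: itgB => //; [exact: pF.1|apply: itgZ => //; exact: pL.1].
  move=> s t st; rewrite ointB; last 2 first.
  - exact: prim_oitg pF.
  - by apply: oitgZ; exact: prim_oitg pL.
  rewrite ointZ; last exact: prim_oitg pL.
  by rewrite -(pF.2 _ _ st) -(pL.2 _ _ st) /V; ring.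
have V0 : V 0 = 0 by rewrite /V L0 w00; ring.
have Vl : V l = 0 by rewrite /V Ll /m -wll; field; exact: lt0r_neq0.
have idw : oitg dw 0 l by apply: oitg_eq (prim_oitg 0 l pF) => x /dFE.
have iVV : oitg (fun x => (mu_p p \o dw) x * dV x) 0 l.
  apply: (@oitg_eq _ (fun x => mu_p p (dw x) * dw x - m * (mu_p p \o dw) x)).
    by move=> x xl; rewrite /dV dFE// oneE//=; ring.
  by apply: oitgB => //; exact: oitgZ.
have E1 : oint (fun x => (mu_p p \o dw) x * dV x) 0 l = 0.
  by have := H' V dV pV iVV; rewrite /inner_bd V0 Vl !mulr0 addr0 mulr0 addr0.
have idV := prim_oitg 0 l pV.
have E2 : oint dV 0 l = 0 by rewrite -(pV.2 _ _ (ltW l0)) V0 Vl subrr.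
pose A0 := `|m|.
have [c c0 Hc] := mu_p_coercive p12 (normr_ge0 m).
have iZ : oitg (fun x => (mu_p p (dw x) - mu_p p m) * dV x) 0 l.
  apply: (@oitg_eq _ (fun x => (mu_p p \o dw) x * dV x - mu_p p m * dV x)).
    by move=> x xl /=; ring.
  by apply: oitgB => //; exact: oitgZ.
have E3 : oint (fun x => (mu_p p (dw x) - mu_p p m) * dV x) 0 l = 0.
  rewrite (@oint_eq _ _ (fun x => (mu_p p \o dw) x * dV x - mu_p p m * dV x)).
    by rewrite ointB ?ointZ ?E1 ?E2 ?mulr0 ?subr0//; exact: oitgZ.
  by move=> x xl /=; ring.
have dVE x : 0 < x < l -> dV x = dw x - m by move=> xl; rewrite /dV dFE// oneE// mulr1.
have ae0 : {ae mu, forall x, `]0, l[%classic x -> (mu_p p (dw x) - mu_p p m) * dV x = 0}.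
  apply: (@Rintegral_eq0_ae _ _ _ mu `]0, l[%classic) => // x /=; rewrite in_itv/= => xl.
  rewrite dVE//; apply: le_trans (Hc m (dw x) (lexx _)).
  by rewrite mulr_ge0 ?(ltW c0)// le_min sqr_ge0 normr_ge0.
have aem : {ae mu, forall x, `]0, l[%classic x -> dw x = m}.
  apply: (ae_imp ae0) => x H0 xl; have := H0 xl; have /= := xl; rewrite in_itv/= => xl'.
  rewrite dVE// => {}H0; have := Hc m (dw x) (lexx _); rewrite H0.
  rewrite pmulr_rle0// ge_min => /orP[|].
    by move=> h; apply/eqP; rewrite -subr_eq0 -sqrf_eq0 eq_le h sqr_ge0.
  by rewrite normr_le0 subr_eq0 => /eqP.
have iLL : oitg (fun x => (mu_p p \o dw) x * one x) 0 l.
  by apply: oitg_eq ifl => x xl; rewrite oneE// mulr1.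
have El : mu_p p m + alpha * w l = alpha * g l.
  have := H' L one pL iLL.
  have -> : inner l (mu_p p \o dw) one = mu_p p m * l.
    transitivity (oint (fun=> mu_p p m) 0 l); last by rewrite oint_cst ?subr0// ltW.
    apply: ae_eq_Rintegral => //; first exact: oitg_meas iLL.
    apply: (ae_imp aem) => y Hy yl; have /= := yl; rewrite in_itv/= => yl'.
    by rewrite oneE// mulr1 Hy.
  rewrite /inner_bd L0 Ll !mulr0 !add0r => h2.
  by apply: (mulIf (lt0r_neq0 l0)); lra.
exists m; split=> //.
- move=> x /andP[x0 xl]; rewrite wF ?x0//.
  suff : V x = 0 by rewrite /V /L lin_E ?x0//; lra.
  have -> : V x = oint dV 0 x by rewrite -(pV.2 _ _ x0) V0 subr0.
  transitivity (oint (fun=> 0 : R) 0 x); last by rewrite oint_cst ?mul0r.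
  have idVx : oitg dV 0 x by exact: prim_oitg pV.
  apply: ae_eq_Rintegral => //; first exact: oitg_meas idVx.
  apply: (ae_imp aem) => y Hy /=; rewrite in_itv/= => /andP[y0 yx].
  have yl : 0 < y < l by rewrite y0 (lt_le_trans yx).
  by rewrite dVE// Hy ?subrr//= in_itv.
have p1V : prim (cst 1 : R -> R) (fun=> 0).
  split; first exact: integrable0.
  by move=> s t st; rewrite subrr oint_cst ?mul0r.
have := H' _ _ p1V; have -> : inner l (mu_p p \o dw) (fun=> 0) = 0.
  rewrite /inner (_ : (fun x => _ * 0) = fun=> 0); last first.
    by apply/funext => x; rewrite mulr0.
  by rewrite [LHS]oint_cst ?mul0r// ltW.
rewrite /inner_bd /cst !mulr1 add0r => h1.
have {}h1 : alpha * (w 0 + w l) = alpha * (g 0 + g l).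
  apply: h1; apply: (@oitg_eq _ (fun=> 0)); last exact: oitg_cst.
  by move=> x _; rewrite mulr0.
by rewrite !mulrDr in h1; lra.
Qed.

(** For [m >= 0] the boundary conditions give [g0 <= w0 <= wl <= gl], and all inequalities reverse
    for [m < 0]; the profile lies between the boundary data. *)
Lemma stationary_range (p alpha m w0 wl g0 gl a b : R) : 1 < p <= 2 -> 0 < alpha ->
  wl = w0 + m * l -> - mu_p p m + alpha * w0 = alpha * g0 ->
  mu_p p m + alpha * wl = alpha * gl -> a <= g0 <= b -> a <= gl <= b ->
  a <= w0 <= b /\ a <= wl <= b.
Proof.
move=> p12 al0 wlE h0 hl /andP[ag0 g0b] /andP[agl glb].
have mu0 : mu_p p (0 : R) = 0 by rewrite /mu_p mulr0.
have [m0|m0] := leP 0 m.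
  have mm : 0 <= mu_p p m by rewrite -mu0; apply: mu_p_homo.
  have k1 : g0 <= w0 by rewrite -(ler_pM2l al0); lra.
  have k2 : wl <= gl by rewrite -(ler_pM2l al0); lra.
  have k3 : w0 <= wl by rewrite wlE lerDl mulr_ge0// ltW.
  by split; apply/andP; split; lra.
have mm : mu_p p m <= 0 by rewrite -mu0; apply: mu_p_homo => //; exact: ltW.
have k1 : w0 <= g0 by rewrite -(ler_pM2l al0); lra.
have k2 : gl <= wl by rewrite -(ler_pM2l al0); lra.
have k3 : wl <= w0 by rewrite wlE gerDl nmulr_rle0// ltW.
by split; apply/andP; split; lra.
Qed.

(** For [m' <= m] a common nonnegative quantity [z] is added to the data difference at 0 and
    subtracted at [l], while the larger slope orders the results: [g0 - g0' <= w0 - w0' <= wl - wl'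
    <= gl - gl']. The estimate does not see the modulus of continuity of the flux. *)
Lemma stationary_lipschitz (p alpha m w0 wl g0 gl m' w0' wl' g0' gl' : R) :
  1 < p <= 2 -> 0 < alpha ->
  wl = w0 + m * l -> - mu_p p m + alpha * w0 = alpha * g0 ->
  mu_p p m + alpha * wl = alpha * gl ->
  wl' = w0' + m' * l -> - mu_p p m' + alpha * w0' = alpha * g0' ->
  mu_p p m' + alpha * wl' = alpha * gl' ->
  `|w0 - w0'| <= `|g0 - g0'| + `|gl - gl'| /\ `|wl - wl'| <= `|g0 - g0'| + `|gl - gl'|.
Proof.
move=> p12 al0 E1 E2 E3 E1' E2' E3'.
wlog mm : m w0 wl g0 gl m' w0' wl' g0' gl' E1 E2 E3 E1' E2' E3' / m' <= m.
  move=> H; have [mm|/ltW mm] := leP m' m; first by apply: (H m w0 wl g0 gl m').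
  by have := H _ _ _ _ _ _ _ _ _ _ E1' E2' E3' E1 E2 E3 mm;
    rewrite !(distrC w0' w0, distrC wl' wl, distrC g0' g0, distrC gl' gl).
have hmu := mu_p_homo p12 mm.
set y := mu_p p m in hmu E2 E3 *; set y' := mu_p p m' in hmu E2' E3' *.
have e : alpha * ((y - y') / alpha) = y - y' by rewrite mulrC divfK// gt_eqF.
have k0 : w0 - w0' = (g0 - g0') + (y - y') / alpha.
  by apply: (mulfI (lt0r_neq0 al0)); rewrite [RHS]mulrDr e; lra.
have kl : wl - wl' = (gl - gl') - (y - y') / alpha.
  by apply: (mulfI (lt0r_neq0 al0)); rewrite [RHS]mulrBr e; lra.
have k1 : 0 <= (m - m') * l by rewrite mulr_ge0 ?subr_ge0// ltW.
have kd : (wl - wl') - (w0 - w0') = (m - m') * l by rewrite E1 E1'; ring.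
have kz : 0 <= (y - y') / alpha by rewrite divr_ge0 ?subr_ge0// ltW.
set z := (y - y') / alpha in k0 kl kz.
have := ler_norm (g0 - g0'); have := ler_norm (gl - gl').
have := ler_norm (- (g0 - g0')); have := ler_norm (- (gl - gl')); rewrite !normrN.
have := normr_ge0 (g0 - g0'); have := normr_ge0 (gl - gl').
set X := `|g0 - _|; set Y := `|gl - _| => q1 q2 q3 q4 q5 q6.
rewrite !ler_norml; clear - k0 kl k1 kd kz q1 q2 q3 q4 q5 q6.
by split; apply/andP; split; lra.
Qed.

(** Linear growth of the minimum controls [V] in absolute value but not its square; the uniform
    bound [M] turns one factor of the square into a constant. *)
Lemma sup_bound V dV (M x : R) : prim V dV -> (forall y, 0 <= y <= l -> `|V y| <= M) ->
  0 <= x <= l ->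
  V x ^+ 2 <= 2 * V 0 ^+ 2
    + (8 * l + 8 * M) * oint (fun y => Num.min (dV y ^+ 2) `|dV y|) 0 l.
Proof.
move=> pV VM xl; have idV := prim_oitg 0 l pV.
have /andP[x0 xl'] := xl.
have iabs : oitg (fun y => `|dV y|) 0 l by exact: oitg_abs.
have iD : oitg (fun y => Num.min (dV y ^+ 2) `|dV y|) 0 l.
  apply: (oitg_dom _ iabs).
    have mdV := oitg_meas idV; apply: measurable_minr; last exact: measurableT_comp.
    exact: measurable_funX.
  by move=> y _; rewrite ger0_norm ?ge_min ?lexx ?orbT// le_min sqr_ge0 normr_ge0.
set D := oint (fun y => Num.min _ _) 0 l; set X := oint (fun y => `|dV y|) 0 l.
have D0 : 0 <= D by apply: oint_ge0 => y _; rewrite le_min sqr_ge0 normr_ge0.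
have X0 : 0 <= X by exact: oint_ge0.
have YX : `|V x - V 0| <= X.
  rewrite (pV.2 _ _ x0) (le_trans (oint_abs _))//; first exact: prim_oitg pV.
  by rewrite /X (oint_cat x0 xl' iabs) lerDl oint_ge0.
(* Slopes below [eta] contribute at most [eta]; above it, [|z|] is at most the minimum divided by
   [eta], because [eta <= 1]. *)
have key (eta : R) : 0 < eta -> eta <= 1 -> X <= l * eta + D / eta.
  move=> e0 e1.
  have -> : l * eta + D / eta =
      oint (fun y => eta + eta^-1 * Num.min (dV y ^+ 2) `|dV y|) 0 l.
    rewrite ointD; [|exact: oitg_cst|exact: oitgZ].
    by rewrite ointZ// oint_cst ?ltW// subr0 mulrC [D / _]mulrC.
  apply: oint_le => //; first by apply: oitgD; [exact: oitg_cst|exact: oitgZ].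
  move=> y _; set z := `|dV y|; have z0 : 0 <= z by exact: normr_ge0.
  have -> : dV y ^+ 2 = z ^+ 2 by rewrite real_normK ?num_real.
  have ei : 0 < eta^-1 by rewrite invr_gt0.
  have [ze|ez] := leP z eta.
    by rewrite ler_wpDr// mulr_ge0 ?(ltW ei)// le_min sqr_ge0 z0.
  rewrite ler_wpDl ?(ltW e0)// ler_pdivlMl// minEle; case: ifP => _.
    by rewrite expr2 ler_wpM2r// ltW.
  by rewrite -[leRHS]mul1r ler_wpM2r.
have VM0 : `|V 0| <= M by rewrite VM// lexx ltW.
have Y2 : `|V x - V 0| <= 2 * M.
  by rewrite (le_trans (ler_normB _ _))// mulr2n mulrDl mul1r lerD// VM.
have M0 : 0 <= M by exact: le_trans VM0.
have YY : (V x - V 0) ^+ 2 <= (4 * l + 4 * M) * D.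
  rewrite -real_normK ?num_real//; set Y := `|_ - _| in YX Y2 *.
  have Y0 : 0 <= Y by exact: normr_ge0.
  have [X_0|Xp] := leP X 0.
    have -> : Y = 0 by apply/eqP; rewrite eq_le Y0 (le_trans YX).
    by rewrite expr0n mulr_ge0// addr_ge0// mulr_ge0// ltW.
  have lD : 0 <= l * D by rewrite mulr_ge0// ltW.
  have MD : 0 <= M * D by rewrite mulr_ge0.
  (* For [X <= 2 * l] the choice [eta = X / (2 * l)] gives [X^2 <= 4 * l * D]. Otherwise [eta = 1]
     gives [X <= 2 * D], and [Y^2 <= 2 * M * X <= 4 * M * D]. *)
  have [Xl|lX] := leP X (2 * l).
    have e0 : 0 < X / (2 * l) by rewrite divr_gt0// mulr_gt0.
    have e1 : X / (2 * l) <= 1 by rewrite ler_pdivrMr ?mulr_gt0// mul1r.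
    have := key _ e0 e1.
    have -> : l * (X / (2 * l)) = X / 2 by field; lra.
    have -> : D / (X / (2 * l)) = 2 * l * D / X by field; apply/andP; split; lra.
    rewrite -lerBlDl ler_pdivlMr// => h.
    have : Y ^+ 2 <= X ^+ 2 by rewrite ler_sqr ?nnegrE.
    by move: h; rewrite !expr2; lra.
  have := key 1 ltr01 (lexx _); rewrite divr1 mulr1 => h.
  have : Y ^+ 2 <= 2 * M * X by rewrite expr2 ler_pM.
  have : M * X <= M * (2 * D) by rewrite ler_wpM2l//; lra.
  lra.
have := sqr_ge0 (V x - 2 * V 0); rewrite !expr2 in YY *; lra.
Qed.

(* Testing the difference of the evolution and the stationary equation with [u - w]. *)
Lemma dissipation (p alpha c A0 M m w0 : R) (u ux b g : R -> R) :
  1 < p <= 2 -> 0 < alpha -> 0 < c ->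
  (forall a y, `|a| <= A0 ->
    c * Num.min ((y - a) ^+ 2) `|y - a| <= (mu_p p y - mu_p p a) * (y - a)) ->
  sobolev p%:E `]0, l[%classic u ux -> oitg b 0 l ->
  (forall v dv, sobolev 2%:E `]0, l[%classic v dv ->
     inner l b v + inner l (mu_p p \o ux) dv + alpha * inner_bd l u v
     = alpha * inner_bd l g v) ->
  `|m| <= A0 -> - mu_p p m + alpha * w0 = alpha * g 0 ->
  mu_p p m + alpha * (w0 + m * l) = alpha * g l ->
  (forall x, 0 <= x <= l -> `|u x - (w0 + m * x)| <= M) ->
  sqnorm l (fun x => u x - (w0 + m * x)) <=
    l * (2 / alpha + (8 * l + 8 * M) / c) * - inner l b (fun x => u x - (w0 + m * x)).
Proof.
move=> p12 al0 c0 Hc su ib H mA E0 El uM; have /andP[p1 p2] := p12.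
have [F pF uF] := sobolev_prim l0 (ltW p1) su.
have [ifl ifd] := flux_integrable p1 su.
have pL := lin_prim; set one := _ \_ _ in pL; set L := fun x => _ in pL.
have LE x : 0 <= x <= l -> L x = x by exact: lin_E.
have oneE x : 0 < x < l -> one x = 1 by move=> xl; rewrite /one patchE mem_set//= in_itv.
pose dF := ux \_ `]0, l[%classic.
have dFE x : 0 < x < l -> dF x = ux x by move=> xl; rewrite /dF patchE mem_set//= in_itv.
pose V x := F x - w0 - m * L x; pose dV x := dF x - m * one x.
have pV : prim V dV.
  split; first by apply: itgB => //; [exact: pF.1|apply: itgZ => //; exact: pL.1].
  move=> s t st; rewrite ointB; last 2 first.
  - exact: prim_oitg pF.
  - by apply: oitgZ; exact: prim_oitg pL.
  rewrite ointZ; last exact: prim_oitg pL.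
  by rewrite -(pF.2 _ _ st) -(pL.2 _ _ st) /V; ring.
have VE x : 0 <= x <= l -> V x = u x - (w0 + m * x).
  by move=> xl; rewrite /V LE// -uF//; ring.
have dVE x : 0 < x < l -> dV x = ux x - m by move=> xl; rewrite /dV dFE// oneE// mulr1.
have cV := prim_continuous pV.
have idV := prim_oitg 0 l pV.
have iVV : oitg (fun x => (mu_p p \o ux) x * dV x) 0 l.
  apply: (@oitg_eq _ (fun x => mu_p p (ux x) * ux x - m * (mu_p p \o ux) x)).
    by move=> x xl; rewrite dVE//=; ring.
  by apply: oitgB => //; exact: oitgZ.
have := weak_eq_extend l0 ib ifl H pV iVV.
have -> : inner l b V = inner l b (fun x => u x - (w0 + m * x)).
  by apply: oint_eq => x /andP[x0 xl]; rewrite VE// !ltW.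
set I := inner l b _ => EQ.
have z0 : 0 <= (0 : R) <= l by rewrite lexx ltW.
have zl : 0 <= l <= l by rewrite lexx ltW.
pose D := oint (fun x => (mu_p p (ux x) - mu_p p m) * dV x) 0 l.
have iZ : oitg (fun x => (mu_p p (ux x) - mu_p p m) * dV x) 0 l.
  apply: (@oitg_eq _ (fun x => (mu_p p \o ux) x * dV x - mu_p p m * dV x)).
    by move=> x xl /=; ring.
  by apply: oitgB => //; exact: oitgZ.
(* The constant flux of the profile pairs with [dV] to [mu_p p m * (V l - V 0)], which the Robin
   conditions turn into its boundary terms. *)
have DE : D = inner l (mu_p p \o ux) dV - mu_p p m * (V l - V 0).
  rewrite (pV.2 _ _ (ltW l0)) /D.
  rewrite (@oint_eq _ _ (fun x => (mu_p p \o ux) x * dV x - mu_p p m * dV x)).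
    by rewrite ointB ?ointZ//; exact: oitgZ.
  by move=> x xl /=; ring.
have IE : - I = D + alpha * (V 0 ^+ 2 + V l ^+ 2).
  have u0 : u 0 = V 0 + w0 by rewrite VE//; ring.
  have ul : u l = V l + (w0 + m * l) by rewrite VE//; ring.
  move: EQ; rewrite /inner_bd u0 ul DE; set J := inner _ _ _ => EQ.
  have k1 : alpha * g 0 * V 0 = (- mu_p p m + alpha * w0) * V 0 by rewrite E0.
  have k2 : alpha * g l * V l = (mu_p p m + alpha * (w0 + m * l)) * V l by rewrite El.
  by rewrite !expr2; clear - EQ k1 k2; lra.
pose Dm := oint (fun y => Num.min (dV y ^+ 2) `|dV y|) 0 l.
have iD : oitg (fun y => Num.min (dV y ^+ 2) `|dV y|) 0 l.
  apply: (oitg_dom _ (oitg_abs idV)).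
    have mdV := oitg_meas idV; apply: measurable_minr; last exact: measurableT_comp.
    exact: measurable_funX.
  by move=> y _; rewrite ger0_norm ?ge_min ?lexx ?orbT// le_min sqr_ge0 normr_ge0.
have DDm : c * Dm <= D.
  rewrite /Dm -ointZ//; apply: oint_le => //; first exact: oitgZ.
  by move=> x xl; rewrite dVE// Hc.
have Dm0 : 0 <= Dm by apply: oint_ge0 => y _; rewrite le_min sqr_ge0 normr_ge0.
have VM y : 0 <= y <= l -> `|V y| <= M by move=> yl; rewrite VE// uM.
have M0 : 0 <= M by apply: le_trans (VM 0 z0).
have -> : sqnorm l (fun x => u x - (w0 + m * x)) = oint (fun x => V x ^+ 2) 0 l.
  by apply: oint_eq => x /andP[x0 xl]; rewrite VE ?expr2// !ltW.
(* The pointwise bound is integrated over an interval of length [l]. Both [alpha * V 0 ^+ 2] and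
   [c * Dm] are at most [- I], which explains the summands [2 / alpha] and [(8 * l + 8 * M) / c]. *)
apply: (@le_trans _ _ (l * (2 * V 0 ^+ 2 + (8 * l + 8 * M) * Dm))).
  have -> : forall A : R, l * A = oint (fun=> A) 0 l.
    by move=> A; rewrite oint_cst ?subr0 1?mulrC// ltW.
  apply: oint_le.
  - by apply: oitg_cont => x; under eq_fun do rewrite expr2; apply: cvgM; exact: cV.
  - exact: oitg_cst.
  - by move=> x /andP[x0 xl]; apply: sup_bound => //; rewrite !ltW.
rewrite -mulrA ler_wpM2l ?(ltW l0)// [leRHS]mulrDl lerD//.
  rewrite IE mulrAC ler_pdivlMr// -mulrA ler_wpM2l//.
  have D0 : 0 <= D by apply: le_trans DDm; rewrite mulr_ge0// ltW.
  have aV : 0 <= alpha * V l ^+ 2 by rewrite mulr_ge0 ?sqr_ge0// ltW.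
  rewrite [_ * alpha]mulrC; clear - D0 aV; lra.
rewrite mulrAC ler_pdivlMr// -mulrA ler_wpM2l; last 2 first.
- by rewrite addr_ge0// mulr_ge0// ltW.
- rewrite IE mulrC (le_trans DDm)// lerDl mulr_ge0 ?(ltW al0)//.
  by rewrite addr_ge0 ?sqr_ge0.
by [].
Qed.

(** The test function is nondecreasing in [u], so the flux term is nonnegative. Where it does not
    vanish at a boundary point, [u] lies beyond [k] and [g] does not, on the side chosen by the sign
    of [lam]; hence the boundary terms are nonnegative too. *)
Lemma comparison_test (p alpha lam k : R) (u ux b g : R -> R) :
  1 < p <= 2 -> 0 < alpha ->
  sobolev p%:E `]0, l[%classic u ux -> oitg b 0 l ->
  (forall v dv, sobolev 2%:E `]0, l[%classic v dv ->
     inner l b v + inner l (mu_p p \o ux) dv + alpha * inner_bd l u v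
     = alpha * inner_bd l g v) ->
  0 <= lam * (k - g 0) -> 0 <= lam * (k - g l) ->
  inner l b (fun x => lam * step (lam * (u x - k))) <= 0.
Proof.
move=> p12 al0 su ib H g0k glk; have /andP[p1 p2] := p12.
have [F pF uF] := sobolev_prim l0 (ltW p1) su.
have [ifl ifd] := flux_integrable p1 su.
pose P y := lam * step (lam * (y - k)).
pose P' y := lam ^+ 2 * dstep (lam * (y - k)).
have cP' : continuous P'.
  move=> y; apply: cvgM; first exact: cvg_cst.
  apply: (@continuous_comp _ _ _ (fun y => lam * (y - k)) dstep).
    exact: continuous_affine.
  exact: continuous_dstep.
have P'0 y : 0 <= P' y by rewrite mulr_ge0 ?sqr_ge0 ?dstep_ge0.
have P'le y : `|P' y| <= lam ^+ 2.
  by rewrite ger0_norm// ler_piMr ?sqr_ge0 ?dstep_le1.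
have pV := prim_comp_prim (is_derive_step_scale lam k) cP' P'le pF.
have cF := prim_continuous pF.
set V := _ \o _ in pV; set dV := fun x => _ in pV.
have dVE x : 0 < x < l -> dV x = P' (u x) * ux x.
  move=> /[dup] xl /andP[x0 xl']; rewrite /dV patchE mem_set/= ?in_itv//= uF//.
  by rewrite !ltW.
have iVV : oitg (fun x => (mu_p p \o ux) x * dV x) 0 l.
  have h : oitg (fun x => P' (F x) * (mu_p p (ux x) * ux x)) 0 l.
    by apply: oitgM => // x; apply: continuous_comp; [exact: cF|exact: cP'].
  apply: oitg_eq h => x /[dup] xl /andP[x0 xl']; rewrite dVE// uF ?ltW//.
  by rewrite /= mulrCA.
have := weak_eq_extend l0 ib ifl H pV iVV.
have -> : inner l b V = inner l b (fun x => lam * step (lam * (u x - k))).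
  by apply: oint_eq => x /andP[x0 xl]; rewrite /V/= uF// !ltW.
have J0 : 0 <= inner l (mu_p p \o ux) dV.
  apply: oint_ge0 => x xl; rewrite dVE//= mulrCA mu_p_mul//.
  by rewrite mulr_ge0 ?P'0 ?powR_ge0.
have z0 : 0 <= (0 : R) <= l by rewrite lexx ltW.
have zl : 0 <= l <= l by rewrite lexx ltW.
have bd x : 0 <= x <= l -> 0 <= lam * (k - g x) -> 0 <= (u x - g x) * V x.
  move=> xl gk; rewrite /V/= -uF//.
  have [h|h] := leP (lam * (u x - k)) 0; first by rewrite step0// !mulr0.
  have s0 := step_ge0 (lam * (u x - k)).
  rewrite mulrA mulr_ge0// mulrC; move: h gk; rewrite !mulrBr; lra.
move=> EQ; have := bd 0 z0 g0k; have := bd l zl glk.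
move: EQ J0; rewrite /inner_bd; set J := inner _ _ _; set I := inner _ _ _ => EQ J0 h1 h2.
have : 0 <= alpha * ((u 0 - g 0) * V 0 + (u l - g l) * V l).
  by rewrite mulr_ge0 ?(ltW al0)// addr_ge0.
lra.
Qed.

End spatial_estimates.

(** * Time evolution *)

Section fubini_rectangle.
Context {d1 d2 : measure_display} {T1 : measurableType d1} {T2 : measurableType d2}.
Context {R : realType}.
Variables (m1 : {sigma_finite_measure set T1 -> \bar R}).
Variables (m2 : {sigma_finite_measure set T2 -> \bar R}).
Variables (A : set T1) (B : set T2) (mA : measurable A) (mB : measurable B).
Implicit Type f : T1 * T2 -> R.

Lemma patch_rect1 f t : A t -> (fun x => (f \_ (A `*` B)) (t, x)) = (fun x => f (t, x)) \_ B.
Proof.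
move=> At; apply/funext => x; rewrite !patchE.
have [xB|xB] := boolP (x \in B); first by rewrite mem_set//; split => //=; exact: set_mem.
by rewrite memNset// => -[_ /= /mem_set]; rewrite (negbTE xB).
Qed.

Lemma patch_rect1N f t : ~ A t -> (fun x => (f \_ (A `*` B)) (t, x)) = (fun=> 0).
Proof. by move=> At; apply/funext => x; rewrite patchE memNset// => -[]. Qed.

Lemma patch_rect2 f x : B x -> (fun t => (f \_ (A `*` B)) (t, x)) = (fun t => f (t, x)) \_ A.
Proof.
move=> Bx; apply/funext => t; rewrite !patchE.
have [tA|tA] := boolP (t \in A); first by rewrite mem_set//; split => //=; exact: set_mem.
by rewrite memNset// => -[/= /mem_set]; rewrite (negbTE tA).
Qed.

Lemma patch_rect2N f x : ~ B x -> (fun t => (f \_ (A `*` B)) (t, x)) = (fun=> 0).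
Proof. by move=> Bx; apply/funext => t; rewrite patchE memNset// => -[]. Qed.

(** The real inner integral is [fine] of the extended one; the two agree wherever the section is
    integrable, that is almost everywhere. *)
Lemma rfub1 f : itg (m1 \x m2)%E setT f ->
  itg m1 setT (fun t => \int[m2]_x f (t, x)) /\
  \int[m1]_t \int[m2]_x f (t, x) = \int[(m1 \x m2)%E]_z f z.
Proof.
move=> itf; have h := integrable_fubini_F itf.
have aeF := ae_integrable1 itf.
have E : ae_eq m1 setT (fubini_F m2 (EFin \o f)) (fun t => (\int[m2]_x f (t, x))%:E).
  apply: filterS aeF => t ht _; rewrite /fubini_F /Rintegral fineK//.
  exact: integrable_fin_num ht.
have mh := measurable_int _ h.
have mE : measurable_fun setT (fun t => (\int[m2]_x f (t, x))%:E).
  apply: measurableT_comp => //.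
  have -> : (fun t => \int[m2]_x f (t, x)) = fine \o fubini_F m2 (EFin \o f) by [].
  exact: measurableT_comp.
split.
  apply/integrableP; split => //.
  have /integrableP[_] := h; apply: le_lt_trans.
  rewrite le_eqVlt; apply/orP; left; apply/eqP; apply: ae_eq_integral => //.
  - exact: measurableT_comp.
  - exact: measurableT_comp.
  - by apply: filterS E => t Et tT; congr (abse _); exact/esym/Et.
rewrite /Rintegral -(integral12_prod_meas1 itf); congr fine.
apply: ae_eq_integral => //.
by apply: filterS E => t Et tT; rewrite Et.
Qed.

Lemma itg_fubini_G f : itg (m1 \x m2)%E setT f ->
  m2.-integrable setT (fubini_G m1 (EFin \o f)).
Proof.
move=> itf; have mf : measurable_fun setT (EFin \o f) := measurable_int _ itf.
have mG := measurable_fubini_G itf.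
have mabs : measurable_fun setT (fun y => \int[m1]_x `|(EFin \o f) (x, y)|)%E.
  apply: (measurable_fun_fubini_tonelli_G (abse \o (EFin \o f))) => //=.
  exact: measurableT_comp.
apply/integrableP; split; first exact: mG.
have H := (integrable21ltyP m1 m2 mf).1 itf.
apply: (le_lt_trans _ H).
apply: ge0_le_integral => //; first exact: measurableT_comp.
by move=> y _; apply: le_abse_integral => //; exact: measurableT_comp.
Qed.

Lemma rfub2 f : itg (m1 \x m2)%E setT f ->
  itg m2 setT (fun x => \int[m1]_t f (t, x)) /\
  \int[m2]_x \int[m1]_t f (t, x) = \int[(m1 \x m2)%E]_z f z.
Proof.
move=> itf; have h := itg_fubini_G itf.
have aeF := ae_integrable2 itf.
have E : ae_eq m2 setT (fubini_G m1 (EFin \o f)) (fun x => (\int[m1]_t f (t, x))%:E).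
  apply: filterS aeF => t ht _; rewrite /fubini_G /Rintegral fineK//.
  exact: integrable_fin_num ht.
have mh := measurable_int _ h.
have mE : measurable_fun setT (fun x => (\int[m1]_t f (t, x))%:E).
  apply: measurableT_comp => //.
  have -> : (fun x => \int[m1]_t f (t, x)) = fine \o fubini_G m1 (EFin \o f) by [].
  exact: measurableT_comp.
split.
  apply/integrableP; split => //.
  have /integrableP[_] := h; apply: le_lt_trans.
  rewrite le_eqVlt; apply/orP; left; apply/eqP; apply: ae_eq_integral => //.
  - exact: measurableT_comp.
  - exact: measurableT_comp.
  - by apply: filterS E => t Et tT; congr (abse _); exact/esym/Et.
rewrite /Rintegral -(integral21_prod_meas1 itf); congr fine.
apply: ae_eq_integral => //.
by apply: filterS E => t Et tT; rewrite Et.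
Qed.

Lemma Rfubini f : itg (m1 \x m2)%E (A `*` B) f ->
  [/\ {ae m1, forall t, A t -> itg m2 B (fun x => f (t, x))},
      {ae m2, forall x, B x -> itg m1 A (fun t => f (t, x))},
      itg m1 A (fun t => \int[m2]_(x in B) f (t, x)),
      itg m2 B (fun x => \int[m1]_(t in A) f (t, x)) &
      \int[m1]_(t in A) \int[m2]_(x in B) f (t, x) =
      \int[m2]_(x in B) \int[m1]_(t in A) f (t, x)].
Proof.
move=> itf; have mAB : measurable (A `*` B) by exact: measurableX.
have itp := itg_patch mAB itf.
have [i1 E1] := rfub1 itp; have [i2 E2] := rfub2 itp.
have g1 : (fun t => \int[m2]_x (f \_ (A `*` B)) (t, x)) =
    (fun t => \int[m2]_(x in B) f (t, x)) \_ A.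
  apply/funext => t; rewrite patchE; have [/set_mem tA|/negP tA] := boolP (t \in A).
    by rewrite patch_rect1// -Rintegral_mkcond.
  by rewrite patch_rect1N ?Rintegral_cst ?mul0r// => /mem_set.
have g2 : (fun x => \int[m1]_t (f \_ (A `*` B)) (t, x)) =
    (fun x => \int[m1]_(t in A) f (t, x)) \_ B.
  apply/funext => t; rewrite patchE; have [/set_mem tA|/negP tA] := boolP (t \in B).
    by rewrite patch_rect2// -Rintegral_mkcond.
  by rewrite patch_rect2N ?Rintegral_cst ?mul0r// => /mem_set.
split.
- apply: filterS (ae_integrable1 itp) => t h At.
  have {}h : itg m2 setT (fun x => (f \_ (A `*` B)) (t, x)) := h.
  rewrite patch_rect1// in h; have : itg m2 B ((fun x => f (t, x)) \_ B) by apply: itgS h.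
  by apply: itg_eq => // x Bx; rewrite patchE mem_set.
- apply: filterS (ae_integrable2 itp) => t h At.
  have {}h : itg m1 setT (fun x => (f \_ (A `*` B)) (x, t)) := h.
  rewrite patch_rect2// in h; have : itg m1 A ((fun x => f (x, t)) \_ A) by apply: itgS h.
  by apply: itg_eq => // x Bx; rewrite patchE mem_set.
- rewrite g1 in i1; have : itg m1 A ((fun t => \int[m2]_(x in B) f (t, x)) \_ A) by apply: itgS i1.
  by apply: itg_eq => // x Ax; rewrite patchE mem_set.
- rewrite g2 in i2; have : itg m2 B ((fun x => \int[m1]_(t in A) f (t, x)) \_ B) by apply: itgS i2.
  by apply: itg_eq => // x Ax; rewrite patchE mem_set.
have e1 : \int[m1]_t \int[m2]_x (f \_ (A `*` B)) (t, x) =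
    \int[m1]_(t in A) \int[m2]_(x in B) f (t, x).
  by rewrite [RHS]Rintegral_mkcond -g1.
have e2 : \int[m2]_x \int[m1]_t (f \_ (A `*` B)) (t, x) =
    \int[m2]_(x in B) \int[m1]_(t in A) f (t, x).
  by rewrite [RHS]Rintegral_mkcond -g2.
by rewrite -e1 -e2 E1 E2.
Qed.

(** [min(|f|, 1)] is integrable on a rectangle of finite measure. Its iterated integral vanishes in
    one order, hence in the other, and nonnegativity turns this into vanishing of the sections. *)
Lemma ae_prod_swap f : (m1 A < +oo)%E -> (m2 B < +oo)%E ->
  measurable_fun (A `*` B) f ->
  {ae m1, forall t, A t -> {ae m2, forall x, B x -> f (t, x) = 0}} ->
  {ae m2, forall x, B x -> {ae m1, forall t, A t -> f (t, x) = 0}}.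
Proof.
move=> Aoo Boo mf H; pose h z := Num.min `|f z| 1.
have mAB : measurable (A `*` B) by exact: measurableX.
have mh : measurable_fun (A `*` B) h.
  by apply: measurable_minr => //; exact: measurableT_comp.
have h0 z : 0 <= h z by rewrite le_min normr_ge0 ler01.
have ih : itg (m1 \x m2)%E (A `*` B) h.
  apply: (@itg_dom _ _ _ _ _ _ _ (fun=> 1)) => //.
    apply: (@itg_cst _ _ _ _ _ mAB); suff : ((m1 \x m2)%E (A `*` B) < +oo)%E by [].
    by rewrite product_measure1E// lte_mul_pinfty// ge0_fin_numE.
  by move=> z _; rewrite ger0_norm// ge_min lexx orbT.
have hE z : h z = 0 -> f z = 0.
  rewrite /h minEle; case: ifP => [_ /eqP|_ /eqP]; last by rewrite oner_eq0.
  by rewrite normr_eq0 => /eqP.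
have [a1 a2 i1 i2 E] := Rfubini ih.
have z1 : \int[m1]_(t in A) \int[m2]_(x in B) h (t, x) = 0.
  transitivity (\int[m1]_(t in A) (0 : R)); last by rewrite Rintegral_cst ?mul0r.
  apply: ae_eq_Rintegral => //; first exact: itg_meas i1.
  apply: filterS2 H a1 => t Ht it At.
  transitivity (\int[m2]_(x in B) (0 : R)); last by rewrite Rintegral_cst ?mul0r.
  apply: ae_eq_Rintegral => //; first by apply: itg_meas; exact: it.
  apply: filterS (Ht At) => x Hx Bx; rewrite /h Hx// normr0 min_l//.
have z2 : {ae m2, forall x, B x -> \int[m1]_(t in A) h (t, x) = 0}.
  apply: Rintegral_eq0_ae i2 _ _ => //; last by rewrite -E.
  by move=> x _; apply: Rintegral_ge0.
apply: filterS2 z2 a2 => x Hx ix Bx.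
have := Rintegral_eq0_ae mA (ix Bx) (fun t _ => h0 _) (Hx Bx).
by apply: filterS => t Ht At; apply: hE; exact: Ht.
Qed.

End fubini_rectangle.

(** * Measurability of integrals depending on a parameter *)

Section parametric_measurability.
Context {d : measure_display} {X : measurableType d} {R : realType}.

(** Tonelli's measurability is applied to the positive and negative parts separately, so sections of
    [K] need not be integrable. *)
Lemma measurable_Rint_param (m2 : {sigma_finite_measure set (measurableTypeR R) -> \bar R})
    (K : X * measurableTypeR R -> R) : measurable_fun setT K ->
  measurable_fun setT (fun z => \int[m2]_r K (z, r)).
Proof.
move=> mK.
have -> : (fun z => \int[m2]_r K (z, r)) =
    fine \o (fun z => fubini_F m2 (EFin \o K)^\+ z - fubini_F m2 (EFin \o K)^\- z)%E.
  apply/funext => z; rewrite /Rintegral integralE /fubini_F/=.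
  congr (fine (_ - _)%E); apply: eq_integral => r _.
  - by rewrite !unlock.
  - by rewrite !unlock.
have mEK : measurable_fun setT (EFin \o K) by exact: measurableT_comp.
apply: measurableT_comp => //; apply: emeasurable_funB.
- apply: measurable_fun_fubini_tonelli_F => //; exact: measurable_funepos.
- apply: measurable_fun_fubini_tonelli_F => //; exact: measurable_funeneg.
Qed.

End parametric_measurability.

(** * Absolutely continuous paths in time *)

Section time_paths.
Context {R : realType}.
Notation mu := (@lebesgue_measure R).
Notation mR := (measurableTypeR R).
Variables (T l : R) (T0 : 0 < T) (l0 : 0 < l).
Variables (F : mR * mR -> R) (w0 : R -> R).
Hypothesis iF : itg (mu \x mu)%E setT F.
Hypothesis F0 : forall r x, ~~ (0 < r < T) -> F (r, x) = 0.
Hypothesis iw0 : oitg w0 0 l.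

(** With [F] the time derivative of [beta (u)] extended by 0, this is its absolutely continuous
    representative. It is constant before time 0, where the interval is empty, and after [T], where
    [F] vanishes. *)
Definition path (t x : R) : R := w0 x + oint (fun r => F (r, x)) 0 t.

Lemma ae_itg_time : {ae mu, forall x, itg mu setT (fun r => F (r, x))}.
Proof. exact: ae_integrable2 iF. Qed.

Lemma path_prim x : itg mu setT (fun r => F (r, x)) -> prim (path ^~ x) (fun r => F (r, x)).
Proof.
move=> ix; have io : oitg (fun r => F (r, x)) 0 T by apply: itgS ix.
have := prim_oint io.
have -> : (fun r => F (r, x)) \_ `]0, T[%classic = (fun r => F (r, x)).
  apply/funext => r; rewrite patchE; case: ifPn => // /negP h; rewrite F0//.
  by apply/negP => h'; apply: h; apply/mem_set => /=; rewrite in_itv.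
move=> [pi pE]; split=> // s t st; rewrite -pE// /path; lra.
Qed.

Lemma path0 x : path 0 x = w0 x.
Proof. by rewrite /path oint_xx addr0. Qed.

Lemma measurable_path : measurable_fun setT (fun z : mR * mR => oint (fun r => F (r, z.2)) 0 z.1).
Proof.
(* The moving end point becomes a measurable indicator in three variables, which reduces the claim
   to an integral over a fixed domain. *)
pose D : set ((mR * mR) * mR) := (fun z => (0 < z.2) && (z.2 < z.1.1)) @^-1` [set true].
have mD : measurable D.
  rewrite -[D]setTI; apply: measurable_and => //.
  - by apply: measurable_fun_ltr => //; exact: measurable_snd.
  - by apply: measurable_fun_ltr; [exact: measurable_snd|exact: measurableT_comp].
pose K := (fun z : (mR * mR) * mR => F (z.2, z.1.2)) \_ D.
have mK : measurable_fun setT K.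
  apply: (measurable_restrictT _ mD).1; apply: measurable_funTS.
  apply: (measurableT_comp (itg_meas iF)).
  apply: measurable_fun_pair; first exact: measurable_snd.
  exact: measurableT_comp.
have := measurable_Rint_param mu mK.
congr (measurable_fun _ _); apply/funext => z; rewrite /oint [RHS]Rintegral_mkcond.
apply: eq_Rintegral => r _; rewrite /K !patchE.
have [/= h|h] := boolP (0 < r < z.1).
  by rewrite !mem_set//= in_itv.
by rewrite !memNset//=; rewrite ?in_itv//=; apply/negP.
Qed.

Lemma path_itg t : oitg (path t) 0 l.
Proof.
apply: oitgD => //.
have h : itg (mu \x mu)%E (`]0, t[%classic `*` `]0, l[%classic) F.
  by apply: itgS iF => //; exact: measurableX.
have [//|//|_ _ _ i2 _] := Rfubini _ _ h.
exact: i2.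
Qed.

Lemma path_modulus s t : s <= t ->
  oint (fun x => `|path t x - path s x|) 0 l <=
  oint (fun r => \int[mu]_(x in `]0, l[%classic) `|F (r, x)|) s t.
Proof.
move=> st.
have h : itg (mu \x mu)%E (`]s, t[%classic `*` `]0, l[%classic) (fun z => `|F z|).
  by apply: itgS (itg_abs iF) => //; exact: measurableX.
have [//|//|_ _ _ i2 E] := Rfubini _ _ h.
have -> : oint (fun r => \int[mu]_(x in `]0, l[%classic) `|F (r, x)|) s t =
  \int[mu]_(x in `]0, l[%classic) \int[mu]_(r in `]s, t[%classic) `|F (r, x)| by exact: E.
apply: ae_le_Rintegral; [exact: measurable_itv| |exact: i2|].
  by apply: oitg_abs; apply: oitgB; exact: path_itg.
apply: (ae_imp ae_itg_time) => x ix _; rewrite ((path_prim ix).2 _ _ st).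
have ixst : oitg (fun r => F (r, x)) s t by apply: itgS ix.
exact: oint_abs ixst.
Qed.

Lemma itg_time_norm : itg mu setT (fun r => \int[mu]_(x in `]0, l[%classic) `|F (r, x)|).
Proof.
have h : itg (mu \x mu)%E (setT `*` `]0, l[%classic) (fun z => `|F z|).
  by apply: itgS (itg_abs iF) => //; exact: measurableX.
by have [//|//|_ _ i1 _ _] := Rfubini _ _ h.
Qed.

Lemma lipschitz_continuous (g : R -> R) (L : R) :
  (forall y z, `|g y - g z| <= L * `|y - z|) -> continuous g.
Proof.
move=> gL x; apply/cvgrPdist_le => e e0.
have L1 : 0 < `|L| + 1 by rewrite ltr_wpDl.
have d0 : 0 < e / (`|L| + 1) by rewrite divr_gt0.
exists (e / (`|L| + 1)) => //= y /ltW /=; rewrite ler_pdivlMr// mulrC => xy.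
rewrite (le_trans (gL _ _))// (le_trans _ xy)// ler_wpM2r//.
by rewrite (le_trans (ler_norm L))// lerDl.
Qed.

Lemma path_comp_itg (g : R -> R) (L t : R) :
  (forall y z, `|g y - g z| <= L * `|y - z|) -> oitg (fun x => g (path t x)) 0 l.
Proof.
move=> gL; apply: (@oitg_dom _ _ (fun x => `|g 0| + L * `|path t x|)).
- apply: measurableT_comp; last exact: oitg_meas (path_itg t).
  by apply: cont_meas => //; exact: lipschitz_continuous gL.
- by apply: oitgD; [exact: oitg_cst|apply: oitgZ; exact: oitg_abs (path_itg t)].
move=> x _; rewrite -[g (path t x)](subrK (g 0)) addrC (le_trans (ler_normD _ _))//.
by rewrite lerD2l -[X in L * `|X|]subr0.
Qed.

(** Integrals over a fixed set [E] are compared because equality of all of them identifies a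
    function almost everywhere, at every time. *)
Lemma path_comp_continuous (g : R -> R) (L : R) (E : set mR) : 0 <= L ->
  (forall y z, `|g y - g z| <= L * `|y - z|) -> measurable E -> E `<=` `]0, l[%classic ->
  continuous (fun t => \int[mu]_(x in E) g (path t x)).
Proof.
move=> L0 gL mE El.
apply: (@dominated_continuous _ _ (fun r => L * \int[mu]_(x in `]0, l[%classic) `|F (r, x)|)).
  by apply: itgZ => //; exact: itg_time_norm.
move=> s t st.
have ig r : itg mu E (fun x => g (path r x)) by apply: itgS (path_comp_itg r gL).
have iN := itg_time_norm.
rewrite ointZ; last by apply: itgS iN.
rewrite -RintegralB//; [|exact: ig|exact: ig].
apply: (@le_trans _ _ (\int[mu]_(x in E) (L * `|path t x - path s x|))).
  have iB : itg mu E (fun x => g (path t x) - g (path s x)) by exact: itgB (ig t) (ig s).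
  have h1 := le_normr_Rintegral mE iB; apply: (le_trans h1); apply: le_Rintegral => //.
  - exact: itg_abs iB.
  - have h := oitgZ L (oitg_abs (oitgB (path_itg t) (path_itg s))).
    by apply: itgS h.
have iP := oitgZ L (oitg_abs (oitgB (path_itg t) (path_itg s))).
apply: (@le_trans _ _ (oint (fun x => L * `|path t x - path s x|) 0 l)).
  rewrite /oint [leLHS]Rintegral_mkcond [leRHS]Rintegral_mkcond; apply: le_Rintegral => //.
  - by apply: itg_patch => //; apply: itgS iP.
  - exact: itg_patch iP.
  move=> x _; rewrite !patchE; case: ifPn => [/set_mem /El xl|_].
    by rewrite mem_set.
  by case: ifPn => // _; rewrite mulr_ge0.
rewrite ointZ ?ler_wpM2l ?path_modulus//.
exact: oitg_abs (oitgB (path_itg t) (path_itg s)).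
Qed.

End time_paths.

(** * Continuous representatives of time-dependent functions *)

Section versions.
Context {R : realType}.
Notation mu := (@lebesgue_measure R).
Notation mR := (measurableTypeR R).
Variables (T l : R) (T0 : 0 < T) (l0 : 0 < l).

Lemma Lp_dist1E (f g : R -> R) : oitg f 0 l -> oitg g 0 l ->
  Lp_dist 1%:E `]0, l[%classic f g = (oint (fun x => `|f x - g x|) 0 l)%:E.
Proof.
move=> if_ ig; have iB := oitg_abs (oitgB if_ ig).
rewrite /Lp_dist Lnorm1 /oint /Rintegral fineK; last exact: integrable_fin_num iB.
rewrite [RHS]integral_mkcond; apply: eq_integral => x _ /=.
by rewrite !patchE; case: ifPn => // _; rewrite normr0.
Qed.

(** Integrates [|z| <= e + z^2 / e], using that the integral of [z^2] is at most [e^2]. *)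
Lemma Lp_dist2_lt (f g : R -> R) (e : R) : 0 < e ->
  in_Lp mu 2%:E `]0, l[%classic f -> in_Lp mu 2%:E `]0, l[%classic g ->
  (Lp_dist 2%:E `]0%R, l[%classic f g < e%:E)%E ->
  oint (fun x => `|f x - g x|) 0 l <= e * (l + 1).
Proof.
move=> e0 f2 g2 fge.
have if_ : oitg f 0 l by apply: in_Lp_itg f2 => //; [exact: leb_oo_lty|rewrite ler1n].
have ig : oitg g 0 l by apply: in_Lp_itg g2 => //; [exact: leb_oo_lty|rewrite ler1n].
have sq h : in_Lp mu 2%:E `]0, l[%classic h -> oitg (fun x => h x ^+ 2) 0 l.
  move=> h2; have : oitg (fun x => `|h x| `^ 2) 0 l by apply: in_Lp_pow h2 => //; rewrite ler1n.
  by apply: oitg_eq => x _; rewrite powR_mulrn// real_normK ?num_real.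
have iB := oitgB if_ ig.
have iS : oitg (fun x => (f x - g x) ^+ 2) 0 l.
  apply: (@oitg_dom _ _ (fun x => 2 * f x ^+ 2 + 2 * g x ^+ 2)).
  - by apply: measurable_funX; exact: oitg_meas iB.
  - by apply: oitgD; apply: oitgZ; exact: sq.
  - by move=> x _; rewrite ger0_norm ?sqr_ge0// !expr2; have := sqr_ge0 (f x + g x); rewrite expr2; lra.
have S0 : oint (fun x => (f x - g x) ^+ 2) 0 l <= e ^+ 2.
  rewrite -lee_fin /oint /Rintegral fineK; last exact: integrable_fin_num iS.
  have -> : (\int[mu]_(x in `]0%R, l[) ((f x - g x) ^+ 2)%:E =
      Lnorm mu 2%:E (EFin \o ((fun x => f x - g x)%R \_ `]0%R, l[%classic)) `^ 2)%E.
    rewrite powR_Lnorm ?pnatr_eq0// [LHS]integral_mkcond; apply: eq_integral => x _ /=.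
    rewrite !patchE; case: ifPn => _.
      by rewrite powR_mulrn// real_normK ?num_real.
    by rewrite normr0 powR0 ?pnatr_eq0.
  have : (Lp_dist 2%:E `]0%R, l[%classic f g `^ 2 <= e%:E `^ 2)%E.
    apply: gt0_ler_poweR => //; last exact: ltW.
    - by rewrite in_itv/= leey andbT Lnorm_ge0.
    - by rewrite in_itv/= leey andbT lee_fin ltW.
  by rewrite /= powR_mulrn// ltW.
apply: (@le_trans _ _ (oint (fun x => e + e^-1 * (f x - g x) ^+ 2) 0 l)).
  apply: oint_le; [exact: oitg_abs|by apply: oitgD; [exact: oitg_cst|exact: oitgZ]|].
  move=> x _; set z := f x - g x.
  rewrite -(ler_pM2l e0) mulrDr mulVKf ?gt_eqF// -[z ^+ 2]real_normK ?num_real//.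
  by have := sqr_ge0 (e - `|z|); have := sqr_ge0 `|z|; have := sqr_ge0 e; rewrite !expr2; lra.
rewrite ointD; [|exact: oitg_cst|exact: oitgZ].
rewrite ointZ// (oint_cst _ (ltW l0)) subr0 [leRHS]mulrDr mulr1 lerD2l.
by rewrite ler_pdivrMl// -expr2.
Qed.

Lemma version_integral_continuous (q : R) (w W : R -> R -> R) (E : set mR) :
  q = 1 \/ q = 2 -> continuous_version q%:E T l w W ->
  measurable E -> E `<=` `]0, l[%classic ->
  {within `[0, T], continuous (fun t => \int[mu]_(x in E) W t x)}.
Proof.
move=> q12 [WL _ cW] mE El; apply/subspace_continuousP => t tT.
have tT' : t \in `[0, T] by [].
have WI s : s \in `[0, T] -> oitg (W s) 0 l.
  move=> /WL; apply: in_Lp_itg => //; first exact: leb_oo_lty.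
  by case: q12 => ->; rewrite ?ler1n.
apply/cvgrPdist_le => e e0.
pose d := e / (l + 1); have l1 : 0 < l + 1 by rewrite ltr_wpDr// ltW.
have d0 : 0 < d by rewrite divr_gt0.
have dl : d * (l + 1) = e by rewrite divfK// gt_eqF.
have de : d <= e by rewrite -dl mulrDr mulr1 lerDr mulr_ge0// ltW.
have N : \forall s \near within `[0, T]%classic (nbhs t), (Lp_dist q%:E `]0%R, l[%classic (W s) (W t) < d%:E)%E.
  by have := cW t tT'; move=> /(_ [set y | (y < d%:E)%E]); apply; apply: open_ereal_lt'; rewrite lte_fin.
rewrite /= near_withinE; rewrite near_withinE in N.
apply: filterS N => s Hs sT; have {}Hs := Hs sT.
have iB := oitgB (WI _ tT') (WI s sT).
rewrite -RintegralB//; [|by apply: itgS (WI _ tT')|by apply: itgS (WI s sT)].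
have iBE : itg mu E (fun x => W t x - W s x) by apply: itgS iB.
apply: le_trans (le_normr_Rintegral mE iBE) _.
apply: (@le_trans _ _ (oint (fun x => `|W s x - W t x|) 0 l)).
  rewrite /oint [leLHS]Rintegral_mkcond [leRHS]Rintegral_mkcond; apply: le_Rintegral => //.
  - by apply: itg_patch => //; exact: itg_abs iBE.
  - by apply: itg_patch => //; exact: oitg_abs (oitgB (WI s sT) (WI _ tT')).
  move=> x _; rewrite !patchE; case: ifPn => [/set_mem /El xl|_].
    by rewrite mem_set// distrC.
  by case: ifPn => // _; rewrite normr_ge0.
case: q12 Hs WL {cW} => -> Hs WL.
  rewrite Lp_dist1E in Hs; [|exact: WI|exact: WI].
  by rewrite (le_trans _ de)// ltW// -lte_fin.
by rewrite -dl; apply: Lp_dist2_lt => //; exact: WL.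
Qed.

Lemma ae_eq_of_integrals (f g : R -> R) : oitg f 0 l -> oitg g 0 l ->
  (forall E : set mR, E `<=` `]0, l[%classic -> measurable E ->
     \int[mu]_(x in E) f x = \int[mu]_(x in E) g x) ->
  {ae mu, forall x, x \in `]0, l[ -> f x = g x}.
Proof.
move=> if_ ig H.
have : ae_eq mu `]0, l[%classic (EFin \o f) (EFin \o g).
  apply: integral_ae_eq => //; first exact: measurable_int ig.
  move=> E El mE; have iE : itg mu E f by apply: itgS if_.
  have iE' : itg mu E g by apply: itgS ig.
  have := H E El mE; rewrite /Rintegral => h.
  rewrite -[LHS]fineK; last exact: integrable_fin_num iE.
  rewrite -[RHS]fineK; last exact: integrable_fin_num iE'.
  by congr (_%:E).
by move=> h; apply: (ae_imp h) => x hx xl; have [] := hx xl.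
Qed.

Lemma Rfubini_leb (A B : set mR) (f : R -> R -> R) : measurable A -> measurable B ->
  itg (mu \x mu)%E (A `*` B) (fun z : mR * mR => f z.1 z.2) ->
  [/\ {ae mu, forall t, A t -> itg mu B (f t)},
      {ae mu, forall x, B x -> itg mu A (f ^~ x)},
      itg mu A (fun t => \int[mu]_(x in B) f t x),
      itg mu B (fun x => \int[mu]_(t in A) f t x) &
      \int[mu]_(t in A) (\int[mu]_(x in B) f t x) =
      \int[mu]_(x in B) (\int[mu]_(t in A) f t x)].
Proof. by move=> mA mB itf; have [] := Rfubini mA mB itf. Qed.

(** For each measurable [E], Fubini turns the weak identity into a scalar one: the integral of [W r]
    over [E] is continuous in [r] with weak derivative the integral of [wt r] over [E]. It is
    therefore a primitive, and letting [E] vary identifies [W t] at every [t], not merely at almost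
    every one. *)
Lemma version_path (w wt W : R -> R -> R) : W11_time T l w wt ->
  continuous_version 1%:E T l w W ->
  forall t, 0 <= t <= T -> {ae mu, forall x, x \in `]0, l[ ->
    W t x = path ((fun z : mR * mR => wt z.1 z.2) \_ (space_time T l)) (W 0) t x}.
Proof.
move=> [wL wtL Hw] cW t tT; set F := _ \_ _.
have mQ : measurable (space_time T l) by exact: measurableX.
have iw : itg (mu \x mu)%E (space_time T l) (fun z : mR * mR => w z.1 z.2) by apply/in_Lp1_itg.
have iwt : itg (mu \x mu)%E (space_time T l) (fun z : mR * mR => wt z.1 z.2) by apply/in_Lp1_itg.
have iF : itg (mu \x mu)%E setT F by exact: itg_patch.
have z0 : (0 : R) \in `[0, T] by rewrite in_itv/= lexx ltW.
have [WL WE _] := cW.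
have WI s : s \in `[0, T] -> oitg (W s) 0 l.
  by move=> /WL; apply: in_Lp_itg => //; exact: leb_oo_lty.
have iW0 := WI 0 z0.
have tT' : t \in `[0, T] by rewrite in_itv.
apply: ae_eq_of_integrals; first exact: WI.
  have h := path_itg iF iW0 t.
  exact: h.
move=> E El mE.
have sub : `]0, T[%classic `*` E `<=` space_time T l by move=> z [h1 h2]; split=> //; exact: El.
have mTE : measurable (`]0, T[%classic `*` E : set (mR * mR)) by exact: measurableX.
have iwE : itg (mu \x mu)%E (`]0, T[%classic `*` E) (fun z : mR * mR => w z.1 z.2) by apply: itgS iw.
have iwtE : itg (mu \x mu)%E (`]0, T[%classic `*` E) (fun z : mR * mR => wt z.1 z.2) by apply: itgS iwt.
pose N r := \int[mu]_(x in E) W r x.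
have cN : {within `[0, T], continuous N}.
  exact: version_integral_continuous (or_introl erefl) cW mE El.
have mITV : measurable (`]0, T[%classic : set mR) by [].
have mE' : measurable (E : set mR) by [].
have [awt _ iD _ _] := Rfubini_leb mITV mE' iwtE.
have [aw _ _ _ _] := Rfubini_leb mITV mE' iwE.
pose df r := \int[mu]_(x in E) wt r x.
have weak (phi : R -> R) : test_function `]0, T[%classic phi ->
    \int[mu]_(r in `]0, T[%classic) (N r * derive1 phi r) =
    - \int[mu]_(r in `]0, T[%classic) (df r * phi r).
  move=> tphi; have Hphi := Hw phi tphi; have [dphi cdphi _] := tphi.
  have cphi : continuous phi.
    by move=> x; apply: differentiable_continuous; apply/derivable1_diffP.
  have [d dE] : exists d : R -> R, d = derive1 phi by exists (derive1 phi).
  rewrite -dE in Hphi cdphi *.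
  have mult (f : R -> R -> R) (c : R -> R) : continuous c ->
      itg (mu \x mu)%E (`]0, T[%classic `*` E) (fun z : mR * mR => f z.1 z.2) ->
      itg (mu \x mu)%E (`]0, T[%classic `*` E) (fun z : mR * mR => f z.1 z.2 * c z.1).
    move=> cc if_; have [M _ cM] := cont_bounded 0 T cc.
    have : itg (mu \x mu)%E (`]0, T[%classic `*` E) (fun z : mR * mR => c z.1 * f z.1 z.2).
      apply: (@itgMb _ _ _ (mu \x mu)%E _ mTE (fun z : mR * mR => c z.1) _ M) => //.
        apply: measurable_funTS; apply: measurableT_comp => //.
        exact: continuous_measurable_fun.
      by move=> z [/= h _]; move: h; rewrite in_itv/= => /andP[? ?]; rewrite cM// !ltW.
    by apply: itg_eq => // z _; rewrite mulrC.
  have m1 := mult w _ cdphi iwE; have m2 := mult wt _ cphi iwtE.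
  have [a1 a2 i1 i2 E1] := @Rfubini_leb _ _ (fun r x => w r x * d r) mITV mE' m1.
  have [b1 b2 j1 j2 E2] := @Rfubini_leb _ _ (fun r x => wt r x * phi r) mITV mE' m2.
  have pull (f : R -> R -> R) (c : R -> R) :
      {ae mu, forall r, `]0, T[%classic r -> itg mu E (fun x => f r x)} ->
      {ae mu, forall r, `]0, T[%classic r ->
        (\int[mu]_(x in E) f r x) * c r = \int[mu]_(x in E) (f r x * c r)}.
    move=> ae; apply: (ae_imp ae) => r ir rT.
    exact: (esym (@RintegralZr _ _ _ mu E (f r) (c r) mE' (ir rT))).
  have mN : measurable_fun `]0, T[%classic N.
    have mN1 : measurable_fun `[0, T]%classic N by exact: subspace_continuous_measurable_fun.
    apply: (measurable_funS _ _ mN1); first exact: measurable_itv.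
    exact: subset_itv_oo_cc.
  transitivity (\int[mu]_(r in `]0, T[%classic) (\int[mu]_(x in E) (w r x * d r))).
    apply: ae_eq_Rintegral; [exact: mITV| |exact: itg_meas i1|].
      have mdphi : measurable_fun (`]0, T[%classic : set mR) d by apply: cont_meas.
      by have := measurable_funM mN mdphi; exact.
    apply: (ae_imp2 (ae_imp2 WE aw (fun r h1 h2 => conj h1 h2)) (pull w d aw)) => r [Wr ir] pr rT.
    have rT' : r \in `]0, T[ by exact: rT.
    have rTc : r \in `[0, T].
      by move: rT'; rewrite !in_itv/= => /andP[? ?]; rewrite !ltW.
    rewrite -(pr rT); congr (_ * _).
    have iWr : itg mu E (W r) by apply: itgS (WI r rTc).
    apply: ae_eq_Rintegral; [exact: mE|exact: itg_meas iWr|exact: itg_meas (ir rT)|].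
    by apply: (ae_imp (Wr rT')) => x Hx xE; apply: Hx; exact: El.
  rewrite E1.
  transitivity (\int[mu]_(x in E) (- (\int[mu]_(r in `]0, T[%classic) (wt r x * phi r)))).
    apply: ae_eq_Rintegral; [exact: mE|exact: itg_meas i2| |].
      by have := itg_meas (itgN j2); exact.
    by apply: (ae_imp Hphi) => x Hx xE; apply: Hx; exact: El.
  transitivity (- (\int[mu]_(x in E) (\int[mu]_(r in `]0, T[%classic) (wt r x * phi r)))).
    rewrite -mulN1r -(RintegralZl _ mE j2); apply: eq_Rintegral => x _.
    by rewrite mulN1r.
  rewrite -E2; congr (- _).
  apply: ae_eq_Rintegral; [exact: mITV|exact: itg_meas j1| |].
    have mphi : measurable_fun (`]0, T[%classic : set mR) phi by apply: cont_meas.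
    by have := measurable_funM (itg_meas iD) mphi; exact.
  by apply: (ae_imp (pull wt phi awt)) => r Hr rT; rewrite -(Hr rT).
have [P pP NP] := weak_derivative_prim T0 (@subset_refl _ _) cN iD weak.
have /andP[t0 tT1] := tT.
have Nt : N t - N 0 = oint df 0 t.
  have z00 : 0 <= (0 : R) <= T by rewrite lexx ltW.
  rewrite (NP t tT) (NP 0 z00) (pP.2 _ _ t0); apply: oint_eq => r /andP[r0 rt].
  by rewrite patchE mem_set//= in_itv/= r0 (lt_le_trans rt).
have iFt : itg (mu \x mu)%E (`]0, t[%classic `*` E) F.
  by apply: itgS iF => //; exact: measurableX.
have mt : measurable (`]0, t[%classic : set mR) by [].
have [_ _ _ iFx EF] := @Rfubini_leb _ _ (fun r x => F (r, x)) mt mE' iFt.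
have iW0E : itg mu E (W 0) by apply: itgS iW0.
rewrite /path (RintegralD mE' iW0E iFx).
have -> : \int[mu]_(x in E) W t x = N t by [].
have -> : N t = N 0 + oint df 0 t by rewrite -Nt; ring.
congr (_ + _); transitivity (oint (fun r => \int[mu]_(x in E) F (r, x)) 0 t); last exact: EF.
apply: oint_eq => r /andP[r0 rt]; apply: eq_Rintegral => x /set_mem xE.
have rxQ : space_time T l (r, x).
  by split; [rewrite /= in_itv/= r0 (lt_le_trans rt)|exact: El].
by rewrite /F patchE mem_set.
Qed.

End versions.

(** * Integrability on rectangles from bounds on sections *)

Section product_integrability.
Context {R : realType}.
Notation mu := (@lebesgue_measure R).
Notation mR := (measurableTypeR R).

(** Tonelli's criterion: the L^1 norms of the sections are bounded by one constant over a base of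
    finite measure. *)
Lemma itg_rect_sections (A B : set mR) (f : mR * mR -> R) (C : R) :
  measurable A -> measurable B -> (mu A < +oo)%E -> measurable_fun (A `*` B) f ->
  (forall t, A t -> itg mu B (fun x => f (t, x))) ->
  (forall t, A t -> \int[mu]_(x in B) `|f (t, x)| <= C) ->
  itg (mu \x mu)%E (A `*` B) f.
Proof.
move=> mA mB Aoo mf itf fC.
have mAB : measurable (A `*` B) by exact: measurableX.
have mp : measurable_fun setT (f \_ (A `*` B)) by exact: (measurable_restrictT f mAB).1.
suff H : itg (mu \x mu)%E setT (f \_ (A `*` B)).
  have : itg (mu \x mu)%E (A `*` B) (f \_ (A `*` B)) by apply: itgS H.
  by apply: itg_eq => // z zAB; rewrite patchE mem_set.
have mEp : measurable_fun setT (EFin \o (f \_ (A `*` B))) by exact: measurableT_comp.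
apply/(integrable12ltyP mu mu mEp).
apply: (@le_lt_trans _ _ (\int[mu]_(t in A) (`|C|%:E))%E); last first.
  by rewrite integral_cst//= lte_mul_pinfty.
rewrite [leRHS]integral_mkcond; apply: ge0_le_integral => //.
- by move=> t _; apply: integral_ge0.
- apply: (measurable_fun_fubini_tonelli_F (abse \o (EFin \o (f \_ (A `*` B))))) => //=.
  exact: measurableT_comp.
- apply: (measurable_restrictT _ mA).1; exact: measurable_cst.
move=> t _; rewrite patchE; case: ifPn => [/set_mem At|/negP tA].
  have h := itf t At.
  have ha := itg_abs h.
  apply: (@le_trans _ _ (\int[mu]_(x in B) `|f (t, x)|%:E)%E).
    rewrite [leRHS]integral_mkcond le_eqVlt; apply/orP; left; apply/eqP.
    apply: eq_integral => x _; rewrite /= !patchE.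
    have [xB|xB] := boolP (x \in B); first by rewrite mem_set//; split => //=; exact: set_mem.
    by rewrite memNset ?normr0//= => -[_ /= /mem_set]; rewrite (negbTE xB).
  have := fC t At; rewrite -lee_fin /Rintegral fineK; last exact: integrable_fin_num ha.
  by move=> h1; apply: (le_trans h1); rewrite lee_fin ler_norm.
rewrite integral0_eq// => x _; rewrite /= patchE memNset/= ?normr0// => -[/= At _].
by apply: tA; exact: mem_set.
Qed.

End product_integrability.

(** * Entropy inequality *)

Section entropy_inequality.
Context {R : realType}.
Notation mu := (@lebesgue_measure R).
Notation mR := (measurableTypeR R).
Variables (T l : R).

Definition rect : set (mR * mR) := `]0, T[%classic `*` `]0, l[%classic.

Lemma measurable_rect : measurable rect.
Proof. exact: measurableX. Qed.

Lemma measurable_path_rect F w0 : itg (mu \x mu)%E setT F -> oitg w0 0 l ->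
  measurable_fun rect (fun z : mR * mR => path F w0 z.1 z.2).
Proof.
move=> iF iw0; apply: measurable_funD.
  apply: (@measurable_comp _ _ _ _ _ _ (`]0, l[%classic : set mR)) => //.
  - by move=> _ [z [_ zl] <-].
  - exact: oitg_meas iw0.
  - by apply: measurable_funTS; exact: measurable_snd.
by apply: measurable_funTS; exact: (@measurable_path R F iF).
Qed.

Lemma path_norm1 F w0 t : itg (mu \x mu)%E setT F ->
  (forall r x, ~~ (0 < r < T) -> F (r, x) = 0) -> oitg w0 0 l -> 0 <= t ->
  oint (fun x => `|path F w0 t x|) 0 l <=
  oint (fun x => `|w0 x|) 0 l + \int[mu]_r (\int[mu]_(x in `]0, l[%classic) `|F (r, x)|).
Proof.
move=> iF F0 iw0 t0.
have ip r := path_itg iF iw0 r.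
have ipt := ip t; have ip0 := ip 0.
have id_ := oitgB ipt ip0.
apply: (@le_trans _ _ (oint (fun x => `|w0 x| + `|path F w0 t x - path F w0 0 x|) 0 l)).
  apply: oint_le; [exact: oitg_abs ipt|by apply: oitgD; [exact: oitg_abs|exact: oitg_abs id_]|].
  by move=> x _; rewrite -{1}(path0 F w0 x) -{1}(subrK (path F w0 0 x) (path F w0 t x)) addrC ler_normD.
rewrite ointD; [|exact: oitg_abs|exact: oitg_abs id_].
rewrite lerD2l; apply: le_trans (path_modulus iF F0 iw0 t0) _.
have iN := @itg_time_norm R l F iF.
rewrite /oint [leLHS]Rintegral_mkcond; apply: le_Rintegral => //.
  by apply: itg_patch => //; apply: itgS iN.
move=> r _; rewrite patchE; case: ifPn => _; first by [].
by apply: Rintegral_ge0 => x _; exact: normr_ge0.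
Qed.

Lemma path_itg_rect F w0 : itg (mu \x mu)%E setT F ->
  (forall r x, ~~ (0 < r < T) -> F (r, x) = 0) -> oitg w0 0 l ->
  itg (mu \x mu)%E rect (fun z : mR * mR => path F w0 z.1 z.2).
Proof.
move=> iF F0 iw0.
apply: (@itg_rect_sections _ _ _ _ (oint (fun x => `|w0 x|) 0 l
  + \int[mu]_r (\int[mu]_(x in `]0, l[%classic) `|F (r, x)|))).
- exact: measurable_itv.
- exact: measurable_itv.
- exact: leb_oo_lty.
- exact: measurable_path_rect.
- by move=> t _; have := path_itg iF iw0 t.
- move=> t /=; rewrite in_itv/= => /andP[t0 _].
  exact: (path_norm1 iF F0 iw0 (ltW t0)).
Qed.

Lemma path_comp_itg_rect F w0 (g : R -> R) (L : R) : itg (mu \x mu)%E setT F ->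
  (forall r x, ~~ (0 < r < T) -> F (r, x) = 0) -> oitg w0 0 l ->
  (forall y z, `|g y - g z| <= L * `|y - z|) ->
  itg (mu \x mu)%E rect (fun z : mR * mR => g (path F w0 z.1 z.2)).
Proof.
move=> iF F0 iw0 gL; have mrect := measurable_rect.
have ip := path_itg_rect iF F0 iw0.
have mp := measurable_path_rect iF iw0.
have cg := lipschitz_continuous gL.
have mg : measurable_fun rect (fun z : mR * mR => g (path F w0 z.1 z.2)).
  by apply: (measurableT_comp _ mp); exact: continuous_measurable_fun.
have h : itg (mu \x mu)%E rect (fun z : mR * mR => `|g 0| + L * `|path F w0 z.1 z.2|).
  apply: itgD => //; last by apply: itgZ => //; exact: itg_abs ip.
  apply: itg_cst => //; suff : ((mu \x mu)%E rect < +oo)%E by [].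
  rewrite product_measure1E//; apply: lte_mul_pinfty => //.
  - by rewrite ge0_fin_numE//; exact: leb_oo_lty.
  - exact: leb_oo_lty.
apply: (itg_dom mrect mg h) => z _ /=.
rewrite -[g (path _ _ _ _)](subrK (g 0)) addrC (le_trans (ler_normD _ _))//.
by rewrite lerD2l -[X in L * `|X|]subr0.
Qed.

(** Integrates [entropy_path] over [x] and exchanges the integrals. The profile is affine in [x],
    and the bound on [g] makes [Psi] globally Lipschitz; these provide integrability on the
    rectangle. *)
Lemma entropy_int F w0 (Psi g B beta A m k : R -> R) (Kg Kk : R) :
  itg (mu \x mu)%E setT F -> (forall r x, ~~ (0 < r < T) -> F (r, x) = 0) -> oitg w0 0 l ->
  (forall x y, Psi y - Psi x <= g y * (y - x)) -> continuous g ->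
  (forall y, `|g y| <= Kg) ->
  (forall x y, B y - B x <= beta y * (y - x)) -> continuous beta -> continuous B ->
  continuous A -> continuous m -> itg mu setT k -> (forall r, 0 <= k r <= Kk) ->
  (forall s t x, 0 < x < l -> s <= t ->
     `|(A t + m t * x) - (A s + m s * x)| <= oint k s t) ->
  let al t x := A t + m t * x in
  let p t x := path F w0 t x in
  let E t := oint (fun x => Psi (p t x) + B (al t x) - al t x * p t x) 0 l in
  let D r := oint (fun x => (g (p r x) - al r x) * F (r, x)
                            + `|beta (al r x) - p r x| * k r) 0 l in
  [/\ forall t, 0 <= t <= T -> oitg (fun x => Psi (p t x) + B (al t x) - al t x * p t x) 0 l,
      oitg E 0 T, oitg D 0 T &
      forall s t, 0 <= s -> s <= t -> t <= T -> E t - E s <= oint D s t].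
Proof.
move=> iF F0 iw0 hPsi cg gK hB cbeta cB cA cm ik kK hal al p E D.
have mrect := measurable_rect.
have Kg0 : 0 <= Kg by exact: le_trans (gK 0).
have PsiL y z : `|Psi y - Psi z| <= Kg * `|y - z|.
  have H a b : Psi a - Psi b <= Kg * `|a - b|.
    apply: le_trans (hPsi _ _) _; apply: le_trans (ler_norm _) _.
    by rewrite normrM ler_wpM2r.
  rewrite ler_norml; apply/andP; split; last exact: H.
  by have := H z y; rewrite distrC; lra.
have [KA KA0 AK] := cont_bounded 0 T cA.
have [Km Km0 mK] := cont_bounded 0 T cm.
(* The profile stays in a compact interval on the rectangle, so [B] and [beta], which are merely
   continuous, are bounded along it. *)
pose Ka := KA + Km * l.
have alK t x : 0 <= t <= T -> 0 < x < l -> `|al t x| <= Ka.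
  move=> tT /andP[x0 xl]; rewrite (le_trans (ler_normD _ _))// lerD ?AK//.
  by rewrite normrM (gtr0_norm x0) ler_pM// ?mK// ltW.
have [KB _ BK] := cont_bounded (- Ka) Ka cB.
have [Kb _ bK] := cont_bounded (- Ka) Ka cbeta.
have cal t : continuous (al t).
  move=> x; apply: cvgD; first exact: cvg_cst.
  by apply: cvgM; [exact: cvg_cst|exact: cvg_id].
have mal : measurable_fun rect (fun z : mR * mR => al z.1 z.2).
  apply: measurable_funTS; apply: measurable_funD.
    by apply: (measurableT_comp (continuous_measurable_fun cA)).
  apply: measurable_funM => //.
  by apply: (measurableT_comp (continuous_measurable_fun cm)).
have mB := measurableT_comp (continuous_measurable_fun cB) mal.
have mb := measurableT_comp (continuous_measurable_fun cbeta) mal.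
have mp := measurable_path_rect iF iw0.
have mg := measurableT_comp (continuous_measurable_fun cg) mp.
have ipr := path_itg_rect iF F0 iw0.
have iPr := path_comp_itg_rect iF F0 iw0 PsiL.
have icst (c : R) : itg (mu \x mu)%E rect (fun=> c).
  apply: itg_cst => //; suff : ((mu \x mu)%E rect < +oo)%E by [].
  rewrite product_measure1E//; apply: lte_mul_pinfty => //.
  - by rewrite ge0_fin_numE//; exact: leb_oo_lty.
  - exact: leb_oo_lty.
have rectE (z : mR * mR) : rect z -> 0 <= z.1 <= T /\ 0 < z.2 < l.
  by move=> [/=]; rewrite !in_itv/= => /andP[h1 h2] h3; rewrite !ltW.
have iE : itg (mu \x mu)%E rect (fun z : mR * mR => Psi (p z.1 z.2) + B (al z.1 z.2) - al z.1 z.2 * p z.1 z.2).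
  apply: itgB => //.
    apply: itgD => //; apply: (itg_dom mrect mB (icst KB)) => z /rectE[h1 h2].
    by rewrite BK//; have := alK _ _ h1 h2; rewrite ler_norml.
  by apply: (itgMb mrect mal _ ipr) => z /rectE[h1 h2]; exact: alK.
have iFr : itg (mu \x mu)%E rect F by apply: itgS iF.
have mk : measurable_fun rect (fun z : mR * mR => k z.1).
  apply: measurable_funTS; apply: (measurableT_comp (itg_meas ik)) => //.
have iD : itg (mu \x mu)%E rect (fun z : mR * mR => (g (p z.1 z.2) - al z.1 z.2) * F (z.1, z.2)
                            + `|beta (al z.1 z.2) - p z.1 z.2| * k z.1).
  apply: itgD => //.
    have h : itg (mu \x mu)%E rect (fun z : mR * mR => (g (p z.1 z.2) - al z.1 z.2) * F z).
      apply: (itgMb mrect _ _ iFr) => //.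
        exact: measurable_funB mg mal.
      move=> z /rectE[h1 h2]; rewrite (le_trans (ler_normB _ _))//.
      by apply: lerD; [exact: gK|exact: alK h1 h2].
    by apply: itg_eq h => // -[r x] _.
  have h : itg (mu \x mu)%E rect (fun z : mR * mR => Kk * (Kb + `|p z.1 z.2|)).
    by apply: itgZ => //; apply: itgD => //; exact: itg_abs ipr.
  have mm : measurable_fun rect (fun z : mR * mR => `|beta (al z.1 z.2) - p z.1 z.2| * k z.1).
    apply: measurable_funM => //; apply: measurableT_comp => //.
    exact: measurable_funB mb mp.
  apply: (itg_dom mrect mm h) => z /rectE[h1 h2].
  have /andP[k0 kKk] := kK z.1.
  rewrite normrM normr_id (ger0_norm k0) mulrC ler_pM//.
  rewrite (le_trans (ler_normB _ _))// lerD2r bK//.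
  by have := alK _ _ h1 h2; rewrite ler_norml.
have mT : measurable (`]0, T[%classic : set mR) by exact: measurable_itv.
have ml : measurable (`]0, l[%classic : set mR) by exact: measurable_itv.
have [_ _ iE1 _ _] := @Rfubini_leb R _ _ (fun t x => Psi (p t x) + B (al t x) - al t x * p t x) mT ml iE.
pose Th r x := (g (p r x) - al r x) * F (r, x) + `|beta (al r x) - p r x| * k r.
have [_ _ iD1 _ _] := @Rfubini_leb R _ _ Th mT ml iD.
have iphi t : 0 <= t <= T -> oitg (fun x => Psi (p t x) + B (al t x) - al t x * p t x) 0 l.
  move=> tT; apply: oitgB.
    apply: oitgD; first exact: (path_comp_itg iF iw0 t PsiL).
    apply: oitg_cont => x; apply: continuous_comp; [exact: cal|exact: cB].
  by apply: oitgM; [exact: cal|exact: path_itg iF iw0 t].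
split=> // s t s0 st tT.
have t0 := le_trans s0 st; have sT := le_trans st tT.
have mst : measurable (`]s, t[%classic : set mR) by exact: measurable_itv.
have iDst : itg (mu \x mu)%E (`]s, t[%classic `*` `]0, l[%classic) (fun z : mR * mR => Th z.1 z.2).
  apply: itgS iD => //; first exact: measurableX.
  move=> z [/= + h2]; rewrite /rect !in_itv/= => /andP[sz zt]; split=> //=.
  by rewrite in_itv/= (le_lt_trans s0 sz) (lt_le_trans zt).
have [_ _ _ iDx ED] := @Rfubini_leb R _ _ Th mst ml iDst.
have h1 : 0 <= s <= T by rewrite s0.
have h2 : 0 <= t <= T by rewrite t0.
rewrite /E -ointB; [|exact: iphi|exact: iphi].
have -> : oint D s t = oint (fun x => oint (fun r => Th r x) s t) 0 l by exact: ED.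
apply: ae_le_Rintegral.
- exact: measurable_itv.
- exact: oitgB (iphi t h2) (iphi s h1).
- exact: iDx.
apply: (ae_imp (ae_itg_time iF)) => x ix; rewrite /= in_itv/= => xl.
have px := path_prim w0 F0 ix.
have := @entropy_path R Psi g B beta (path F w0 ^~ x) (fun r => F (r, x)) (al ^~ x) k s t
  st hPsi cg hB cbeta px ik.
by apply=> a b ab; exact: hal.
Qed.

End entropy_inequality.

(** * Identification of solutions with paths *)

Section version_comp.
Context {R : realType}.
Notation mu := (@lebesgue_measure R).
Notation mR := (measurableTypeR R).
Variables (T l : R).

(** Integrals of both sides over any measurable set are continuous in time and agree for almost
    every time, hence for all times; this is what gives the estimate at each [s] and [t]. *)
Lemma version_comp_path (F : mR * mR -> R) (w0 g : R -> R) (L : R) (u U : R -> R -> R) :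
  0 < T -> 0 < l ->
  itg (mu \x mu)%E setT F -> (forall r x, ~~ (0 < r < T) -> F (r, x) = 0) -> oitg w0 0 l ->
  0 <= L -> (forall y z, `|g y - g z| <= L * `|y - z|) ->
  continuous_version 2%:E T l u U ->
  {ae mu, forall t, t \in `]0, T[ -> {ae mu, forall x, x \in `]0, l[ -> u t x = g (path F w0 t x)}} ->
  forall t, 0 <= t <= T -> {ae mu, forall x, x \in `]0, l[ -> U t x = g (path F w0 t x)}.
Proof.
move=> T0 l0 iF F0 iw0 L0 gL cU Hu t tT.
have [UL UE _] := cU.
have UI s : 0 <= s <= T -> oitg (U s) 0 l.
  move=> sT; have : s \in `[0, T] by rewrite in_itv.
  move=> /UL; apply: in_Lp_itg => //; first exact: leb_oo_lty.
  by rewrite ler1n.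
apply: ae_eq_of_integrals; [exact: UI|exact: (path_comp_itg iF iw0 t gL)|].
move=> E El mE.
pose N1 r := \int[mu]_(x in E) U r x.
pose N2 r := \int[mu]_(x in E) g (path F w0 r x).
have c1 : {within `[0, T], continuous N1}.
  exact: (version_integral_continuous l0 (or_intror erefl) cU mE El).
have c2 : {within `[0, T], continuous N2}.
  apply: continuous_subspaceT; exact: (path_comp_continuous iF F0 iw0 L0 gL mE El).
apply: (continuous_ae_eq T0 c1 c2 _ tT).
apply: (ae_imp2 UE Hu) => r Ur ur rT.
have rT' : 0 <= r <= T by move: rT; rewrite in_itv/= => /andP[? ?]; rewrite !ltW.
have iUE : itg mu E (U r) by apply: itgS (UI r rT').
have igE : itg mu E (fun x => g (path F w0 r x)) by apply: itgS (path_comp_itg iF iw0 r gL).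
apply: ae_eq_Rintegral; [exact: mE|exact: itg_meas iUE|exact: itg_meas igE|].
apply: (ae_imp2 (Ur rT) (ur rT)) => x h1 h2 xE.
have xl : x \in `]0, l[ by exact: El.
by rewrite h1// h2.
Qed.

Lemma ae_swap_rect (f : mR * mR -> R) : measurable_fun (rect T l) f ->
  {ae mu, forall t, t \in `]0, T[ -> {ae mu, forall x, x \in `]0, l[ -> f (t, x) = 0}} ->
  {ae mu, forall x, x \in `]0, l[ -> {ae mu, forall t, t \in `]0, T[ -> f (t, x) = 0}}.
Proof.
move=> mf H.
have mT : measurable (`]0, T[%classic : set mR) by exact: measurable_itv.
have ml : measurable (`]0, l[%classic : set mR) by exact: measurable_itv.
have := @ae_prod_swap _ _ _ _ R mu mu _ _ mT ml f (leb_oo_lty 0 T) (leb_oo_lty 0 l) mf.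
exact.
Qed.

End version_comp.

(** * The nonlinearity and its convex primitives *)

Section nonlinearity.
Context {R : realType}.
Notation mu := (@lebesgue_measure R).
Variable beta : R -> R.
Hypothesis cbeta : continuous beta.
Hypothesis dbeta : forall x : R, x != 0 ->
  [/\ derivable beta x 1, {for x, continuous (derive1 beta)} & 0 < derive1 beta x].

(** [beta] may fail to be differentiable at 0, so the interval must not have 0 in its interior;
    having it as an end point is harmless. *)
Lemma beta_mvt (x y : R) : x <= y -> 0 <= x \/ y <= 0 -> x != y ->
  exists2 z, x < z < y & beta y - beta x = derive1 beta z * (y - x).
Proof.
move=> xy s0 xy'; have xyl : x < y by rewrite lt_neqAle xy'.
have [||z] := @MVT _ beta (derive1 beta) x y xyl.
- move=> z; rewrite in_itv/= => /andP[xz zy].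
  have [|D _ _] := dbeta (x := z).
    by case: s0 => h; rewrite ?(gt_eqF (le_lt_trans h xz))// (lt_eqF (lt_le_trans zy h)).
  by rewrite derive1E; exact: derivableP.
- exact: continuous_subspaceT.
- by rewrite in_itv/= => zz E; exists z.
Qed.

Lemma beta_homo : {homo beta : x y / x <= y}.
Proof.
have half x y : x <= y -> 0 <= x \/ y <= 0 -> beta x <= beta y.
  move=> xy s0; have [->//|xy'] := eqVneq x y.
  have [z /andP[xz zy] E] := beta_mvt xy s0 xy'.
  have z0 : z != 0.
    by case: s0 => h; rewrite ?(gt_eqF (le_lt_trans h xz))// (lt_eqF (lt_le_trans zy h)).
  have [_ _ d0] := dbeta z0.
  by rewrite -subr_ge0 E mulr_ge0 ?subr_ge0// ltW.
move=> x y xy; have [x0|x0] := leP 0 x; first by apply: half => //; left.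
have [y0|y0] := leP y 0; first by apply: half => //; right.
apply: (@le_trans _ _ (beta 0)); apply: half.
- exact: ltW.
- by right.
- exact: ltW.
- by left.
Qed.

(** On a compact interval to the right of 0 the derivative is continuous and positive; its minimum
    and maximum are the two constants. *)
Lemma beta_bilipschitz (c d : R) : 0 < c -> c <= d -> exists kap K : R,
  [/\ 0 < kap, 0 < K & forall x y, c <= x -> x <= y -> y <= d ->
    kap * (y - x) <= beta y - beta x <= K * (y - x)].
Proof.
move=> c0 cd.
have pos z : c <= z -> z != 0 by move=> cz; rewrite gt_eqF// (lt_le_trans c0).
have cdb : {within `[c, d], continuous (derive1 beta)}.
  apply/subspace_continuousP => z /=; rewrite in_itv/= => /andP[cz _].
  have [_ cz' _] := dbeta (pos _ cz).
  by apply: cvg_within_filter.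
have [z1 z1cd H1] := EVT_min cd cdb; have [z2 z2cd H2] := EVT_max cd cdb.
have z1p : 0 < derive1 beta z1.
  by move: z1cd; rewrite in_itv/= => /andP[cz _]; have [] := dbeta (pos _ cz).
have z2p : 0 < derive1 beta z2.
  by move: z2cd; rewrite in_itv/= => /andP[cz _]; have [] := dbeta (pos _ cz).
exists (derive1 beta z1), (derive1 beta z2); split=> // x y cx xy yd.
have [->|xy'] := eqVneq x y; first by rewrite !subrr !mulr0 lexx.
have [|z /andP[xz zy] ->] := beta_mvt xy _ xy'.
  by left; rewrite (le_trans (ltW c0)).
have zcd : z \in `[c, d].
  by rewrite in_itv/= (le_trans cx (ltW xz)) (le_trans (ltW zy) yd).
by rewrite !ler_wpM2r ?subr_ge0 ?H1 ?H2.
Qed.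

(** The intermediate value theorem solves [beta u = cl y] in [[c, d]], where [cl] clamps [y] to the
    range of [beta] there. Clamping is nonexpansive and [beta] expands by at least [kap], whence the
    Lipschitz constant. *)
Lemma clamped_inverse (c d kap : R) : c <= d -> 0 < kap ->
  (forall x y, c <= x -> x <= y -> y <= d -> kap * (y - x) <= beta y - beta x) ->
  exists g : R -> R, [/\ forall u, g (beta u) = Num.max c (Num.min u d),
    forall y z, `|g y - g z| <= kap^-1 * `|y - z|,
    {homo g : y z / y <= z}, forall y, c <= g y <= d &
    forall y, beta c <= y <= beta d -> beta (g y) = y].
Proof.
move=> cd kap0 Hk; have bcd := beta_homo cd.
pose cl y := Num.max (beta c) (Num.min y (beta d)).
have clP y : beta c <= cl y <= beta d.
  by rewrite /cl le_max lexx/= ge_max bcd ge_min lexx orbT.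
have ex y : exists u, c <= u <= d /\ beta u = cl y.
  have cb : {within `[c, d], continuous beta} by exact: continuous_subspaceT.
  have [|u ucd E] := @IVT _ beta c d (cl y) cd cb.
    by rewrite min_l ?max_r.
  by exists u; split=> //; move: ucd; rewrite in_itv.
pose g y := sval (cid (ex y)).
have gcd y : c <= g y <= d by have [] := svalP (cid (ex y)).
have gE y : beta (g y) = cl y by have [] := svalP (cid (ex y)).
have clL y z : y <= z -> cl y <= cl z /\ cl z - cl y <= z - y.
  have mx (b u v : R) : u <= v -> Num.max b u <= Num.max b v /\ Num.max b v - Num.max b u <= v - u.
    by move=> uv; rewrite !maxEle; have [h1|h1] := leP b u; have [h2|h2] := leP b v; split; lra.
  have mn (b u v : R) : u <= v -> Num.min u b <= Num.min v b /\ Num.min v b - Num.min u b <= v - u.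
    by move=> uv; rewrite !minEle; have [h1|h1] := leP u b; have [h2|h2] := leP v b; split; lra.
  move=> yz; have [h1 h2] := mn (beta d) _ _ yz; have [h3 h4] := mx (beta c) _ _ h1.
  by split => //; exact: le_trans h2.
have gh y z : y <= z -> g y <= g z.
  move=> yz; rewrite leNgt; apply/negP => h.
  have /andP[cz _] := gcd z; have /andP[_ yd] := gcd y.
  have := Hk _ _ cz (ltW h) yd; rewrite !gE; have [h1 _] := clL y z yz.
  have h2 : 0 < kap * (g y - g z) by rewrite mulr_gt0// subr_gt0.
  lra.
have gL y z : y <= z -> g z - g y <= kap^-1 * (z - y).
  move=> yz; have /andP[cy _] := gcd y; have /andP[_ zd] := gcd z.
  rewrite ler_pdivlMl//; apply: le_trans (Hk _ _ cy (gh _ _ yz) zd) _.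
  by rewrite !gE; have [] := clL y z yz.
have inj u v : c <= u <= d -> c <= v <= d -> beta u = beta v -> u = v.
  move=> /andP[cu ud] /andP[cv vd] E; apply/eqP; rewrite eq_le.
  have [uv|vu] := leP u v.
    have := Hk _ _ cu uv vd; rewrite E subrr pmulr_rle0// subr_le0.
    by move=> ->.
  have := Hk _ _ cv (ltW vu) ud; rewrite E subrr pmulr_rle0// subr_le0.
  by rewrite leNgt vu.
exists g; split=> //.
- move=> u; apply: inj => //.
    by rewrite le_max lexx/= ge_max cd ge_min lexx orbT.
  rewrite gE /cl; have [ud|du] := leP u d.
    have := beta_homo ud => h; rewrite (min_l h); have [cu|uc] := leP c u.
      by rewrite max_r// beta_homo.
    by rewrite max_l// beta_homo// ltW.
  by have := beta_homo (ltW du) => h; rewrite (min_r h) !max_r.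
- have H y z : y <= z -> `|g z - g y| <= kap^-1 * `|z - y|.
    move=> yz; rewrite (ger0_norm (_ : 0 <= z - y)) ?subr_ge0//.
    by rewrite ger0_norm ?subr_ge0 ?gh// gL.
  move=> y z; have [yz|/ltW zy] := leP y z; last exact: H.
  by rewrite distrC (distrC y); exact: H.
- by move=> y /andP[h1 h2]; rewrite gE /cl min_l ?max_r.
Qed.

End nonlinearity.

(** * Convex primitives, subgradients and the Legendre transform *)

Section convex_primitive.
Context {R : realType}.
Notation mu := (@lebesgue_measure R).
Implicit Types (h beta g B Psi : R -> R).

Lemma primitiveB h (x y : R) : continuous h -> x <= y ->
  primitive h y - primitive h x = oint h x y.
Proof.
move=> ch xy; have ih s t : oitg h s t by exact: oitg_cont.
rewrite /primitive; have [x0|x0] := leP 0 x.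
  rewrite (le_trans x0 xy) !oint_cc// (@oint_cat _ h 0 x y)//; ring.
have [y0|y0] := leP 0 y.
  rewrite !oint_cc// (@oint_cat _ h x 0 y)// ?ltW//; ring.
rewrite !oint_cc// (@oint_cat _ h x y 0)// ?ltW//; ring.
Qed.

Lemma primitive_subgradient h : continuous h -> {homo h : x y / x <= y} ->
  forall x y, primitive h y - primitive h x <= h y * (y - x).
Proof.
move=> ch hh x y; have ih s t : oitg h s t by exact: oitg_cont.
have [xy|yx] := leP x y.
  rewrite primitiveB// -oint_cst//; apply: oint_le => //; first exact: oitg_cst.
  by move=> z /andP[_ zy]; apply: hh; exact: ltW.
have yx' := ltW yx.
rewrite -opprB (primitiveB ch yx') -[leRHS]opprK -mulrN opprB lerN2.
rewrite -(oint_cst _ yx'); apply: oint_le => //; first exact: oitg_cst.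
by move=> z /andP[yz _]; apply: hh; exact: ltW.
Qed.

Lemma subgradient_continuous B beta : continuous beta ->
  (forall x y, B y - B x <= beta y * (y - x)) -> continuous B.
Proof.
move=> cb HB x; apply/cvgrPdist_le => e e0.
pose M := `|beta x| + 1; have M0 : 0 < M by rewrite ltr_wpDl.
near=> y.
have bM : `|beta y| <= M.
  rewrite -[beta y](subrK (beta x)) addrC (le_trans (ler_normD _ _))// lerD2l.
  by near: y; apply: cont_eps.
have yx : `|y - x| <= e / M.
  near: y; apply: (@cont_eps _ id); last by rewrite divr_gt0.
  by move=> z; exact: cvg_id.
have bMx : `|beta x| <= M by rewrite lerDl.
have P (b : R) : `|b| <= M -> b * (y - x) <= e /\ b * (x - y) <= e.
  move=> bM'; have : `|b| * `|y - x| <= e.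
    by rewrite (le_trans (ler_pM _ _ bM' yx))// mulrC divfK// gt_eqF.
  rewrite -normrM => h; split; first exact: le_trans (ler_norm _) h.
  by apply: le_trans (ler_norm _) _; rewrite -opprB mulrN normrN.
have := HB x y; have := HB y x; have [h1 h2] := P _ bM; have [h3 h4] := P _ bMx.
by rewrite ler_norml => q1 q2; clear - h1 h2 h3 h4 q1 q2; apply/andP; split; lra.
Unshelve. all: by end_near. Qed.

(** Two subgradient inequalities through the midpoint [m] give the lower bound
    [(beta m - beta v) * (a - m)]; each factor carries half of [a - v], hence [kap / 4].
    Monotonicity between [a] and [v] gives the upper bound. *)
Lemma subgradient_bounds B beta (c d kap K a v : R) :
  (forall x y, B y - B x <= beta y * (y - x)) ->
  (forall x y, c <= x -> x <= y -> y <= d ->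
     kap * (y - x) <= beta y - beta x <= K * (y - x)) ->
  c <= a <= d -> c <= v <= d ->
  kap / 4 * (a - v) ^+ 2 <= B a - B v - beta v * (a - v) <= K * (a - v) ^+ 2.
Proof.
move=> HB Hb /andP[ca ad] /andP[cv vd].
have up : B a - B v - beta v * (a - v) <= (beta a - beta v) * (a - v).
  by have := HB v a; lra.
pose m := (a + v) / 2.
have lo : (beta m - beta v) * (a - m) <= B a - B v - beta v * (a - v).
  by have := HB a m; have := HB m v; rewrite /m; lra.
apply/andP; split.
  apply: le_trans lo; have [av|va] := leP a v.
    have := Hb m v; rewrite /m => /(_ _ _ _).
    have h1 : c <= (a + v) / 2 by lra.
    have h2 : (a + v) / 2 <= v by lra.
    move=> /(_ h1 h2 vd)/andP[h _]; rewrite /m expr2.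
    have h3 : 0 <= v - a by lra.
    by have := ler_wpM2r h3 h; lra.
  have h1 : c <= v by [].
  have h2 : v <= m by rewrite /m; lra.
  have h3 : m <= d by rewrite /m; lra.
  have := Hb v m h1 h2 h3 => /andP[h _].
  have h4 : 0 <= a - v by lra.
  by have := ler_wpM2r h4 h; rewrite /m expr2; lra.
apply: le_trans up _; have [av|va] := leP a v.
  have := Hb a v ca av vd => /andP[_ h]; have h3 : 0 <= v - a by lra.
  by have := ler_wpM2r h3 h; rewrite expr2; lra.
have := Hb v a cv (ltW va) ad => /andP[_ h]; have h3 : 0 <= a - v by lra.
by have := ler_wpM2r h3 h; rewrite expr2; lra.
Qed.

(** Formally the derivative of [N] is [(g (beta u) - u) * beta'(u) = 0]. The subgradient
    inequalities replace this by increments of [N] that are quadratic in [t - s], and such a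
    function is constant. The constant normalises [Psi] into the Legendre transform of [B]. *)
Lemma legendre_constant Psi g B beta (c d K : R) : 0 <= K ->
  (forall x y, Psi y - Psi x <= g y * (y - x)) ->
  (forall x y, B y - B x <= beta y * (y - x)) ->
  (forall x y, c <= x -> x <= y -> y <= d -> 0 <= beta y - beta x <= K * (y - x)) ->
  (forall u, c <= u <= d -> g (beta u) = u) ->
  forall u, c <= u <= d ->
    Psi (beta u) + B u - u * beta u = Psi (beta c) + B c - c * beta c.
Proof.
move=> K0 hPsi HB Hb gb u /andP[cu ud].
pose N u := Psi (beta u) + B u - u * beta u.
have bound s t : c <= s -> s <= t -> t <= d -> `|N t - N s| <= K * (t - s) ^+ 2.
  move=> cs st td.
  have gs : g (beta s) = s by apply: gb; rewrite cs (le_trans st).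
  have gt_ : g (beta t) = t by apply: gb; rewrite td (le_trans cs).
  have /andP[h0 h] := Hb _ _ cs st td; have ts0 : 0 <= t - s by rewrite subr_ge0.
  have hh := ler_wpM2r ts0 h.
  have := hPsi (beta s) (beta t); have := hPsi (beta t) (beta s); rewrite gs gt_.
  have := HB s t; have := HB t s; rewrite ler_norml /N expr2 => ? ? ? ?.
  by apply/andP; split; lra.
(* Taken with [sg = 1] and [sg = -1] to bound the increment of [N] from both sides. *)
have half (sg : R) : `|sg| <= 1 -> sg * N u - sg * N c <= 0.
  move=> sg1; rewrite -(mul0r (u - c)) -oint_cst//.
  apply: (@local_to_global _ (fun x => sg * N x) _ (fun=> 1) c u cu).
  - exact: oitg_cst.
  - exact: oitg_cst.
  (* An interval shorter than twice this gauge satisfies [K * (t - s) <= e]. *)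
  move=> r e rcu e0; exists (e / (2 * (K + 1))).
    by rewrite divr_gt0// mulr_gt0// ltr_wpDl.
  move=> s t cs sr rt tu sd td; have st := le_trans sr rt.
  rewrite (@oint_eq _ _ (fun=> e)); last by move=> x _; rewrite add0r mulr1.
  rewrite oint_cst// -mulrBr; apply: le_trans (ler_norm _) _; rewrite normrM.
  apply: (@le_trans _ _ (K * (t - s) ^+ 2)).
    rewrite -[leRHS]mul1r ler_pM//; apply: bound => //; exact: le_trans ud.
  rewrite expr2 mulrA ler_wpM2r ?subr_ge0//.
  have : t - s <= 2 * (e / (2 * (K + 1))) by lra.
  have -> : 2 * (e / (2 * (K + 1))) = e / (K + 1) by field; lra.
  rewrite ler_pdivlMr; last by rewrite ltr_wpDl.
  have : 0 <= t - s by rewrite subr_ge0.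
  lra.
have h1 := half 1; have h2 := half (-1); rewrite normrN normr1 in h2.
have {}h1 := h1 ltac:(by rewrite normr1).
have {}h2 := h2 (lexx _).
by apply/eqP; rewrite eq_le -/(N u) -/(N c); apply/andP; split; lra.
Qed.

End convex_primitive.

Section oint_zero.
Context {R : realType}.
Notation mu := (@lebesgue_measure R).

Lemma oint_eq0_ae (f : R -> R) (s t : R) : oitg f s t -> (forall x, 0 <= f x) ->
  oint f s t = 0 -> {ae mu, forall x, x \in `]s, t[ -> f x = 0}.
Proof.
move=> if_ f0 E; have ml : measurable (`]s, t[%classic : set (measurableTypeR R)).
  exact: measurable_itv.
have h := @Rintegral_eq0_ae _ _ R mu _ ml f if_ (fun x _ => f0 x) E.
exact: h.
Qed.

Lemma oint_le_cst_ae (f : R -> R) (k l : R) : 0 <= l -> oitg f 0 l ->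
  (forall x, k <= f x) -> oint f 0 l <= l * k ->
  {ae mu, forall x, x \in `]0, l[ -> f x = k}.
Proof.
move=> l0 if_ kf fk.
have iB : oitg (fun x => f x - k) 0 l by apply: oitgB; [exact: if_|exact: oitg_cst].
have pos x : 0 <= f x - k by rewrite subr_ge0; exact: kf.
have I0 : 0 <= oint (fun x => f x - k) 0 l by apply: oint_ge0 => x _; exact: pos.
have I1 : oint (fun x => f x - k) 0 l <= 0.
  rewrite ointB; [|exact: if_|exact: oitg_cst].
  by rewrite (oint_cst _ l0) subr0 mulrC subr_le0 mulrC mulrC.
have I2 : oint (fun x => f x - k) 0 l = 0 by apply/eqP; rewrite eq_le I0 I1.
apply: (ae_imp (oint_eq0_ae iB pos I2)) => x Hx xl.
by apply/eqP; rewrite -subr_eq0; apply/eqP; exact: Hx.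
Qed.

End oint_zero.

(** * Bounds for weak solutions *)

Section weak_solutions.
Context {R : realType}.
Notation mu := (@lebesgue_measure R).
Notation mR := (measurableTypeR R).
Variables (p l alpha T : R) (beta u0 : R -> R) (ub : R -> R -> R).

(** What the equation provides at one fixed time; bundling it leaves a single exceptional null set
    of times. *)
Definition good_time (u ux bt : R -> R -> R) (F : mR * mR -> R) (w0 : R -> R) (t : R) : Prop :=
  [/\ sobolev p%:E `]0, l[%classic (u t) (ux t), oitg (bt t) 0 l,
      forall x, 0 < x < l -> F (t, x) = bt t x,
      forall v dv : R -> R, sobolev 2%:E `]0, l[%classic v dv ->
        inner l (bt t) v + inner l (mu_p p \o ux t) dv + alpha * inner_bd l (u t) v
        = alpha * inner_bd l (ub t) v &
      {ae mu, forall x, x \in `]0, l[ -> path F w0 t x = beta (u t x)}].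

Lemma weak_solution_path u : 0 < T -> 0 < l ->
  regular_weak_solution p l alpha beta u0 ub T u ->
  exists (ux bt : R -> R -> R) (F : mR * mR -> R) (w0 : R -> R),
  [/\ itg (mu \x mu)%E setT F, forall r x, ~~ (0 < r < T) -> F (r, x) = 0,
      oitg w0 0 l, {ae mu, forall x, x \in `]0, l[ -> w0 x = beta (u0 x)} &
      {ae mu, forall t, t \in `]0, T[ -> good_time u ux bt F w0 t}].
Proof.
move=> T0 l0 [ux [bt [[iu iux aesob] w11 [W [cW W0]] aeeq]]].
have [wL btL _] := w11.
pose F : mR * mR -> R := (fun z : mR * mR => bt z.1 z.2) \_ (space_time T l).
have mQ : measurable (space_time T l) by exact: measurableX.
have ib : itg (mu \x mu)%E (space_time T l) (fun z : mR * mR => bt z.1 z.2) by apply/in_Lp1_itg.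
have iF : itg (mu \x mu)%E setT F by exact: itg_patch.
have z0 : (0 : R) \in `[0, T] by rewrite in_itv/= lexx ltW.
have [WL WE _] := cW.
have iW0 : oitg (W 0) 0 l.
  by have := WL 0 z0; apply: in_Lp_itg => //; exact: leb_oo_lty.
have vp := version_path T0 l0 w11 cW.
have mT : measurable (`]0, T[%classic : set mR) by exact: measurable_itv.
have ml : measurable (`]0, l[%classic : set mR) by exact: measurable_itv.
have [aeb _ _ _ _] := @Rfubini_leb R _ _ bt mT ml ib.
exists ux, bt, F, (W 0); split => //.
  move=> r x rT; rewrite /F patchE memNset// => -[/= h _].
  by move: rT; rewrite in_itv/= in h; rewrite h.
apply: (ae_imp2 (ae_imp2 aesob aeeq (fun r a b => conj a b))
                (ae_imp2 WE aeb (fun r a b => conj a b))) => t [sob eq_] [Wt ibt] tT.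
have tT' : 0 <= t <= T by move: tT; rewrite in_itv/= => /andP[? ?]; rewrite !ltW.
split.
- exact: sob.
- exact: ibt.
- by move=> x xl; rewrite /F patchE mem_set//; split=> //=; rewrite in_itv.
- exact: eq_.
- by apply: (ae_imp2 (vp t tT') (Wt tT)) => x h1 h2 xl; rewrite -h1// h2.
Qed.

(* The entropy is the primitive of a smooth truncation of [u - k] seen as a function
   of [beta u]; [lam < 0] gives the bound from below. *)
Lemma comparison (c d L lam k : R) (g : R -> R) u ux bt F w0 :
  0 < T -> 0 < l -> 1 < p <= 2 -> 0 < alpha -> c < k < d ->
  (forall u, g (beta u) = Num.max c (Num.min u d)) ->
  (forall y z, `|g y - g z| <= L * `|y - z|) ->
  {homo g : y z / y <= z} -> (forall y, c <= g y <= d) ->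
  (forall u, step (lam * (Num.max c (Num.min u d) - k)) = step (lam * (u - k))) ->
  itg (mu \x mu)%E setT F -> (forall r x, ~~ (0 < r < T) -> F (r, x) = 0) ->
  oitg w0 0 l ->
  {ae mu, forall x, x \in `]0, l[ -> w0 x = beta (u0 x)} ->
  {ae mu, forall t, t \in `]0, T[ -> good_time u ux bt F w0 t} ->
  {ae mu, forall x, x \in `]0, l[ -> lam * (u0 x - k) <= 0} ->
  (forall t x, 0 < t -> x = 0 \/ x = l -> 0 <= lam * (k - ub t x)) ->
  {ae mu, forall t, t \in `]0, T[ ->
    {ae mu, forall x, x \in `]0, l[ -> lam * (u t x - k) <= 0}}.
Proof.
move=> T0 l0 p12 al0 /andP[ck kd] gb gL gh gcd flat iF F0 iw0 w0E good u0k ubk.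
have tri (x1 x2 x3 x4 : R) : x1 - x2 <= x3 -> x3 <= 0 -> x2 <= x4 -> x1 <= x4.
  lra.
have mid (x1 x2 : R) : x1 = (x1 + x2) / 2 -> x1 = x2 by lra.
have cd : c < d by exact: lt_trans kd.
have gk : g (beta k) = k by rewrite gb min_l ?max_r ?ltW.
have cg := lipschitz_continuous gL.
pose q v := lam * step (lam * (v - k)).
have cq : continuous q.
  move=> y; apply: cvgM; first exact: cvg_cst.
  apply: (@continuous_comp _ _ _ (fun y => lam * (y - k)) step).
    exact: continuous_affine.
  exact: continuous_step.
have qh : {homo q : y z / y <= z}.
  move=> y z yz; rewrite /q; have [lam0|lam0] := leP 0 lam.
    by rewrite ler_wpM2l// step_homo// ler_wpM2l// lerD2r.
  by rewrite ler_wnM2l ?(ltW lam0)// step_homo// ler_wnM2l ?(ltW lam0)// lerD2r.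
have qb y : `|q y| <= `|lam|.
  by rewrite normrM ler_piMr// ger0_norm ?step_le1 ?step_ge0.
pose h w := q (g w).
have ch : continuous h.
  by move=> x; apply: (@continuous_comp _ _ _ g q); [exact: cg|exact: cq].
have hh : {homo h : y z / y <= z} by move=> y z /gh /qh.
have [Psi hPsi] : exists Psi : R -> R, forall x y, Psi y - Psi x <= h y * (y - x).
  by exists (primitive h); exact: primitive_subgradient.
have cst0 : continuous ((fun=> 0) : R -> R) by move=> x; exact: cvg_cst.
have zero_le (s t x : R) : 0 < x < l -> s <= t ->
    `|((fun=> 0 : R) t + (fun=> 0 : R) t * x) - ((fun=> 0 : R) s + (fun=> 0 : R) s * x)|
    <= oint (fun=> 0 : R) s t.
  by move=> _ st; rewrite !mul0r subrr normr0 oint_cst// mul0r.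
have z1 (x y : R) : (fun=> 0 : R) y - (fun=> 0 : R) x <= (fun=> 0 : R) y * (y - x).
  by rewrite mul0r subrr.
have z2 : 0 <= (0 : R) <= 0 by rewrite lexx.
(* With zero profile, zero [B] and zero speed the Fenchel gap reduces to [Psi] of the path. *)
have [iE _ iD ent] := @entropy_int R T l F w0 Psi h (fun=> 0) (fun=> 0) (fun=> 0) (fun=> 0)
  (fun=> 0) `|lam| 0 iF F0 iw0 hPsi ch (fun y => qb (g y)) z1 cst0 cst0 cst0 cst0
  (integrable0 _ _) (fun=> z2) zero_le.
have ip r := path_itg iF iw0 r.
have simp t x : Psi (path F w0 t x) + 0 - (0 + 0 * x) * path F w0 t x = Psi (path F w0 t x).
  by rewrite mul0r !addr0 mul0r subr0.
have PsiL y z : `|Psi y - Psi z| <= `|lam| * `|y - z|.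
  have H a b : Psi a - Psi b <= `|lam| * `|a - b|.
    apply: le_trans (hPsi _ _) _; apply: le_trans (ler_norm _) _.
    by rewrite normrM ler_wpM2r// qb.
  rewrite ler_norml; apply/andP; split; last exact: H.
  by have := H z y; rewrite distrC; lra.
have iPsi t : oitg (fun x => Psi (path F w0 t x)) 0 l by exact: (path_comp_itg iF iw0 t PsiL).
have hsign v : lam * (v - k) <= 0 -> q v = 0 by move=> hv; rewrite /q step0 ?mulr0.
(* [h] vanishes at [beta k], so 0 is a subgradient there and [beta k] minimises [Psi]. *)
have Psi_ge w : Psi (beta k) <= Psi w.
  have := hPsi w (beta k); rewrite /h gk hsign ?subrr ?mulr0// mul0r; lra.
have Psi_eq w : lam * (w - beta k) <= 0 -> Psi w <= Psi (beta k).
  move=> wk; have := hPsi (beta k) w; rewrite /h hsign ?mul0r; first lra.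
  have [lam0|lam0] := leP lam 0.
    have [->|lamn] := eqVneq lam 0; first by rewrite mul0r.
    have {}lam0 : lam < 0 by rewrite lt_neqAle lamn.
    move: wk; rewrite !nmulr_rle0// !subr_ge0 => wk.
    by rewrite -gk; exact: gh.
  move: wk; rewrite !pmulr_rle0// !subr_le0 => wk.
  by rewrite -gk; exact: gh.
(* [Psi] must be strictly above its minimum where the bound fails. If [g w] violated it, so would
   the midpoint [v] of [g w] and [k]; the positive subgradient at [beta v] then forces [w = beta v],
   so [g w] is its own midpoint with [k]. *)
have Psi_lt w : Psi w = Psi (beta k) -> lam * (g w - k) <= 0.
  move=> E; rewrite leNgt; apply/negP => pos.
  pose v := (g w + k) / 2.
  have /andP[cg_ gd] := gcd w.
  have vcd : c <= v <= d by clear - ck kd cg_ gd; rewrite /v; apply/andP; split; lra.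
  have gv : g (beta v) = v by case/andP: vcd => ? ?; rewrite gb min_l ?max_r.
  have lamv : 0 < lam * (v - k) by clear - pos; rewrite /v; lra.
  have wm : 0 <= lam * (w - beta v).
    rewrite leNgt; apply/negP => neg.
    have : 0 <= lam * (v - g w).
      have [lam0|lam0] := leP lam 0.
        have lamn : lam < 0 by rewrite lt_neqAle lam0 andbT; apply: contraTneq pos => ->; rewrite mul0r ltxx.
        move: neg; rewrite !nmulr_rlt0// subr_gt0 => /ltW /gh; rewrite gv => h1.
        by rewrite nmulr_rge0// subr_le0.
      move: neg; rewrite !pmulr_rlt0// subr_lt0 => /ltW /gh; rewrite gv => h1.
      by rewrite mulr_ge0 ?subr_ge0// ltW.
    by move=> hv; clear - hv pos; rewrite /v in hv; lra.
  have := hPsi w (beta v); rewrite /h gv /q E.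
  have s0 := step_gt0 lamv.
  have := Psi_ge (beta v).
  have : 0 <= step (lam * (v - k)) * (lam * (w - beta v)) by rewrite mulr_ge0// ltW.
  move=> h1 h2 h3.
  have z : step (lam * (v - k)) * (lam * (w - beta v)) = 0.
    by apply/eqP; rewrite eq_le h1 andbT; clear - h2 h3; lra.
  have : lam * (w - beta v) = 0.
    by move/eqP: z; rewrite mulf_eq0 (gt_eqF s0) => /eqP.
  have lamn : lam != 0 by apply: contraTneq pos => ->; rewrite mul0r ltxx.
  move=> /eqP; rewrite mulf_eq0 (negbTE lamn)/= subr_eq0 => /eqP wv.
  have gw : g w = v by rewrite {1}wv.
  have gwk : g w = k by exact: mid gw.
  by move: pos; rewrite gwk subrr mulr0 ltxx.
have zt0 : 0 <= (0 : R) <= T by rewrite lexx ltW.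
have Dle : {ae mu, forall r, `]0, T[%classic r ->
    oint (fun x => (h (path F w0 r x) - (0 + 0 * x)) * F (r, x)
      + `|0 - path F w0 r x| * 0) 0 l <= 0}.
  apply: (ae_imp good) => r gr rT; have [sob ibt FE eqn pE] := gr rT.
  have r0 : 0 < r by move: rT; rewrite /= in_itv/= => /andP[].
  have ct := comparison_test l0 p12 al0 sob ibt eqn (ubk r 0 r0 (or_introl erefl)) (ubk r l r0 (or_intror erefl)).
  apply: le_trans ct; rewrite le_eqVlt; apply/orP; left; apply/eqP.
  have m1 : measurable_fun (`]0, l[%classic : set mR) (fun x => bt r x * h (path F w0 r x)).
    apply: measurable_funM; first exact: oitg_meas ibt.
    by apply: (measurableT_comp (continuous_measurable_fun ch)); exact: oitg_meas (ip r).
  have m2 : measurable_fun (`]0, l[%classic : set mR) (fun x => bt r x * q (u r x)).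
    apply: measurable_funM; first exact: oitg_meas ibt.
    apply: (measurableT_comp (continuous_measurable_fun cq)).
    by have [up _ _ _] := sob; exact: in_Lp_meas up.
  transitivity (oint (fun x => bt r x * h (path F w0 r x)) 0 l).
    by apply: oint_eq => x xl; rewrite FE// mul0r addr0 subr0 mulr0 addr0 mulrC.
  apply: ae_eq_Rintegral; [exact: measurable_itv|exact: m1|exact: m2|].
  (* By [flat], the clamp inside [g] is invisible to the test function, so the equation can be
     tested with [u] itself. *)
  apply: (ae_imp pE) => x Hx xl; rewrite Hx// /h /q gb.
  by rewrite flat.
(* The initial value satisfies the bound, so the entropy starts at its minimum; being nonincreasing,
   it stays there. *)
have E0 : oint (fun x => Psi (path F w0 0 x)) 0 l <= l * Psi (beta k).
  have -> : l * Psi (beta k) = oint (fun=> Psi (beta k)) 0 l.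
    by rewrite oint_cst ?subr0 1?mulrC// ltW.
  apply: ae_le_Rintegral; [exact: measurable_itv|exact: iPsi|exact: oitg_cst|].
  apply: (ae_imp2 w0E u0k) => x h1 h2 xl; rewrite path0 h1//.
  have {}h2 := h2 xl.
  have := hPsi (beta k) (beta (u0 x)); rewrite /h /q gb flat step0 ?mulr0 ?mul0r//; lra.
have Et t : 0 <= t <= T -> {ae mu, forall x, x \in `]0, l[ -> lam * (g (path F w0 t x) - k) <= 0}.
  move=> /andP[t0 tT].
  have le1 : oint (fun x => Psi (path F w0 t x)) 0 l <= l * Psi (beta k).
    have := ent 0 t (lexx _) t0 tT.
    rewrite (@oint_eq _ _ (fun x => Psi (path F w0 t x))); last by move=> x _; exact: simp.
    rewrite (@oint_eq _ (fun x => Psi (path F w0 0 x) + _ - _) (fun x => Psi (path F w0 0 x))); last first.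
      by move=> x _; exact: simp.
    have D0 : oint (fun r => oint (fun x => (h (path F w0 r x) - (0 + 0 * x)) * F (r, x)
      + `|0 - path F w0 r x| * 0) 0 l) 0 t <= oint (fun=> 0) 0 t.
      apply: ae_le_Rintegral; [exact: measurable_itv|by apply: oitgS iD|exact: oitg_cst|].
      apply: (ae_imp Dle) => r Hr /=; rewrite in_itv/= => /andP[r0 rt]; apply: Hr => /=.
      by rewrite in_itv/= r0 (lt_le_trans rt).
    rewrite (oint_cst 0 t0) mul0r in D0 => en; exact: (tri _ _ _ _ en D0 E0).
  have z := oint_le_cst_ae (ltW l0) (iPsi t) (fun x => Psi_ge (path F w0 t x)) le1.
  apply: (ae_imp z) => x Hx xl; apply: Psi_lt; exact: Hx.
apply: (ae_imp good) => t gt_ tT; have [_ _ _ _ pE] := gt_ tT.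
have tT' : 0 <= t <= T by move: tT; rewrite in_itv/= => /andP[? ?]; rewrite !ltW.
apply: (ae_imp2 pE (Et t tT')) => x h1 h2 xl; have := h2 xl; rewrite h1// gb.
(* Since [c < k < d], clamping to [[c, d]] does not change the sign of [u - k]. *)
rewrite leNgt => /negP h3; rewrite leNgt; apply/negP => h4; apply: h3.
move: h4; rewrite maxEle minEle.
have [a|a] := leP (u t x) d; last first.
  rewrite (ltW cd); have [lam0|lam0] := leP lam 0.
    rewrite ltNge => /negP[]; apply: mulr_le0_ge0 => //.
    by rewrite subr_ge0 ltW// (lt_trans kd).
  by move=> _; rewrite mulr_gt0// subr_gt0.
have [b|b] := leP c (u t x); first by [].
have [lam0|lam0] := leP 0 lam.
  rewrite ltNge => /negP[]; apply: mulr_ge0_le0 => //.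
  by rewrite subr_le0 ltW// (lt_trans b).
by move=> _; rewrite nmulr_rgt0// subr_lt0.
Qed.

End weak_solutions.

(** * Lipschitz boundary data *)

Section Linfty_data.
Context {R : realType}.
Notation mu := (@lebesgue_measure R).
Notation mR := (measurableTypeR R).

Lemma sobolev_inf_prim (T : R) (f df : R -> R) : 0 < T ->
  sobolev +oo%E `]0, +oo[%classic f df ->
  exists M : R, [/\ 0 < M, {ae mu, forall r, r \in `]0, T[ -> `|df r| <= M},
    oitg df 0 T, {within `[0, T], continuous f} &
    forall s t, 0 <= s -> s <= t -> t <= T -> f t - f s = oint df s t].
Proof.
move=> T0 [_ dfoo [_ _ H] cf].
have sub : `]0, T[%classic `<=` (`]0, +oo[%classic : set R).
  by move=> x /=; rewrite !in_itv/= andbT => /andP[].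
(* The L^oo norm is an essential supremum only over a space of positive measure, and 0 by convention
   otherwise. *)
have muT : (0 < mu setT)%E.
  apply: (@lt_le_trans _ _ (mu `]0%R, 1%R[%classic)).
    by rewrite lebesgue_measure_itv/= lte_fin ltr01 oppr0 adde0 lte_fin.
  by apply: le_measure => //; rewrite inE.
have [M M0 HM] : exists2 M : R, 0 < M & {ae mu, forall r, r \in `]0, T[ -> `|df r| <= M}.
  have := sub_Lfun_finLfun dfoo; rewrite inE/= /finite_norm unlock/= muT.
  set g := (abse \o _); have := @ess_sup_ge _ _ R mu g.
  (* Finiteness of the norm excludes [+oo]; with [-oo] the almost-everywhere bound on an absolute
     value is contradictory, so any [M] will do. *)
  case: (ess_sup mu g) => [r| |]// Hg _.
    exists (Num.max 1 r); first by rewrite lt_max ltr01.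
    apply: (ae_imp Hg) => x + xT; rewrite /g/= patchE mem_set ?lee_fin; last exact: sub.
    by move=> h; rewrite le_max h orbT.
  by exists 1 => //; apply: (ae_imp Hg) => x; rewrite /g/= leeNy_eq.
have mdf : measurable_fun `]0, T[%classic df.
  have m1 : measurable_fun (`]0, +oo[%classic : set mR) df by exact: in_Lp_meas dfoo.
  by apply: measurable_funS m1 => //; exact: measurable_itv.
have idf : oitg df 0 T.
  apply: (@ae_itg _ _ _ mu `]0, T[%classic (measurable_itv _) df (fun=> M)) => //.
  exact: oitg_cst.
have cf' : {within `[0, T], continuous f}.
  apply: continuous_subspaceW cf.
  by apply: (subset_trans (closure_oo T0)); exact: closureS.
have [P pP fP] := weak_derivative_prim T0 sub cf' idf H.
exists M; split=> // s t s0 st tT.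
have h1 : 0 <= s <= T by rewrite s0 (le_trans st).
have h2 : 0 <= t <= T by rewrite tT (le_trans s0).
rewrite (fP _ h1) (fP _ h2) (pP.2 _ _ st); apply: oint_eq => x /andP[sx xt].
by rewrite patchE mem_set//= in_itv/= (le_lt_trans s0 sx) (lt_le_trans xt).
Qed.

End Linfty_data.

(** * Clamping and the propagation of bounds *)

Section clamping.
Context {R : realType}.
Notation mu := (@lebesgue_measure R).
Notation mR := (measurableTypeR R).

Definition clamp (lo hi y : R) : R := Num.max lo (Num.min y hi).

Lemma clamp_id (lo hi y : R) : lo <= y <= hi -> clamp lo hi y = y.
Proof. by move=> /andP[? ?]; rewrite /clamp min_l// max_r. Qed.

Lemma clamp_range (lo hi y : R) : lo <= hi -> lo <= clamp lo hi y <= hi.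
Proof. by move=> lohi; rewrite /clamp le_max lexx/= ge_max lohi ge_min lexx orbT. Qed.

Lemma clamp_homo (lo hi y z : R) : y <= z -> clamp lo hi y <= clamp lo hi z.
Proof.
move=> yz; rewrite /clamp ge_max le_max lexx/= le_max; apply/orP; right.
by rewrite le_min !ge_min yz lexx orbT.
Qed.

Lemma clamp_le (lo hi y z : R) : y <= z -> clamp lo hi z - clamp lo hi y <= z - y.
Proof.
rewrite /clamp; have [? | ?] := leP z hi; have [? | ?] := leP y hi => yz;
  by repeat (match goal with |- context [Num.max ?a ?b] => have [? | ?] := leP a b end); lra.
Qed.

Lemma clamp_lipschitz (lo hi y z : R) : `|clamp lo hi y - clamp lo hi z| <= 1 * `|y - z|.
Proof.
rewrite mul1r; wlog yz : y z / z <= y.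
  move=> H; have [zy|/ltW yz] := leP z y; first exact: H.
  by rewrite distrC [leRHS]distrC; exact: H.
by rewrite !ger0_norm ?subr_ge0 ?clamp_homo// clamp_le.
Qed.

Lemma continuous_clamp (lo hi : R) : continuous (clamp lo hi).
Proof. exact: (lipschitz_continuous (clamp_lipschitz lo hi)). Qed.

Lemma itv_dist (lo hi M a b : R) : lo <= a <= hi -> lo <= b <= hi -> hi - lo <= M ->
  `|a - b| <= M.
Proof.
move=> /andP[? ?] /andP[? ?] ?; rewrite ler_norml; apply/andP; split; lra.
Qed.

(** The function agrees almost everywhere with its clamp, which is continuous as well; hence it
    agrees everywhere. *)
Lemma continuous_ae_range (f : R -> R) (a b lo hi : R) : a < b -> lo <= hi ->
  {within `[a, b], continuous f} ->
  {ae mu, forall x, x \in `]a, b[ -> lo <= f x <= hi} ->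
  forall x, a <= x <= b -> lo <= f x <= hi.
Proof.
move=> ab lohi cf ae_ x xab.
have cg : {within `[a, b], continuous (fun x => clamp lo hi (f x))}.
  by move=> y; have := continuous_comp (cf y) (@continuous_clamp lo hi (f y)).
rewrite (@continuous_ae_eq _ f (fun x => clamp lo hi (f x)) a b ab cf cg _ x xab).
  exact: clamp_range.
by apply: (ae_imp ae_) => y h /h /clamp_id ->.
Qed.

(** Exchanges quantifiers: Fubini, applied to the path minus its clamp, puts the exceptional set on
    [x], after which continuity in time reaches every [t]. *)
Lemma path_ae_range (T l lo hi : R) (F : mR * mR -> R) (w0 : R -> R) :
  0 < T -> lo <= hi -> itg (mu \x mu)%E setT F ->
  (forall r x, ~~ (0 < r < T) -> F (r, x) = 0) -> oitg w0 0 l ->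
  {ae mu, forall t, t \in `]0, T[ ->
    {ae mu, forall x, x \in `]0, l[ -> lo <= path F w0 t x <= hi}} ->
  {ae mu, forall x, x \in `]0, l[ -> forall t, 0 <= t <= T -> lo <= path F w0 t x <= hi}.
Proof.
move=> T0 lohi iF F0 iw0 ae_.
pose f (z : mR * mR) := path F w0 z.1 z.2 - clamp lo hi (path F w0 z.1 z.2).
have mp := @measurable_path_rect R T l F w0 iF iw0.
have mf : measurable_fun (rect T l) f.
  apply: measurable_funB; first exact: mp.
  exact: (measurableT_comp (continuous_measurable_fun (@continuous_clamp lo hi)) mp).
have h := ae_swap_rect mf.
apply: (ae_imp2 (ae_itg_time iF) (h _)).
  apply: (ae_imp ae_) => t ht tT; apply: (ae_imp (ht tT)) => x hx xl.
  by rewrite /f/= clamp_id ?subrr//; exact: hx.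
move=> x ix hx xl.
have cp : continuous (path F w0 ^~ x) by exact: prim_continuous (path_prim w0 F0 ix).
apply: (continuous_ae_range T0 lohi); first exact: continuous_subspaceT.
apply: (ae_imp (hx xl)) => t ht tT; have /eqP := ht tT.
by rewrite /f/= subr_eq0 => /eqP ->; exact: clamp_range.
Qed.

End clamping.

(** * Range of the solution *)

Section solution_bounds.
Context {R : realType}.
Notation mu := (@lebesgue_measure R).
Notation mR := (measurableTypeR R).

Lemma sa_le (p l alpha ulo uhi : R) (beta u0 : R -> R) (ub dub : R -> R -> R) :
  standing_assumptions p l alpha beta u0 ub dub ulo uhi -> ulo <= uhi.
Proof.
move=> sa; have /andP[a b] := sa_ub_range sa ltr01 (or_introl erefl).
exact: le_trans b.
Qed.

(** The upper bound is the comparison with [lam = 1], [k = uhi], the lower one with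
    [lam = - (4 / ulo)], [k = ulo]. In both cases [lam * (v - k)] equals 2 at the clamping level,
    [uhi + 2] or [ulo / 2], and there the step is already saturated. *)
Lemma solution_range (p l alpha ulo uhi L T : R) (beta u0 g : R -> R) (ub dub : R -> R -> R)
    u ux bt F w0 : 1 < p <= 2 ->
  standing_assumptions p l alpha beta u0 ub dub ulo uhi -> 0 < T ->
  (forall u, g (beta u) = Num.max (ulo / 2) (Num.min u (uhi + 2))) ->
  (forall y z, `|g y - g z| <= L * `|y - z|) ->
  {homo g : y z / y <= z} -> (forall y, ulo / 2 <= g y <= uhi + 2) ->
  itg (mu \x mu)%E setT F -> (forall r x, ~~ (0 < r < T) -> F (r, x) = 0) ->
  oitg w0 0 l ->
  {ae mu, forall x, x \in `]0, l[ -> w0 x = beta (u0 x)} ->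
  {ae mu, forall t, t \in `]0, T[ -> good_time p l alpha beta ub u ux bt F w0 t} ->
  {ae mu, forall t, t \in `]0, T[ -> forall x, 0 <= x <= l -> ulo <= u t x <= uhi}.
Proof.
move=> hp sa T0 gb gL gh gcd iF F0 iw0 w0E good.
have l0 := sa_l sa; have al0 := sa_alpha sa; have ulo0 := sa_ulo sa.
have uu := sa_le sa.
have p1 : 1 <= p by case/andP: hp => /ltW.
have cmp lam k := @comparison R p l alpha T beta u0 ub (ulo / 2) (uhi + 2) L lam k g u ux bt F w0
  T0 l0 hp al0.
have hi := cmp 1 uhi _ gb gL gh gcd _ iF F0 iw0 w0E good.
have lo := cmp (- (4 / ulo)) ulo _ gb gL gh gcd _ iF F0 iw0 w0E good.
have q0 : 0 < 4 / ulo by rewrite divr_gt0.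
have up : ulo / 2 < uhi < uhi + 2 by clear - ulo0 uu; apply/andP; split; lra.
have low : ulo / 2 < ulo < uhi + 2 by clear - ulo0 uu; apply/andP; split; lra.
have Hhi : {ae mu, forall t, t \in `]0, T[ ->
    {ae mu, forall x, x \in `]0, l[ -> 1 * (u t x - uhi) <= 0}}.
  apply: hi.
  - exact: up.
  - move=> v; have [vd|vd] := leP v (uhi + 2).
      have [cv //|cv] := leP (ulo / 2) v.
      rewrite !step0//; clear - cv uu ulo0; lra.
    rewrite max_r; last by clear - uu ulo0; lra.
    rewrite !step1//; clear - vd; lra.
  - by apply: (ae_imp (sa_u0_range sa)) => x h /h /andP[_ ?]; rewrite mul1r subr_le0.
  - by move=> t x t0 /(sa_ub_range sa t0) /andP[_ ?]; rewrite mul1r subr_ge0.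
have Hlo : {ae mu, forall t, t \in `]0, T[ ->
    {ae mu, forall x, x \in `]0, l[ -> - (4 / ulo) * (u t x - ulo) <= 0}}.
  apply: lo.
  - exact: low.
  - move=> v; have [vd|vd] := leP v (uhi + 2).
      have [cv //|cv] := leP (ulo / 2) v.
      have E : - (4 / ulo) * (ulo / 2 - ulo) = 2 by field; rewrite gt_eqF.
      rewrite E !step1// -E ler_wnM2l ?lerD2r ?(ltW cv)//.
      by rewrite oppr_le0 ltW.
    have nn (y : R) : uhi + 2 <= y -> - (4 / ulo) * (y - ulo) <= 0.
      by move=> hy; rewrite mulNr oppr_le0 mulr_ge0 ?(ltW q0)// subr_ge0; clear - hy uu; lra.
    rewrite max_r; last by clear - uu ulo0; lra.
    by rewrite !step0//; apply: nn => //; exact: ltW.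
  - apply: (ae_imp (sa_u0_range sa)) => x h /h /andP[? _].
    by rewrite mulNr oppr_le0 mulr_ge0 ?(ltW q0)// subr_ge0.
  - move=> t x t0 /(sa_ub_range sa t0) /andP[? _].
    by rewrite mulNr -mulrN mulr_ge0 ?(ltW q0)// opprB subr_ge0.
apply: (ae_imp2 good (ae_imp2 Hhi Hlo (fun r a b => conj a b))) => t gt_ [h1 h2] tT.
have [[_ _ _ cu] _ _ _ _] := gt_ tT.
apply: (continuous_ae_range l0 uu).
  by apply: continuous_subspaceW cu; exact: closure_oo.
apply: (ae_imp2 (h1 tT) (h2 tT)) => x a b xl; have {}a := a xl; have {}b := b xl.
apply/andP; split; last by rewrite mul1r subr_le0 in a.
by move: b; rewrite mulNr oppr_le0 pmulr_rge0// subr_ge0.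
Qed.

End solution_bounds.

(** * Exponential decay *)

Section decay.
Context {R : realType}.
Notation mu := (@lebesgue_measure R).
Notation mR := (measurableTypeR R).

(** Subtracting [N] makes [Psi (beta v)] equal to [v * beta v - B v], so the gap becomes the Bregman
    distance of the primitive [B], to which the quadratic bounds apply. *)
Lemma fenchel_gap (beta g : R -> R) (c d kap K : R) : 0 <= K ->
  continuous beta -> {homo beta : x y / x <= y} ->
  (forall x y, c <= x -> x <= y -> y <= d ->
     kap * (y - x) <= beta y - beta x <= K * (y - x)) ->
  continuous g -> {homo g : y z / y <= z} -> (forall u, c <= u <= d -> g (beta u) = u) ->
  exists Psi : R -> R, (forall x y, Psi y - Psi x <= g y * (y - x)) /\
    forall a v, c <= a <= d -> c <= v <= d ->
      kap / 4 * (a - v) ^+ 2 <= Psi (beta v) + primitive beta a - a * beta v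
      <= K * (a - v) ^+ 2.
Proof.
move=> K0 cb hb Hb cg hg gb.
pose N := primitive g (beta c) + primitive beta c - c * beta c.
have hPsi := primitive_subgradient cg hg; have HB := primitive_subgradient cb hb.
exists (fun y => primitive g y - N); split=> [x y|a v acd vcd].
  by have := hPsi x y; lra.
have Hb' x y : c <= x -> x <= y -> y <= d -> 0 <= beta y - beta x <= K * (y - x).
  by move=> cx xy yd; rewrite subr_ge0 hb//; case/andP: (Hb _ _ cx xy yd).
have NE := legendre_constant K0 hPsi HB Hb' gb vcd; rewrite -/N in NE.
have -> : primitive g (beta v) - N + primitive beta a - a * beta v
    = primitive beta a - primitive beta v - beta v * (a - v).
  by rewrite -NE; lra.
exact: subgradient_bounds HB Hb acd vcd.
Qed.

(** The essential bound [M] on boundary derivatives holds almost everywhere only; truncation gives a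
    majorant bounded at every point and equal to [|f|] almost everywhere. *)
Lemma absolutely_bounded (T M : R) (f : R -> R) : oitg f 0 T ->
  exists h : R -> R, [/\ itg mu setT h, forall r, 0 <= h r <= `|M|,
    forall r, h r <= `|f r| &
    {ae mu, forall r, r \in `]0, T[ -> `|f r| <= M} ->
    {ae mu, forall r, r \in `]0, T[ -> h r = `|f r|}].
Proof.
move=> if_; pose h r := Num.min `|f r| `|M|.
have ih : oitg h 0 T.
  apply: (@oitg_dom _ _ (fun r => `|f r|)); last first.
  - move=> x _; rewrite ger0_norm ?ge_min ?lexx// le_min !normr_ge0//.
  - exact: oitg_abs.
  apply: measurable_minr; last exact: measurable_cst.
  by apply: measurableT_comp; [exact: normr_measurable|exact: oitg_meas if_].
exists (h \_ `]0, T[%classic); split.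
- exact: itg_patch.
- move=> r; rewrite patchE; case: ifPn => _; last by rewrite lexx normr_ge0.
  by rewrite /h le_min !normr_ge0 ge_min lexx orbT.
- by move=> r; rewrite patchE; case: ifPn => _; rewrite ?normr_ge0// /h ge_min lexx.
- move=> ae_; apply: (ae_imp ae_) => r Hr rT; rewrite patchE mem_set// /h min_l//.
  exact: le_trans (Hr rT) (ler_norm _).
Qed.

Lemma clamped_increment (T : R) (k : R -> R) (s t : R) : 0 < T -> itg mu setT k ->
  (forall r, 0 <= k r) -> s <= t -> oint k (clamp 0 T s) (clamp 0 T t) <= oint k s t.
Proof.
move=> T0 ik k0 st.
have ok a b : oitg k a b by apply: itgS ik => //; exact: measurable_itv.
have pos a b : 0 <= oint k a b by apply: oint_ge0 => x _; exact: k0.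
have [t0|t0] := leP t 0.
  by rewrite /clamp !max_l ?ge_min ?t0 ?(le_trans st t0)// oint_xx.
have [Ts|sT] := leP T s.
  by rewrite /clamp !min_r ?(le_trans Ts st)// oint_xx.
have sc : s <= clamp 0 T s by rewrite /clamp (min_l (ltW sT)) le_max lexx orbT.
have ct : clamp 0 T t <= t by rewrite /clamp ge_max (ltW t0) ge_min lexx.
have cc := @clamp_homo _ 0 T _ _ st.
rewrite (oint_cat sc (le_trans cc ct) (ok _ _)) (oint_cat cc ct (ok _ _)).
by rewrite addrCA lerDl addr_ge0.
Qed.

(** Time is clamped to [[0, T]], which freezes the profile outside and makes its coefficients
    continuous on the whole line. The speed [k] adds the truncated derivatives of the two boundary
    values. *)
Lemma stationary_curve (p l alpha ulo uhi T : R) (beta u0 : R -> R)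
    (ub dub uhat : R -> R -> R) : 1 < p <= 2 ->
  standing_assumptions p l alpha beta u0 ub dub ulo uhi -> 0 < T ->
  (forall t : R, 0 <= t <= T -> stationary_solution p l alpha (ub t) (uhat t)) ->
  exists (A m k : R -> R) (Kk : R),
  [/\ continuous A, continuous m, itg mu setT k &
   [/\ forall r, 0 <= k r <= Kk, forall r, k r ^+ 2 <= 2 * sqnorm_bd l (dub r),
      oitg (fun r => sqnorm_bd l (dub r)) 0 T,
      forall s t x, 0 < x < l -> s <= t ->
        `|(A t + m t * x) - (A s + m s * x)| <= oint k s t &
      forall t, 0 <= t <= T ->
      [/\ forall x, 0 <= x <= l -> uhat t x = A t + m t * x,
          forall x, 0 <= x <= l -> ulo <= A t + m t * x <= uhi,
          - mu_p p (m t) + alpha * A t = alpha * ub t 0 &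
          mu_p p (m t) + alpha * (A t + m t * l) = alpha * ub t l]]].
Proof.
move=> hp sa T0 st.
have l0 := sa_l sa; have al0 := sa_alpha sa; have uu := sa_le sa.
have [M0 [M00 aeM0 id0 cu0 inc0]] := sobolev_inf_prim T0 (sa_ub sa (or_introl erefl)).
have [Ml [Ml0 aeMl idl cul incl]] := sobolev_inf_prim T0 (sa_ub sa (or_intror erefl)).
have rng x : x = 0 \/ x = l -> {within `[0, T], continuous (fun t => ub t x)} ->
    forall t, 0 <= t <= T -> ulo <= ub t x <= uhi.
  move=> x0l cx; apply: (continuous_ae_range T0 uu cx).
  apply/aeW => t; rewrite in_itv/= => /andP[t0 _]; exact: (sa_ub_range sa t0 x0l).
have rng0 := rng 0 (or_introl erefl) cu0; have rngl := rng l (or_intror erefl) cul.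
have [h0 [ih0 h0b h0d aeh0]] := absolutely_bounded M0 id0.
have [hl [ihl hlb hld aehl]] := absolutely_bounded Ml idl.
have {}aeh0 := aeh0 aeM0; have {}aehl := aehl aeMl.
have cT t : 0 <= clamp 0 T t <= T by apply: clamp_range; exact: ltW.
pose A t := uhat (clamp 0 T t) 0; pose L t := uhat (clamp 0 T t) l.
pose m t := (L t - A t) / l; pose k r := h0 r + hl r.
have ik : itg mu setT k by apply: itgD.
have k0 r : 0 <= k r by apply: addr_ge0; [case/andP: (h0b r)|case/andP: (hlb r)].
have aff t : [/\ forall x, 0 <= x <= l -> uhat (clamp 0 T t) x = A t + m t * x,
    L t = A t + m t * l,
    - mu_p p (m t) + alpha * A t = alpha * ub (clamp 0 T t) 0 &
    mu_p p (m t) + alpha * L t = alpha * ub (clamp 0 T t) l].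
  have [mm [E e1 e2]] := stationary_affine l0 hp al0 (st _ (cT t)).
  have Ll : L t = A t + mm * l by rewrite /L /A E// lexx ltW.
  have -> : m t = mm by rewrite /m Ll [X in X / l]addrAC subrr add0r mulfK// gt_eqF.
  by split.
have inc s t : s <= t -> `|A t - A s| <= oint k s t /\ `|L t - L s| <= oint k s t.
  move=> hst; have cc := @clamp_homo _ 0 T _ _ hst.
  have [_ Lt e1 e2] := aff t; have [_ Ls e3 e4] := aff s.
  have [b1 b2] := stationary_lipschitz l0 hp al0 Lt e1 e2 Ls e3 e4.
  have /andP[s0 _] := cT s; have /andP[_ tT] := cT t.
  suff H : `|ub (clamp 0 T t) 0 - ub (clamp 0 T s) 0|
      + `|ub (clamp 0 T t) l - ub (clamp 0 T s) l| <= oint k s t.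
    by split; [exact: le_trans b1 H|exact: le_trans b2 H].
  apply: le_trans (clamped_increment T0 ik k0 hst).
  have S f : oitg f 0 T -> oitg f (clamp 0 T s) (clamp 0 T t) by exact: oitgS.
  rewrite (inc0 _ _ s0 cc tT) (incl _ _ s0 cc tT).
  apply: le_trans (lerD (oint_abs (S _ id0)) (oint_abs (S _ idl))) _.
  rewrite -ointD; [|exact: oitg_abs (S _ id0)|exact: oitg_abs (S _ idl)].
  apply: ae_le_Rintegral.
  - exact: measurable_itv.
  - by apply: oitgD; [exact: oitg_abs (S _ id0)|exact: oitg_abs (S _ idl)].
  - by apply: itgS ik => //; exact: measurable_itv.
  apply: (ae_imp2 aeh0 aehl) => r e5 e6; rewrite /= in_itv/= => /andP[r1 r2].
  have rT : r \in `]0, T[ by rewrite in_itv/= (le_lt_trans s0 r1) (lt_le_trans r2 tT).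
  by rewrite /k e5// e6.
have cA : continuous A.
  by apply: (dominated_continuous ik) => s t hst; case: (inc s t hst).
have cL : continuous L.
  by apply: (dominated_continuous ik) => s t hst; case: (inc s t hst).
(* An affine profile is the convex combination of its end values with weights [1 - x / l] and
   [x / l], so bounds at the ends pass to every [x]. *)
have cvx (y a b c : R) : 0 <= y -> 0 <= 1 - y -> `|a| <= c -> `|b| <= c ->
    `|(1 - y) * a + y * b| <= c.
  move=> y0 y1 ac bc; apply: le_trans (ler_normD _ _) _.
  rewrite !normrM (ger0_norm y0) (ger0_norm y1).
  by have q1 := ler_wpM2l y1 ac; have q2 := ler_wpM2l y0 bc; clear - q1 q2; lra.
have sqE r : sqnorm_bd l (dub r) = `|dub r 0| ^+ 2 + `|dub r l| ^+ 2.
  by rewrite /sqnorm_bd /inner_bd !real_normK ?num_real// !expr2.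
exists A, m, k, (`|M0| + `|Ml|); split => //.
  move=> t; apply: cvgM; last exact: cvg_cst.
  by apply: cvgB; [exact: cL|exact: cA].
split.
- by move=> r; rewrite k0 lerD//; [case/andP: (h0b r)|case/andP: (hlb r)].
- move=> r; rewrite sqE; have /andP[a1 _] := h0b r; have /andP[a2 _] := hlb r.
  have a3 := h0d r; have a4 := hld r.
  apply: (@le_trans _ _ ((`|dub r 0| + `|dub r l|) ^+ 2)).
    by rewrite ler_pXn2r ?nnegrE ?addr_ge0// lerD.
  rewrite !expr2; have := sqr_ge0 (`|dub r 0| - `|dub r l|); rewrite expr2 => q1; clear - q1; lra.
- have mD x : oitg (dub ^~ x) 0 T -> measurable_fun `]0, T[%classic (fun r => dub r x * dub r x).
    by move=> ix; apply: measurable_funM; exact: oitg_meas ix.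
  apply: (@ae_itg _ _ _ mu `]0, T[%classic (measurable_itv _) _ (fun=> M0 ^+ 2 + Ml ^+ 2)).
  + by apply: measurable_funD; apply: mD.
  + exact: oitg_cst.
  apply: (ae_imp2 aeM0 aeMl) => r e5 e6 rT.
  rewrite sqE ger0_norm; last by rewrite addr_ge0// exprn_ge0.
  by apply: lerD; rewrite ler_pXn2r ?nnegrE ?(ltW M00) ?(ltW Ml0)//; [exact: e5|exact: e6].
- move=> s t x /andP[x0 xl] hst; have [i1 i2] := inc s t hst.
  have -> : A t + m t * x - (A s + m s * x)
      = (1 - x / l) * (A t - A s) + x / l * (L t - L s).
    by rewrite /m; field; rewrite gt_eqF.
  have y0 : 0 <= x / l by rewrite divr_ge0// ltW.
  have y1 : 0 <= 1 - x / l by rewrite subr_ge0 ler_pdivrMr// mul1r ltW.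
  exact: cvx.
move=> t tT; have [a1 a2 a3 a4] := aff t; have ctt : clamp 0 T t = t by exact: clamp_id.
rewrite ctt in a1 a3 a4; split=> //.
- move=> x /andP[x0 xl]; have := stationary_range l0 hp al0 a2 a3 a4 (rng0 t tT) (rngl t tT).
  move=> [/andP[r1 r2] /andP[r3 r4]].
  have -> : A t + m t * x = (1 - x / l) * A t + x / l * L t.
    by rewrite /m; field; rewrite gt_eqF.
  have y0 : 0 <= x / l by rewrite divr_ge0// ltW.
  have y1 : 0 <= 1 - x / l by rewrite subr_ge0 ler_pdivrMr// mul1r.
  have := ler_wpM2l y1 r1; have := ler_wpM2l y0 r3.
  have := ler_wpM2l y1 r2; have := ler_wpM2l y0 r4.
  by move=> q1 q2 q3 q4; clear - q1 q2 q3 q4; apply/andP; split; lra.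
- by rewrite -a2.
Qed.

End decay.

Section decay_estimate.
Context {R : realType}.
Notation mu := (@lebesgue_measure R).
Notation mR := (measurableTypeR R).

Lemma gronwall_decay (E f : R -> R) (gam a b : R) : 0 <= gam -> a <= b ->
  oitg E a b -> oitg f a b -> (forall t, a <= t <= b -> 0 <= E t) ->
  (forall t, 0 <= f t) ->
  (forall s t, a <= s -> s <= t -> t <= b ->
     E t - E s <= oint (fun r => f r - gam * E r) s t) ->
  E b <= expR (- gam * (b - a)) * E a + oint (fun r => expR (- gam * (b - r)) * f r) a b.
Proof.
move=> g0 ab iE if_ E0 f0 H; have G := gronwall g0 ab iE if_ E0 f0 H.
have ce : continuous (fun r : R => expR (gam * r)).
  move=> r; apply: (@continuous_comp _ _ _ ( *%R gam) expR).
    by apply: cvgM; [exact: cvg_cst|exact: cvg_id].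
  exact: continuous_expR.
have split_exp r : expR (- gam * (b - r)) = expR (- (gam * b)) * expR (gam * r).
  by rewrite -expRD; congr expR; lra.
rewrite (@oint_eq _ _ (fun r => expR (- (gam * b)) * (expR (gam * r) * f r))); last first.
  by move=> r _; rewrite split_exp mulrA.
rewrite (ointZ _ (oitgM ce if_)) split_exp -mulrA -mulrDr.
rewrite -ler_pdivrMl ?expR_gt0// expRN invrK addrC -lerBlDr.
exact: G.
Qed.

(* Young's inequality [K k |z| <= z^2 / (2 C0) + C0 K^2 k^2 / 2] lets the dissipation
   absorb the error due to the motion of the stationary profile. *)
Lemma entropy_rate (p l alpha c A0 M m w0 K k C0 : R) (u ux b bd q f g beta : R -> R) :
  0 < l -> 1 < p <= 2 -> 0 < alpha -> 0 < c ->
  (forall a y, `|a| <= A0 ->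
    c * Num.min ((y - a) ^+ 2) `|y - a| <= (mu_p p y - mu_p p a) * (y - a)) ->
  sobolev p%:E `]0, l[%classic u ux -> oitg b 0 l ->
  (forall v dv, sobolev 2%:E `]0, l[%classic v dv ->
     inner l b v + inner l (mu_p p \o ux) dv + alpha * inner_bd l u v
     = alpha * inner_bd l bd v) ->
  `|m| <= A0 -> - mu_p p m + alpha * w0 = alpha * bd 0 ->
  mu_p p m + alpha * (w0 + m * l) = alpha * bd l -> 0 <= M ->
  (forall x, 0 <= x <= l -> `|u x - (w0 + m * x)| <= M) ->
  0 <= k -> continuous beta -> continuous g -> oitg q 0 l ->
  (forall x, 0 < x < l -> `|beta (w0 + m * x) - beta (u x)| <= K * `|u x - (w0 + m * x)|) ->
  (forall x, 0 < x < l -> f x = b x) ->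
  {ae mu, forall x, x \in `]0, l[ -> q x = beta (u x)} ->
  {ae mu, forall x, x \in `]0, l[ -> g (q x) = u x} ->
  C0 = l * (2 / alpha + (8 * l + 8 * M) / c) ->
  oint (fun x => (g (q x) - (w0 + m * x)) * f x + `|beta (w0 + m * x) - q x| * k) 0 l
  <= l * (C0 * K ^+ 2) / 2 * k ^+ 2
     - (2 * C0)^-1 * sqnorm l (fun x => u x - (w0 + m * x)).
Proof.
move=> l0 hp al0 c0 coer sob ib eqn mA bc0 bcl M0 uM k0 cbeta cg iq bK fb qE gE C0E.
have diss := dissipation l0 hp al0 c0 coer sob ib eqn mA bc0 bcl uM.
rewrite -C0E in diss.
have C00 : 0 < C0.
  by rewrite C0E mulr_gt0// ltr_wpDr ?divr_gt0// divr_ge0 ?(ltW c0)// addr_ge0 ?mulr_ge0// ltW.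
pose w x := w0 + m * x; pose z x := u x - w x.
have mu_ : measurable_fun (`]0, l[%classic : set mR) u by case: sob => up _ _ _; exact: in_Lp_meas up.
have cw : continuous w.
  by move=> x; apply: cvgD; [exact: cvg_cst|apply: cvgM; [exact: cvg_cst|exact: cvg_id]].
have ml : measurable (`]0, l[%classic : set mR) by exact: measurable_itv.
have mw : measurable_fun (`]0, l[%classic : set mR) w by exact: cont_meas.
have mz : measurable_fun (`]0, l[%classic : set mR) z by exact: measurable_funB.
have zM x : 0 < x < l -> `|z x| <= M by move=> /andP[x0 xl]; apply: uM; rewrite !ltW.
have mq := oitg_meas iq; have mb := oitg_meas ib.
have mbw : measurable_fun (`]0, l[%classic : set mR) (beta \o w).
  by exact: (measurableT_comp (continuous_measurable_fun cbeta) mw).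
have mbu : measurable_fun (`]0, l[%classic : set mR) (beta \o u).
  by exact: (measurableT_comp (continuous_measurable_fun cbeta) mu_).
have mgq : measurable_fun (`]0, l[%classic : set mR) (g \o q).
  by exact: (measurableT_comp (continuous_measurable_fun cg) mq).
have mabs (h h' : R -> R) : measurable_fun (`]0, l[%classic : set mR) h ->
    measurable_fun (`]0, l[%classic : set mR) h' ->
    measurable_fun (`]0, l[%classic : set mR) (fun x => `|h x - h' x| * k).
  move=> mh mh'; apply: measurable_funM; last exact: measurable_cst.
  by apply: measurableT_comp; [exact: normr_measurable|exact: measurable_funB].
have -> : oint (fun x => (g (q x) - (w0 + m * x)) * f x + `|beta (w0 + m * x) - q x| * k) 0 l
    = oint (fun x => (g (q x) - w x) * b x + `|beta (w x) - q x| * k) 0 l.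
  by apply: oint_eq => x xl; rewrite (fb x xl).
have -> : oint (fun x => (g (q x) - w x) * b x + `|beta (w x) - q x| * k) 0 l
    = oint (fun x => b x * z x + `|beta (w x) - beta (u x)| * k) 0 l.
  apply: ae_eq_Rintegral.
  - exact: ml.
  - apply: measurable_funD; last exact: (mabs _ _ mbw mq).
    by apply: measurable_funM; [exact: (measurable_funB mgq mw)|exact: mb].
  - apply: measurable_funD; last exact: (mabs _ _ mbw mbu).
    by apply: measurable_funM; [exact: mb|exact: mz].
  apply: (ae_imp2 qE gE) => x e1 e2 xl.
  by rewrite (e2 xl) (e1 xl) /z mulrC.
have ibz : oitg (fun x => b x * z x) 0 l.
  apply: (@oitg_dom _ _ (fun x => M * `|b x|)).
  - by apply: measurable_funM; [exact: mb|exact: mz].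
  - exact: oitgZ (oitg_abs ib).
  - by move=> x xl; rewrite normrM mulrC ler_wpM2r// zM.
have iz2 : oitg (fun x => z x * z x) 0 l.
  apply: (@oitg_dom _ _ (fun=> M * M)).
  - by apply: measurable_funM; exact: mz.
  - exact: oitg_cst.
  - by move=> x xl; rewrite normrM ler_pM// zM.
have iab : oitg (fun x => `|beta (w x) - beta (u x)| * k) 0 l.
  apply: (@oitg_dom _ _ (fun x => k * (`|K| * M))).
  - exact: (mabs _ _ mbw mbu).
  - exact: oitg_cst.
  - move=> x xl; rewrite normrM normr_id (ger0_norm k0) mulrC ler_wpM2l//.
    apply: le_trans (bK x xl) _.
    apply: le_trans (ler_wpM2r (normr_ge0 _) (ler_norm K)) _.
    by apply: ler_wpM2l; [exact: normr_ge0|exact: zM].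
rewrite (ointD ibz iab).
(* The difference of the two sides is the square [(|z| - C0 * K * k)^2 / (2 * C0)], integrated over
   []0, l[]. *)
have young : oint (fun x => `|beta (w x) - beta (u x)| * k) 0 l
    <= (2 * C0)^-1 * oint (fun x => z x * z x) 0 l + l * (C0 * K ^+ 2) / 2 * k ^+ 2.
  have -> : l * (C0 * K ^+ 2) / 2 * k ^+ 2 = oint (fun=> C0 * K ^+ 2 / 2 * k ^+ 2) 0 l.
    by rewrite (oint_cst _ (ltW l0)); ring.
  rewrite -(ointZ _ iz2) -ointD; [|exact: oitgZ|exact: oitg_cst].
  apply: oint_le; [exact: iab|by apply: oitgD; [exact: oitgZ|exact: oitg_cst]|].
  move=> x xl; apply: (@le_trans _ _ (K * `|z x| * k)).
    by rewrite ler_wpM2r//; exact: bK.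
  have E : z x * z x = `|z x| * `|z x| by rewrite -!expr2 real_normK ?num_real.
  rewrite E -subr_ge0.
  have -> : (2 * C0)^-1 * (`|z x| * `|z x|) + C0 * K ^+ 2 / 2 * k ^+ 2 - K * `|z x| * k
      = (`|z x| - C0 * K * k) ^+ 2 / (2 * C0) by field; rewrite gt_eqF.
  by rewrite divr_ge0 ?sqr_ge0// mulr_ge0// ltW.
(* Dissipation is worth [S / C0]; Young's inequality spends one half of it. *)
have fin (I S Y : R) : S <= C0 * - I -> I + ((2 * C0)^-1 * S + Y) <= Y - (2 * C0)^-1 * S.
  move=> SI; have : C0^-1 * S <= - I by rewrite ler_pdivrMl.
  have -> : (2 * C0)^-1 = C0^-1 / 2 by field; rewrite gt_eqF.
  lra.
apply: le_trans (fin _ _ _ diss); rewrite lerD2l; exact: young.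
Qed.

(** The dissipation leaves [S / (2 * C0)], and the entropy is at most [K * S], which fixes the rate
    [1 / (2 * C0 * K)]. On the left the entropy is at least [kap / 4 * S]. *)
Lemma entropy_decay (p l alpha ulo uhi kap K cc C0 T : R) (beta u0 g : R -> R)
    (ub dub u U uhat : R -> R -> R) (s t : R) : 1 < p <= 2 ->
  standing_assumptions p l alpha beta u0 ub dub ulo uhi ->
  0 < kap -> 0 < K ->
  (forall x y, ulo / 2 <= x -> x <= y -> y <= uhi + 2 ->
    kap * (y - x) <= beta y - beta x <= K * (y - x)) ->
  0 < cc -> (forall a y, `|a| <= uhi / l ->
    cc * Num.min ((y - a) ^+ 2) `|y - a| <= (mu_p p y - mu_p p a) * (y - a)) ->
  (forall u, g (beta u) = Num.max (ulo / 2) (Num.min u (uhi + 2))) ->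
  (forall y z, `|g y - g z| <= kap^-1 * `|y - z|) ->
  {homo g : y z / y <= z} -> (forall y, ulo / 2 <= g y <= uhi + 2) ->
  (forall y, beta (ulo / 2) <= y <= beta (uhi + 2) -> beta (g y) = y) ->
  C0 = l * (2 / alpha + (8 * l + 8 * uhi) / cc) ->
  0 < T -> regular_weak_solution p l alpha beta u0 ub T u ->
  continuous_version 2%:E T l u U ->
  (forall t, 0 <= t <= T -> stationary_solution p l alpha (ub t) (uhat t)) ->
  0 <= s -> s <= t -> t <= T ->
  kap / 4 * sqnorm l (fun x => U t x - uhat t x)
  <= expR (- (2 * C0 * K)^-1 * (t - s)) * (K * sqnorm l (fun x => U s x - uhat s x))
     + oint (fun r => expR (- (2 * C0 * K)^-1 * (t - r))
                      * (l * (C0 * K ^+ 2) * sqnorm_bd l (dub r))) s t.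
Proof.
move=> hp sa kap0 K0 Hb cc0 coer gb gL gh gcd binv C0E T0 rws cU st s0 hst tT.
have l0 := sa_l sa; have al0 := sa_alpha sa; have uu := sa_le sa; have ulo0 := sa_ulo sa.
have uhi0 := sa_uhi sa.
have cb := sa_beta_cont sa; have hb := beta_homo cb (sa_beta_C1 sa).
have C00 : 0 < C0.
  by rewrite C0E mulr_gt0// ltr_wpDr ?divr_gt0// divr_ge0 ?(ltW cc0)// addr_ge0 ?mulr_ge0// ltW.
have cg := lipschitz_continuous gL.
have loh : ulo / 2 <= ulo by clear - ulo0; lra.
have hih : uhi <= uhi + 2 by clear; rewrite lerDl.
have rngcd v : ulo <= v <= uhi -> ulo / 2 <= v <= uhi + 2.
  by move=> /andP[v1 v2]; clear - ulo0 v1 v2; apply/andP; split; lra.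
have gid v : ulo / 2 <= v <= uhi + 2 -> g (beta v) = v.
  by move=> /andP[? ?]; rewrite gb min_l ?max_r.
have [ux [bt [F [w0 [iF F0 iw0 w0E good]]]]] := weak_solution_path T0 l0 rws.
have urange := solution_range hp sa T0 gb gL gh gcd iF F0 iw0 w0E good.
have [A [m [k [Kk [cA cm ik [kb k2 iq inc stat]]]]]] := stationary_curve hp sa T0 st.
have [Psi [hPsi gap]] := fenchel_gap (ltW K0) cb hb Hb cg gh gid.
have HB := primitive_subgradient cb hb; have cB := subgradient_continuous cb HB.
have gabs y : `|g y| <= uhi + 2.
  by have /andP[g1 g2] := gcd y; rewrite ger0_norm//; clear - ulo0 g1; lra.
have [iE iEt iD ent] := entropy_int iF F0 iw0 hPsi cg gabs HB cb cB cA cm ik kb inc.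
have inT r : r \in `]0, T[ -> 0 <= r <= T.
  by rewrite in_itv/= => /andP[? ?]; rewrite !ltW.
have inl x : x \in `]0, l[ -> 0 <= x <= l.
  by rewrite in_itv/= => /andP[? ?]; rewrite !ltW.
(* The range must hold at every time for almost every [x], because the entropy is compared with [S]
   at the given times [s] and [t]. *)
have prange : {ae mu, forall x, x \in `]0, l[ ->
    forall r, 0 <= r <= T -> beta ulo <= path F w0 r x <= beta uhi}.
  apply: (path_ae_range T0 (hb _ _ uu) iF F0 iw0).
  apply: (ae_imp2 good urange) => r gr ur rT; have [_ _ _ _ pE] := gr rT.
  apply: (ae_imp pE) => x px xl; rewrite (px xl).
  by have /andP[u1 u2] := ur rT x (inl x xl); rewrite !hb.
have ueq : {ae mu, forall r, r \in `]0, T[ ->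
    {ae mu, forall x, x \in `]0, l[ -> u r x = g (path F w0 r x)}}.
  apply: (ae_imp2 good urange) => r gr ur rT; have [_ _ _ _ pE] := gr rT.
  apply: (ae_imp pE) => x px xl; rewrite (px xl) gid//.
  by apply: rngcd; exact: (ur rT x (inl x xl)).
have kapV : 0 <= kap^-1 by rewrite invr_ge0 ltW.
have UE := version_comp_path T0 l0 iF F0 iw0 kapV gL cU ueq.
have ml : measurable (`]0, l[%classic : set mR) by exact: measurable_itv.
have ma r : measurable_fun (`]0, l[%classic : set mR) (fun x => A r + m r * x).
  apply: cont_meas => // x; apply: cvgD; first exact: cvg_cst.
  by apply: cvgM; [exact: cvg_cst|exact: cvg_id].
have mg r : measurable_fun (`]0, l[%classic : set mR) (fun x => g (path F w0 r x)).
  exact: (measurableT_comp (continuous_measurable_fun cg) (oitg_meas (path_itg iF iw0 r))).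
have msq (f1 f2 : R -> R) : measurable_fun (`]0, l[%classic : set mR) f1 ->
    measurable_fun (`]0, l[%classic : set mR) f2 ->
    measurable_fun (`]0, l[%classic : set mR) (fun x => (f1 x - f2 x) * (f1 x - f2 x)).
  by move=> m1 m2; apply: measurable_funM; exact: measurable_funB.
pose S r := oint (fun x => (g (path F w0 r x) - (A r + m r * x)) *
                           (g (path F w0 r x) - (A r + m r * x))) 0 l.
have iS r : 0 <= r <= T -> oitg (fun x => (g (path F w0 r x) - (A r + m r * x)) *
                           (g (path F w0 r x) - (A r + m r * x))) 0 l.
  move=> rT; apply: (@oitg_dom _ _ (fun=> (uhi + 2) * (uhi + 2))).
  - exact: msq (mg r) (ma r).
  - exact: oitg_cst.
  move=> x /andP[x0 xl]; have [_ ar _ _] := stat r rT.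
  have xl' : 0 <= x <= l by rewrite !ltW.
  have h : `|g (path F w0 r x) - (A r + m r * x)| <= uhi + 2.
    apply: (itv_dist (gcd _) (rngcd _ (ar x xl'))).
    by rewrite lerBlDr lerDl divr_ge0// ltW.
  by rewrite normrM; apply: ler_pM.
have SE r : 0 <= r <= T -> sqnorm l (fun x => U r x - uhat r x) = S r.
  move=> rT; have [aE _ _ _] := stat r rT; have [UL _ _] := cU.
  rewrite /sqnorm /inner.
  transitivity (oint (fun x => (U r x - (A r + m r * x)) * (U r x - (A r + m r * x))) 0 l).
    by apply: oint_eq => x /andP[x0 xl]; rewrite aE// !ltW.
  apply: ae_eq_Rintegral; [exact: ml|apply: msq; [|exact: ma]|exact: msq (mg r) (ma r)|].
    by have rT' : r \in `[0, T] by [rewrite in_itv/=]; exact: in_Lp_meas (UL r rT').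
  by apply: (ae_imp (UE r rT)) => x Hx xl; rewrite (Hx xl).
pose E r := oint (fun x => Psi (path F w0 r x) + primitive beta (A r + m r * x)
                           - (A r + m r * x) * path F w0 r x) 0 l.
(* [binv] writes the path as [beta] of [g] of the path, so the gap bounds apply with [v] equal to
   that value of [g]. *)
have Eb r : 0 <= r <= T -> kap / 4 * S r <= E r <= K * S r.
  move=> rT; have [_ ar _ _] := stat r rT.
  have key : {ae mu, forall x, x \in `]0, l[ ->
      kap / 4 * ((g (path F w0 r x) - (A r + m r * x)) * (g (path F w0 r x) - (A r + m r * x)))
      <= Psi (path F w0 r x) + primitive beta (A r + m r * x) - (A r + m r * x) * path F w0 r x
      <= K * ((g (path F w0 r x) - (A r + m r * x)) * (g (path F w0 r x) - (A r + m r * x)))}.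
    apply: (ae_imp prange) => x px xl; have /andP[p1 p2] := px xl r rT.
    have acd := rngcd _ (ar x (inl x xl)); have vcd := gcd (path F w0 r x).
    have := gap _ _ acd vcd; rewrite -[X in kap / 4 * X](sqrrN) opprB expr2.
    rewrite -[X in K * X](sqrrN) opprB expr2 binv//.
    by rewrite (le_trans (hb _ _ loh) p1) (le_trans p2 (hb _ _ hih)).
  rewrite -!(ointZ _ (iS r rT)); apply/andP; split.
    apply: ae_le_Rintegral; [exact: ml|exact: oitgZ (iS r rT)|exact: iE|].
    by apply: (ae_imp key) => x kx xl; case/andP: (kx xl).
  apply: ae_le_Rintegral; [exact: ml|exact: iE|exact: oitgZ (iS r rT)|].
  by apply: (ae_imp key) => x kx xl; case/andP: (kx xl).
have S0 r : 0 <= S r by apply: oint_ge0 => x _; rewrite -expr2 sqr_ge0.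
pose gam := (2 * C0 * K)^-1.
have gam0 : 0 <= gam by rewrite invr_ge0 !mulr_ge0// ltW.
pose f r := l * (C0 * K ^+ 2) / 2 * k r ^+ 2.
have rate : {ae mu, forall r, r \in `]0, T[ ->
    oint (fun x => (g (path F w0 r x) - (A r + m r * x)) * F (r, x)
                   + `|beta (A r + m r * x) - path F w0 r x| * k r) 0 l <= f r - gam * E r}.
  apply: (ae_imp2 (ae_imp2 good urange (fun r a b => conj a b)) ueq) => r [gr ur] uer rT.
  have [sob ibt FE eqn pE] := gr rT; have ur' := ur rT.
  have [_ ar b0 bl] := stat r (inT r rT).
  have k0 : 0 <= k r by case/andP: (kb r).
  (* [m r * l] is the difference of two profile values in [[ulo, uhi]], hence at most [uhi] in
     modulus. *)
  have mA : `|m r| <= uhi / l.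
    have := ar 0; have := ar l; rewrite !lexx (ltW l0) mulr0 addr0.
    move=> /(_ isT) al /(_ isT) a0; rewrite ler_pdivlMr// -(ger0_norm (ltW l0)) -normrM.
    rewrite -[m r * l](addKr (A r)) addrC; apply: (itv_dist al a0).
    by rewrite lerBlDr lerDl ltW.
  have uM x : 0 <= x <= l -> `|u r x - (A r + m r * x)| <= uhi.
    move=> xl; apply: (itv_dist (ur' x xl) (ar x xl)).
    by rewrite lerBlDr lerDl ltW.
  have bK x : 0 < x < l -> `|beta (A r + m r * x) - beta (u r x)| <= K * `|u r x - (A r + m r * x)|.
    move=> /andP[x0 xl]; have xl' : 0 <= x <= l by rewrite !ltW.
    have /andP[a1 a2] := rngcd _ (ar x xl'); have /andP[a3 a4] := rngcd _ (ur' x xl').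
    have [h|/ltW h] := leP (A r + m r * x) (u r x).
      have /andP[_ h2] := Hb _ _ a1 h a4.
      by rewrite distrC !ger0_norm ?subr_ge0 ?hb.
    have /andP[_ h2] := Hb _ _ a3 h a2.
    by rewrite [X in K * X]distrC !ger0_norm ?subr_ge0 ?hb.
  have gE : {ae mu, forall x, x \in `]0, l[ -> g (path F w0 r x) = u r x}.
    by apply: (ae_imp (uer rT)) => x Hx xl; rewrite (Hx xl).
  have er := entropy_rate l0 hp al0 cc0 coer sob ibt eqn mA b0 bl (ltW uhi0) uM k0 cb cg
    (path_itg iF iw0 r) bK FE pE gE C0E.
  apply: le_trans er _; rewrite lerD2l lerN2.
  have -> : sqnorm l (fun x => u r x - (A r + m r * x)) = S r.
    have [uL _ _ _] := sob.
    apply: ae_eq_Rintegral; [exact: ml|apply: msq; [exact: in_Lp_meas uL|exact: ma]|exact: msq (mg r) (ma r)|].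
    by apply: (ae_imp gE) => x Hx xl; rewrite (Hx xl).
  have /andP[_ ES] := Eb r (inT r rT).
  have -> : (2 * C0)^-1 * S r = gam * (K * S r).
    by rewrite /gam; field; rewrite !gt_eqF.
  exact: ler_wpM2l.
have mE a b : 0 <= a -> b <= T -> oitg E a b by move=> a0 bT; exact: oitgS iEt.
have if_ a b : oitg f a b.
  have ikab : oitg k a b by apply: itgS ik => //; exact: measurable_itv.
  apply: (@oitg_dom _ _ (fun=> `|l * (C0 * K ^+ 2) / 2| * Kk ^+ 2)).
  - apply: measurable_funM; first exact: measurable_cst.
    by apply: measurable_funX; exact: oitg_meas ikab.
  - exact: oitg_cst.
  move=> x _; rewrite /f normrM ler_wpM2l// ger0_norm ?sqr_ge0//.
  have /andP[kx0 kx1] := kb x.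
  by rewrite ler_pXn2r ?nnegrE// (le_trans kx0).
have f0 r : 0 <= f r.
  by rewrite /f mulr_ge0 ?sqr_ge0// !mulr_ge0 ?sqr_ge0 ?invr_ge0// ltW.
have slope a b : s <= a -> a <= b -> b <= t ->
    E b - E a <= oint (fun r => f r - gam * E r) a b.
  move=> sa_ ab bt_; have a0 := le_trans s0 sa_; have bT := le_trans bt_ tT.
  apply: le_trans (ent a b a0 ab bT) _.
  apply: ae_le_Rintegral.
  - exact: measurable_itv.
  - exact: oitgS iD.
  - by apply: oitgB; [exact: if_|apply: oitgZ; exact: mE].
  apply: (ae_imp rate) => r Hr; rewrite /= in_itv/= => /andP[r1 r2]; apply: Hr.
  by rewrite in_itv/= (le_lt_trans a0 r1) (lt_le_trans r2 bT).
have E0 r : s <= r <= t -> 0 <= E r.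
  move=> /andP[r1 r2]; have rT : 0 <= r <= T by rewrite (le_trans s0 r1) (le_trans r2 tT).
  have /andP[h _] := Eb r rT; apply: le_trans h.
  by rewrite mulr_ge0// divr_ge0// ltW.
have G := gronwall_decay gam0 hst (mE _ _ s0 tT) (if_ s t) E0 f0 slope.
have sT' : 0 <= s <= T by rewrite s0 (le_trans hst).
have tT' : 0 <= t <= T by rewrite tT (le_trans s0).
have /andP[Et _] := Eb t tT'; have /andP[_ Es] := Eb s sT'.
rewrite (SE t tT') (SE s sT').
apply: le_trans Et _; apply: le_trans G _; apply: lerD.
  by rewrite ler_wpM2l ?expR_ge0.
have ce : continuous (fun r : R => expR (- gam * (t - r))).
  move=> r; apply: (@continuous_comp _ _ _ (fun r => - gam * (t - r)) expR).
    by apply: cvgM; [exact: cvg_cst|apply: cvgB; [exact: cvg_cst|exact: cvg_id]].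
  exact: continuous_expR.
apply: oint_le.
- exact: oitgM ce (if_ s t).
- apply: (oitgM ce); apply: oitgZ; exact: oitgS iq.
move=> r _; rewrite ler_wpM2l ?expR_ge0// /f.
have W : 0 <= l * (C0 * K ^+ 2) by rewrite !mulr_ge0 ?sqr_ge0// ltW.
(* The factor 2 in the bound on [k r ^+ 2] cancels the 1/2 left by Young's inequality. *)
have half (x y z : R) : x * y <= x * (2 * z) -> x / 2 * y <= x * z.
  by move=> h; clear - h; lra.
exact: half (ler_wpM2l W (k2 r)).
Qed.

End decay_estimate.

Theorem theorem15 (R : realType) (p l alpha : R) (beta u0 : R -> R)
    (ub dub : R -> R -> R) (ulo uhi : R)
    (hp : 1 < p <= 2)
    (hdata : standing_assumptions p l alpha beta u0 ub dub ulo uhi) :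
  exists c1 c2 gam gam' : R,
    [/\ 0 < c1, 0 < c2, 0 < gam & 0 < gam'] /\
    forall T : R, 0 < T ->
    forall u : R -> R -> R, regular_weak_solution p l alpha beta u0 ub T u ->
    forall U : R -> R -> R, continuous_version 2%:E T l u U ->
    forall uhat : R -> R -> R,
      (forall t : R, 0 <= t <= T ->
         stationary_solution p l alpha (ub t) (uhat t)) ->
    forall s t : R, 0 <= s -> s <= t -> t <= T ->
      sqnorm l (fun x => U t x - uhat t x)
      <= c1 * expR (- gam * (t - s)) * sqnorm l (fun x => U s x - uhat s x)
         + c2 * \int[leb R]_(r in `[s, t]%classic)
                  (expR (- gam' * (t - r)) * sqnorm_bd l (dub r)).
Proof.
have l0 := sa_l hdata; have al0 := sa_alpha hdata; have uu := sa_le hdata.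
have ulo0 := sa_ulo hdata; have uhi0 := sa_uhi hdata.
have c0 : 0 < ulo / 2 by rewrite divr_gt0.
have cd : ulo / 2 <= uhi + 2 by lra.
have cb := sa_beta_cont hdata; have db := sa_beta_C1 hdata.
have [kap [K [kap0 K0 Hb]]] := beta_bilipschitz cb db c0 cd.
have Hb1 x y : ulo / 2 <= x -> x <= y -> y <= uhi + 2 -> kap * (y - x) <= beta y - beta x.
  by move=> h1 h2 h3; case/andP: (Hb x y h1 h2 h3).
have [g [gb gL gh gcd binv]] := clamped_inverse cb db cd kap0 Hb1.
have A0 : 0 <= uhi / l by rewrite divr_ge0// ltW.
have [cc cc0 coer] := mu_p_coercive hp A0.
(* [uhi] bounds the distance of [u] to the profile, and [uhi / l], used for [cc], bounds the slopes
   of the profiles. *)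
pose C0 := l * (2 / alpha + (8 * l + 8 * uhi) / cc).
have C00 : 0 < C0.
  by rewrite mulr_gt0// ltr_wpDr ?divr_gt0// divr_ge0 ?(ltW cc0)// addr_ge0 ?mulr_ge0// ltW.
pose gam := (2 * C0 * K)^-1; have gam0 : 0 < gam.
  by rewrite invr_gt0; apply: mulr_gt0 K0; apply: mulr_gt0 C00.
(* Both prefactors come from dividing the entropy estimate by [kap / 4]; one rate serves for the two
   exponentials. *)
exists (4 / kap * K), (4 / kap * (l * (C0 * K ^+ 2))), gam, gam; split.
  have k4 : 0 < 4 / kap by rewrite divr_gt0.
  split=> //; first exact: mulr_gt0.
  by apply: mulr_gt0 k4 _; apply: mulr_gt0 l0 _; apply: mulr_gt0 C00 _; exact: exprn_gt0.
move=> T T0 u rws U cU uhat st s t s0 hst tT.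
have D := entropy_decay hp hdata kap0 K0 Hb cc0 coer gb gL gh gcd binv (erefl C0) T0 rws cU st
  s0 hst tT.
(* Recalled for the integrability of [sqnorm_bd l (dub r)], which lets the integral be read over the
   open interval and the constant be pulled out. *)
have [A [m [k [Kk [_ _ _ [_ _ iq _ _]]]]]] := stationary_curve hp hdata T0 st.
have ce : continuous (fun r : R => expR (- gam * (t - r))).
  move=> r; apply: (@continuous_comp _ _ _ (fun r => - gam * (t - r)) expR).
    by apply: cvgM; [exact: cvg_cst|apply: cvgB; [exact: cvg_cst|exact: cvg_id]].
  exact: continuous_expR.
have ie : oitg (fun r => expR (- gam * (t - r)) * sqnorm_bd l (dub r)) s t.
  by apply: (oitgM ce); exact: oitgS iq.
rewrite (oint_cc ie).
rewrite (@oint_eq _ _ (fun r => l * (C0 * K ^+ 2) *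
  (expR (- gam * (t - r)) * sqnorm_bd l (dub r)))) in D; last first.
  by move=> r _; rewrite mulrCA.
rewrite (ointZ _ ie) in D.
have k4 : 0 < kap / 4 by rewrite divr_gt0.
rewrite -(ler_pM2l k4); apply: le_trans D _; rewrite le_eqVlt; apply/orP; left; apply/eqP.
by rewrite -/gam; field; rewrite gt_eqF.
Qed.
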